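(* Let $N\ge2$ and $z\in\mathbb{C}\setminus\{0\}$. Set $\delta=N|z|^2$, $$a=\frac{\delta}{2}+\sqrt{1+\frac{\delta^2}{4}},\qquad b=-a^{-1}=\frac{\delta}{2}-\sqrt{1+\frac{\delta^2}{4}}.$$ Conditionally on $\{\lambda_1=0,\lambda_2=z\}$, we have $$\mathbb{E}(|\mathscr{O}_{12}|^2)=\frac{1}{1+a^2}\left(\frac{a^2}{(a+1)^2}d_{N-2}(a,\delta)+\frac{a^2}{(a-1)^2}d_{N-2}(b,\delta)\right),$$ $$\mathbb{E}(\mathscr{O}_{11}\mathscr{O}_{22})=\frac{1}{1+a^2}\left(\frac{1}{(a+1)^2}d_{N-2}(a,\delta)+\frac{a^4}{(a-1)^2}d_{N-2}(b,\delta)\right),$$ where $$u_k(x)=1-\frac{1-x^{-1}}{k+3},$$ $$d_k(x,\delta)=\frac{(k+2)(k+3)}{e_1^{(k+1)}(\delta)}\left(\frac{u_k(x)}{(x-1)^2}e_3^{(k)}(\delta)-\frac{\delta\,u_k(x)}{2x}+\frac{1}{(x-1)^2}\,\frac{x^2+(k+2)x+(k+1)(k+3)}{(k+3)!}\,\delta^{k+1}\right).$$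
   Context: Let $G=G_N$ be an $N\times N$ complex Ginibre matrix: its entries are i.i.d. centered complex Gaussians with density $\frac{N}{\pi}e^{-N|w|^2}$ with respect to Lebesgue measure on $\mathbb{C}$ (so $\mathbb{E}|G_{ij}|^2=1/N$). Its eigenvalues are a.s. distinct and are labelled exchangeably, so that $(\lambda_1,\dots,\lambda_N)$ has joint density proportional to $\prod_{j<k}|\lambda_j-\lambda_k|^2\prod_k e^{-N|\lambda_k|^2}$. Let $R_i$, $L_i$ be column vectors with $GR_i=\lambda_iR_i$, $L_i^{t}G=\lambda_iL_i^{t}$, normalized by $L_i^{t}R_j=\delta_{ij}$. The overlaps are $\mathscr{O}_{ij}=(R_j^*R_i)(L_j^*L_i)$; they do not depend on the remaining choice of scaling. Conditioning on $\lambda_1=0,\lambda_2=z$ means: $\lambda_3,\dots,\lambda_N$ have joint density (with respect to Lebesgue measure on $\mathbb{C}^{N-2}$) proportional to $\prod_{3\le j<k\le N}|\lambda_j-\lambda_k|^2\prod_{k=3}^N|\lambda_k|^2|z-\lambda_k|^2e^{-N|\lambda_k|^2}$; and, given all eigenvalues, the overlaps are distributed as those of the upper triangular matrix $T$ (Schur form of $G$) with diagonal $\lambda_1,\dots,\lambda_N$ and with independent centered complex Gaussian entries of variance $1/N$ (same law as $G_{ij}$) strictly above the diagonal. Partial exponential sums: $e_k^{(\ell)}(x)=\sum_{i=k}^{\ell}\frac{x^i}{i!}$, with the usual convention $\sum_{i=k}^{\ell}=-\sum_{i=\ell+1}^{k-1}$ when $\ell<k-1$ and $\sum_{i=k}^{k-1}=0$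 (equivalently $e_k^{(\ell)}=e_0^{(\ell)}-e_0^{(k-1)}$ for $k\ge1$). *)

(* Defs.v *)
From HB Require Import structures.
From mathcomp Require Import all_boot all_order all_algebra.
From mathcomp Require Import spectral complex.
From mathcomp Require Import all_classical all_reals all_analysis.
From mathcomp Require Import measurable_realfun.
From mathcomp Require Import ring.

Set Implicit Arguments.
Unset Strict Implicit.
Unset Printing Implicit Defensive.

Import Order.TTheory GRing.Theory Num.Theory.
Import numFieldNormedType.Exports.
Import Normc.

Local Open Scope classical_set_scope.
Local Open Scope ring_scope.
Local Open Scope complex_scope.
Local Open Scope sesquilinear_scope.

(* The sigma-finite structure of a product measure is not inferred by the library
   (the instance on products of subprobabilities takes precedence), hence this
   copy of m1 \x m2. *)
Definition sfproduct d1 d2 (T1 : measurableType d1) (T2 : measurableType d2)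
    (R : realType) (m1 : {sigma_finite_measure set T1 -> \bar R})
    (m2 : {sigma_finite_measure set T2 -> \bar R}) :
  set (T1 * T2)%type -> \bar R := (m1 \x m2)%E.

Section sfproduct.
Context d1 d2 (T1 : measurableType d1) (T2 : measurableType d2) (R : realType).
Variables (m1 : {sigma_finite_measure set T1 -> \bar R})
          (m2 : {sigma_finite_measure set T2 -> \bar R}).

HB.instance Definition _ := Measure.copy (sfproduct m1 m2) (m1 \x m2)%E.

Let sfproduct_sigma_finite : sigma_finite setT (sfproduct m1 m2).
Proof.
have /sigma_finiteP[F [TF ndF Foo]] := sigma_finiteT m1.
have /sigma_finiteP[G [TG ndG Goo]] := sigma_finiteT m2.
exists (fun n => F n `*` G n).
  rewrite -setXTT TF TG predeqE => -[x y]; split.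
    move=> [/= [n _ Fnx] [k _ Gky]]; exists (maxn n k) => //; split.
    - by move: x Fnx; exact/subsetPset/ndF/leq_maxl.
    - by move: y Gky; exact/subsetPset/ndG/leq_maxr.
  by move=> [n _ []/= ? ?]; split; exists n.
move=> k; have [? ?] := Foo k; have [? ?] := Goo k.
split; first exact: measurableX.
by rewrite /sfproduct product_measure1E// lte_mul_pinfty// ge0_fin_numE.
Qed.

HB.instance Definition _ := Measure_isSigmaFinite.Build _ _ _
  (sfproduct m1 m2) sfproduct_sigma_finite.

End sfproduct.

Section cons_measure.
Context d (T : measurableType d) (R : realType) (n : nat).
Variables (mu : {sigma_finite_measure set T -> \bar R})
          (m : {sigma_finite_measure set (n.-tuple T) -> \bar R}).

(* The image of the product measure on T * T^n under T * T^n = T^(n+1). *)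
Definition cons_measure : set (n.+1.-tuple T) -> \bar R :=
  pushforward (sfproduct mu m)
    (fun p : T * n.-tuple T => [the n.+1.-tuple T of p.1 :: p.2]).

Let cons_pair (p : T * n.-tuple T) : n.+1.-tuple T :=
  [the n.+1.-tuple T of p.1 :: p.2].
Let uncons (t : n.+1.-tuple T) : T * n.-tuple T :=
  (thead t, [tuple of behead t]).

Let measurable_cons_pair : measurable_fun setT cons_pair.
Proof. exact: measurable_cons. Qed.

Let measurable_uncons : measurable_fun setT uncons.
Proof.
apply/measurable_fun_pair; first exact: measurable_tnth.
exact: measurable_behead.
Qed.

Let cons_pairK : cancel cons_pair uncons.
Proof. by move=> [x t]; congr pair; exact: val_inj. Qed.

Let cons_measure0 : cons_measure set0 = 0%E.
Proof. by rewrite /cons_measure /pushforward preimage_set0 measure0. Qed.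

Let cons_measure_ge0 A : (0 <= cons_measure A)%E.
Proof. exact: measure_ge0. Qed.

Let cons_measure_sigma_additive : semi_sigma_additive cons_measure.
Proof.
move=> F mF tF mUF; rewrite /cons_measure /pushforward preimage_bigcup.
have mcF (A : set (n.+1.-tuple T)) :
  measurable A -> measurable (cons_pair @^-1` A).
  by move=> mA; rewrite -[X in measurable X]setTI; exact: measurable_cons_pair.
apply: measure_semi_sigma_additive.
- by move=> k; exact: mcF.
- apply/trivIsetP => /= i j _ _ ij; rewrite -preimage_setI.
  by move/trivIsetP : tF => /(_ _ _ _ _ ij) ->//; rewrite preimage_set0.
- by rewrite -preimage_bigcup; exact: mcF.
Qed.

HB.instance Definition _ := isMeasure.Build _ _ _ cons_measure
  cons_measure0 cons_measure_ge0 cons_measure_sigma_additive.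

Let cons_measure_sigma_finite : sigma_finite setT cons_measure.
Proof.
have [F TF Foo] := sigma_finiteT (sfproduct mu m).
exists (fun k => uncons @^-1` F k).
  by rewrite -preimage_bigcup -TF preimage_setT.
move=> k; have [mFk Fkoo] := Foo k; split.
  by rewrite -[X in measurable X]setTI; exact: measurable_uncons.
rewrite /cons_measure /pushforward -comp_preimage.
rewrite (_ : _ \o _ = id) ?preimage_id//.
by apply/funext => p /=; rewrite -[RHS]cons_pairK.
Qed.

HB.instance Definition _ := Measure_isSigmaFinite.Build _ _ _ cons_measure
  cons_measure_sigma_finite.

End cons_measure.

Fixpoint tuple_measure d (T : measurableType d) (R : realType)
    (mu : {sigma_finite_measure set T -> \bar R}) (n : nat) :
    {sigma_finite_measure set (n.-tuple T) -> \bar R} :=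
  if n is n'.+1 then cons_measure mu (tuple_measure mu n')
  else dirac [tuple].

Lemma tuple_measure_box d (T : measurableType d) (R : realType)
    (mu : {sigma_finite_measure set T -> \bar R}) (n : nat) (A : 'I_n -> set T) :
  (forall i, measurable (A i)) ->
  tuple_measure mu n [set t | forall i, A i (tnth t i)]
  = (\prod_(i < n) mu (A i))%E.
Proof.
elim: n A => [|n IHn] A mA /=.
  rewrite big_ord0 diracE mem_set//= => -[].
  by [].
rewrite big_ord_recl -IHn//.
rewrite /cons_measure /pushforward/= -product_measure1E//; last first.
  rewrite (_ : mkset _ = \bigcap_(i in [set: 'I_n])
      ((@tnth _ T ^~ i) @^-1` (A (lift ord0 i)))).
    apply: fin_bigcap_measurable => // i _.
    by rewrite -[X in measurable X]setTI; exact: measurable_tnth.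
  by apply/seteqP; split => t /= At i => [_|]; apply: At.
congr (_ _); apply/seteqP; split => -[x t] /=.
  move=> At; split; first exact: (At ord0).
  by move=> i; have := At (lift ord0 i); rewrite tnthS.
move=> [Ax At] i; case: (unliftP ord0 i) => [j|] ->; last exact: Ax.
by rewrite tnthS; exact: At.
Qed.

Section density_measure.
Context d (T : measurableType d) (R : realType).
Variables (mu : {measure set T -> \bar R}) (f : T -> R).
Hypotheses (mf : measurable_fun setT f) (f0 : forall x, 0 <= f x).

(* The measure with density f with respect to mu. The proofs mf and f0 are
   arguments, so that the measure structure can be inferred. *)
Definition density_measure of measurable_fun setT f & (forall x, 0 <= f x) :=
  fun A : set T => (\int[mu]_(x in A) (f x)%:E)%E.

Local Notation nu := (density_measure mf f0).

Let nu0 : nu set0 = 0%E.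
Proof. by rewrite /density_measure integral_set0. Qed.

Let nu_ge0 A : (0 <= nu A)%E.
Proof. by apply: integral_ge0 => x _; rewrite lee_fin. Qed.

Let nu_sigma_additive : semi_sigma_additive nu.
Proof.
move=> F mF tF mUF; rewrite /density_measure ge0_integral_bigcup//.
- by apply: is_cvg_ereal_nneg_natsum_cond => k _ _; exact: nu_ge0.
- by apply/measurable_EFinP; exact: measurable_funTS.
- by move=> x _; rewrite lee_fin.
Qed.

HB.instance Definition _ := isMeasure.Build _ _ _ nu
  nu0 nu_ge0 nu_sigma_additive.

End density_measure.


(* Points of the complex plane are pairs of reals when integrating (so that they
   carry the Borel sigma-algebra and Lebesgue measure), and are converted to
   R[i] for the algebra. *)
Notation plane R := (measurableTypeR R * measurableTypeR R)%type.

Definition toC (R : realType) (w : plane R) : R[i] := w.1 +i* w.2.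

Definition lebesgueC (R : realType) :
    {sigma_finite_measure set (plane R) -> \bar R} :=
  sfproduct (@lebesgue_measure R) (@lebesgue_measure R).

Definition ginibre_density (R : realType) (N : nat) (w : R[i]) : R :=
  N%:R / pi * expR (- (N%:R * normc w ^+ 2)).

(* Unnormalized density of (lambda_3, ..., lambda_N) given lambda_1 = 0 and
   lambda_2 = z, with N = n + 2; tnth lam k stands for lambda_(k+3). *)
Definition eigenvalue_weight (R : realType) (n : nat) (z : R[i])
    (lam : n.-tuple (plane R)) : R :=
  let l k := toC (tnth lam k) in
  (\prod_(j < n) \prod_(k < n | (j < k)%N) normc (l j - l k) ^+ 2) *
  \prod_(k < n) (normc (l k) ^+ 2 * normc (z - l k) ^+ 2 *
                 expR (- (n.+2%:R * normc (l k) ^+ 2))).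

(* Positions strictly above the diagonal of an N x N matrix. *)
Definition upper (N : nat) := {p : 'I_N * 'I_N | (p.1 < p.2)%N}.

(* The free eigenvalues, and the entries above the diagonal of the Schur form
   listed along the enumeration of the positions. *)
Notation schur_space R n :=
  (n.-tuple (plane R) * #|{: upper n.+2}|.-tuple (plane R))%type.

Definition schur_density (R : realType) (n : nat) (z : R[i])
    (w : schur_space R n) : R :=
  eigenvalue_weight z w.1 *
  \prod_(u : upper n.+2)
     ginibre_density n.+2 (toC (tnth w.2 (enum_rank u))).

Section schur_density_facts.
Context (R : realType).

Lemma ginibre_density_ge0 N (w : R[i]) : 0 <= ginibre_density N w.
Proof. by rewrite mulr_ge0 ?expR_ge0// divr_ge0 ?pi_ge0. Qed.

Lemma schur_density_ge0 n z (w : schur_space R n) : 0 <= schur_density z w.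
Proof.
apply: mulr_ge0; first apply: mulr_ge0.
- by apply: prodr_ge0 => j _; apply: prodr_ge0 => k _; exact: sqr_ge0.
- apply: prodr_ge0 => k _; apply: mulr_ge0; last exact: expR_ge0.
  by rewrite mulr_ge0 ?sqr_ge0.
- by apply: prodr_ge0 => u _; exact: ginibre_density_ge0.
Qed.

Lemma normc_sqr (w : R[i]) :
  normc w ^+ 2 = complex.Re w ^+ 2 + complex.Im w ^+ 2.
Proof. by case: w => a b /=; rewrite sqr_sqrtr// addr_ge0 ?sqr_ge0. Qed.

Lemma measurable_normc_sqr d (T : measurableType d) (f : T -> R[i]) :
  measurable_fun setT (fun x => complex.Re (f x)) ->
  measurable_fun setT (fun x => complex.Im (f x)) ->
  measurable_fun setT (fun x => normc (f x) ^+ 2).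
Proof.
move=> mRe mIm.
rewrite (_ : (fun _ => _) =
  (fun x => complex.Re (f x) ^+ 2 + complex.Im (f x) ^+ 2)); last first.
  by apply/funext => x; exact: normc_sqr.
by apply: measurable_funD; exact: measurable_funX.
Qed.

Let mRe n (i : 'I_n) :
  measurable_fun setT (fun t : n.-tuple (plane R) => (tnth t i).1 : R).
Proof.
by apply: (measurableT_comp measurable_fst); exact: measurable_tnth.
Qed.

Let mIm n (i : 'I_n) :
  measurable_fun setT (fun t : n.-tuple (plane R) => (tnth t i).2 : R).
Proof.
by apply: (measurableT_comp measurable_snd); exact: measurable_tnth.
Qed.

Lemma measurable_ginibre_density d (T : measurableType d) N (f : T -> R[i]) :
  measurable_fun setT (fun x => complex.Re (f x)) ->
  measurable_fun setT (fun x => complex.Im (f x)) ->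
  measurable_fun setT (fun x => ginibre_density N (f x)).
Proof.
move=> mR mI; apply: measurable_funM => //.
apply: (measurableT_comp (@measurable_expR R)).
apply: measurableT_comp => //; apply: measurable_funM => //.
exact: measurable_normc_sqr.
Qed.

Lemma measurable_eigenvalue_weight n (z : R[i]) :
  measurable_fun setT (@eigenvalue_weight R n z).
Proof.
apply: measurable_funM.
  apply: measurable_prod => j _.
  rewrite (_ : (fun _ => _) = (fun lam => \prod_(k < n)
    if (j < k)%N then normc (toC (tnth lam j) - toC (tnth lam k)) ^+ 2 else 1));
    last by apply/funext => lam; exact: big_mkcond.
  apply: measurable_prod => k _; case: (j < k)%N => //.
  apply: measurable_normc_sqr => /=.
  - by apply: measurable_funB; exact: mRe.
  - by apply: measurable_funB; exact: mIm.
apply: measurable_prod => k _.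
have mk : measurable_fun setT
    (fun lam : n.-tuple (plane R) => normc (toC (tnth lam k)) ^+ 2).
  by apply: measurable_normc_sqr; [exact: mRe|exact: mIm].
apply: measurable_funM; first apply: measurable_funM => //.
  case: z => a b; apply: measurable_normc_sqr => /=.
  - by apply: measurable_funB; [exact: measurable_cst|exact: mRe].
  - by apply: measurable_funB; [exact: measurable_cst|exact: mIm].
apply: (measurableT_comp (@measurable_expR R)).
by apply: measurableT_comp => //; apply: measurable_funM.
Qed.

Lemma measurable_schur_density n (z : R[i]) :
  measurable_fun setT (@schur_density R n z).
Proof.
apply: measurable_funM.
  exact: (measurableT_comp (measurable_eigenvalue_weight z) measurable_fst).
apply: measurable_prod => u _; apply: measurable_ginibre_density.
- exact: (measurableT_comp (mRe _) measurable_snd).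
- exact: (measurableT_comp (mIm _) measurable_snd).
Qed.

End schur_density_facts.

(* Law of the Schur form conditionally on lambda_1 = 0 and lambda_2 = z: its
   density with respect to Lebesgue measure is proportional to schur_density.
   (The second argument of mnormalize is only a default value for measures whose
   mass is 0 or infinite.) *)
Definition schur_law (R : realType) (n : nat) (z : R[i]) :
    probability (schur_space R n) R :=
  mnormalize
    (density_measure
       (sfproduct (tuple_measure (lebesgueC R) n)
                  (tuple_measure (lebesgueC R) #|{: upper n.+2}|))
       (measurable_schur_density z) (@schur_density_ge0 R n z))
    (dirac point).

Definition spectrum (R : realType) (n : nat) (z : R[i])
    (w : schur_space R n) (i : 'I_n.+2) : R[i] :=
  nth 0 [:: 0, z & [seq toC x | x <- w.1]] i.

Definition schur_mx (R : realType) (n : nat) (z : R[i])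
    (w : schur_space R n) : 'M[R[i]]_n.+2 :=
  \matrix_(i, j)
    if i == j then spectrum z w i
    else if insub (i, j) is Some u then toC (tnth w.2 (enum_rank (u : upper n.+2)))
    else 0.

Section overlap.
Context (R : realType) (N : nat).
Implicit Types (G : 'M[R[i]]_N) (lambda : 'I_N -> R[i]).

Definition biorthogonal_eigenvectors G lambda (Rv Lv : 'I_N -> 'cV[R[i]]_N) :=
  [/\ forall i, G *m Rv i = lambda i *: Rv i,
      forall i, (Lv i)^T *m G = lambda i *: (Lv i)^T &
      forall i j, (Lv i)^T *m Rv j = ((i == j)%:R)%:M].

(* The overlap (R_j^* R_i) (L_j^* L_i), which does not depend on the choice of
   the eigenvectors when the eigenvalues lambda_1, ..., lambda_N of G are
   distinct; it is set to 0 if they are not. *)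
Definition overlap G lambda (i j : 'I_N) : R[i] :=
  xget 0 [set o | injective lambda /\
    exists Rv Lv, biorthogonal_eigenvectors G lambda Rv Lv /\
      o = ((Rv j)^t* *m Rv i) 0 0 * ((Lv j)^t* *m Lv i) 0 0].

End overlap.

Definition schur_overlap (R : realType) (n : nat) (z : R[i])
    (i j : 'I_n.+2) (w : schur_space R n) : R[i] :=
  overlap (schur_mx z w) (spectrum z w) i j.

(* E[X] = m for complex X. As m is finite, each equality forces the positive and
   negative parts of the integrand to have finite integrals. *)
Definition complex_mean d (T : measurableType d) (R : realType)
    (P : probability T R) (X : T -> R[i]) (m : R[i]) : Prop :=
  ('E_P[fun w => complex.Re (X w)] = (complex.Re m)%:E /\
   'E_P[fun w => complex.Im (X w)] = (complex.Im m)%:E)%E.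

Section closed_form.
Context (R : realType).
Implicit Types (k l : nat) (x delta : R).

(* sum_{i=k}^l x^i/i!, with the convention
   sum_{i=k}^l = - sum_{i=l+1}^{k-1} if l < k - 1. *)
Definition partial_exp k l x : R :=
  if (k <= l.+1)%N then \sum_(k <= i < l.+1) x ^+ i / i`!%:R
  else - \sum_(l.+1 <= i < k) x ^+ i / i`!%:R.

Definition u_ k x : R := 1 - (1 - x^-1) / (k + 3)%:R.

Definition d_ k x delta : R :=
  (k + 2)%:R * (k + 3)%:R / partial_exp 1 (k + 1) delta *
  (u_ k x / (x - 1) ^+ 2 * partial_exp 3 k delta
   - delta * u_ k x / (2 * x)
   + ((x - 1) ^+ 2)^-1 *
     ((x ^+ 2 + (k + 2)%:R * x + (k + 1)%:R * (k + 3)%:R) / (k + 3)`!%:R) *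
     delta ^+ (k + 1)).

Definition a_ delta : R := delta / 2 + Num.sqrt (1 + delta ^+ 2 / 4).

Definition b_ delta : R := - (a_ delta)^-1.

Lemma b_E delta : b_ delta = delta / 2 - Num.sqrt (1 + delta ^+ 2 / 4).
Proof.
have s2 : Num.sqrt (1 + delta ^+ 2 / 4) ^+ 2 = 1 + delta ^+ 2 / 4.
  by rewrite sqr_sqrtr// addr_ge0// divr_ge0// sqr_ge0.
rewrite /b_ /a_; set s := Num.sqrt _ in s2 *.
have ab : (delta / 2 + s) * (delta / 2 - s) = -1.
  by rewrite mulrC -subr_sqr s2; field.
have a0 : delta / 2 + s != 0.
  by apply/eqP => a0; move: ab; rewrite a0 mul0r => /esym/eqP; rewrite oppr_eq0 oner_eq0.
by apply: (mulfI a0); rewrite ab mulrN divff.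
Qed.

End closed_form.

(* Main.v *)
(** Let N = n + 2 and let T be the Schur form. The left eigenvectors b, d of T for
    the eigenvalues 0 and z satisfy a triangular recursion: b_k and d_k are, up to
    the factors 1 / (0 - lambda_k) and 1 / (z - lambda_k), the products of the
    previous entries with the k-th column of T. The overlaps are functions of b_2
    and of B = sum |b_k|^2, D = sum |d_k|^2, C = sum b_k (d_k)^*. Integrating the
    Gaussian columns one after the other (Wick's formula for two pairs) turns the
    pair (B D, |C|^2) into its product with
      (1 + (p + q) / N) I + (p q / N^2) [[1, 1], [1, 1 - delta]],
    where p = 1 / |lambda_k|^2 and q = 1 / |z - lambda_k|^2. The second matrix does
    not depend on k; its eigenvalues are 1 - a and 1 - b. Hence the conditional
    means given the eigenvalues are combinations of two scalar products over k.
    By Andreief's formula the integral of such a product against the squared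
    Vandermonde determinant is n! times the determinant of a moment matrix, which
    is tridiagonal because the weights involve z - lambda only through
    |z - lambda|^2. Its three-term recurrence is solved by the closed form d_k. *)

Require Import Defs.
From HB Require Import structures.
From mathcomp Require Import all_boot all_order all_algebra.
From mathcomp Require Import all_fingroup.
From mathcomp Require Import spectral complex.
From mathcomp Require Import all_classical all_reals all_analysis.
From mathcomp Require Import measurable_realfun ring lra zify.
Import Order.TTheory GRing.Theory Num.Theory.
Import numFieldNormedType.Exports.
Import Normc.
Local Open Scope classical_set_scope.
Local Open Scope ring_scope.
Local Open Scope complex_scope.

Set Implicit Arguments.
Unset Strict Implicit.
Unset Printing Implicit Defensive.

(** * Integrals of real and complex functions *)

(** The pair (B D, |C|^2) closes under the recursion because the cross terms can be eliminated: a' =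
    1/(0 - l) and b' = 1/(z - l) satisfy a' - b' = z a' b', so 2 Re(a' conj(b')) = p + q - |z|^2 p
    q. The last term, divided by N, is the entry -delta in p q / N^2. As the eigenvectors (a, 1) and
    (1, -a) are common to all columns, the product of matrices becomes two products of scalars.

    The entry b_2 is carried along as a weight, because it also enters the right eigenvectors R_1 =
    e_1 and R_2 = e_2 - b_2 e_1: hence O_12 = - conj(b_2) C and O_11 O_22 = (1 + |b_2|^2) B D.

    Conditional averages over columns are taken algebraically, on polynomials in the Gaussian
    entries, with disjointness of variables for independence; integrals serve to show that the mean
    is well defined. Multiplied by |l|^2 |z - l|^2 from the density, the scalar factor of a column
    is again a polynomial in l and conj(l), so everything reduces to Gaussian moments. The
    convention 0^-1 = 0 spoils this at l = 0 and l = z only, a null set. *)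

Section has_integral.
Context d (T : measurableType d) (R : realType).
Implicit Types (mu : {measure set T -> \bar R}) (f g : T -> R).

(** Integrability is bundled with the value: the extended-real integral is total, so its value alone
    does not allow signed functions to be integrated term by term. *)
Definition has_integral mu f (r : R) : Prop :=
  mu.-integrable setT (EFin \o f) /\ (\int[mu]_x (f x)%:E = r%:E)%E.

Lemma has_integral_unique mu f r s :
  has_integral mu f r -> has_integral mu f s -> r = s.
Proof. by move=> [_ fr] [_ fs]; apply: EFin_inj; rewrite -fr. Qed.

Lemma has_integral_measurable mu f r :
  has_integral mu f r -> measurable_fun setT f.
Proof. by move=> [/measurable_int/measurable_EFinP]. Qed.

Lemma has_integral0 mu : has_integral mu (fun=> 0) 0.
Proof. by split; [exact: integrable0|rewrite integral0]. Qed.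

Lemma has_integralD mu f g r s :
  has_integral mu f r -> has_integral mu g s ->
  has_integral mu (fun x => f x + g x) (r + s).
Proof.
move=> [fi fr] [gi gs]; split.
  have := integrableD measurableT fi gi.
  by apply: eq_integrable => // x _; rewrite /= EFinD.
under eq_integral do rewrite EFinD.
by rewrite integralD// fr gs.
Qed.

Lemma has_integralZ mu f r (k : R) :
  has_integral mu f r -> has_integral mu (fun x => k * f x) (k * r).
Proof.
move=> [fi fr]; split.
  by have := integrableZl measurableT k fi; apply: eq_integrable.
under eq_integral do rewrite EFinM.
by rewrite integralZl// fr.
Qed.

Lemma has_integralB mu f g r s :
  has_integral mu f r -> has_integral mu g s ->
  has_integral mu (fun x => f x - g x) (r - s).
Proof.
move=> fr gs; rewrite -mulN1r; under eq_fun do rewrite -[- g _]mulN1r.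
by apply: has_integralD fr _; exact: has_integralZ.
Qed.

(** Measurability of [g] is assumed because [mu] need not be complete. The use is an integrand that
    agrees with a polynomial weight off two points. *)
Lemma has_integral_ae mu f g r : measurable_fun setT g ->
  ae_eq mu setT (EFin \o f) (EFin \o g) -> has_integral mu f r -> has_integral mu g r.
Proof.
move=> mg fg [fi fr].
have mf := measurable_int _ fi.
have mg' : measurable_fun setT (EFin \o g) by exact/measurable_EFinP.
split; last by rewrite -fr; apply/esym/ae_eq_integral.
move/integrableP : fi => [_ fi]; apply/integrableP; split => //.
apply: le_lt_trans fi; rewrite le_eqVlt; apply/orP; left; apply/eqP.
apply: ge0_ae_eq_integral => //; [exact: measurableT_comp..|].
by apply: filterS fg => x /= /[swap] xT /(_ xT) [->].
Qed.

Lemma ge0_has_integral mu f r : measurable_fun setT f -> (forall x, 0 <= f x) ->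
  (\int[mu]_x (f x)%:E = r%:E)%E -> has_integral mu f r.
Proof.
move=> mf f0 fr; split => //; apply/integrableP; split; first exact/measurable_EFinP.
under eq_integral do rewrite /= ger0_norm//.
by rewrite fr ltry.
Qed.

End has_integral.

(** Tonelli's theorem for |f| |g| gives integrability on the product; Fubini's theorem then
    evaluates the iterated integral. *)
Lemma has_integral_prod d1 d2 (T1 : measurableType d1) (T2 : measurableType d2)
    (R : realType) (m1 : {sigma_finite_measure set T1 -> \bar R})
    (m2 : {sigma_finite_measure set T2 -> \bar R}) (f : T1 -> R) (g : T2 -> R) r s :
  has_integral m1 f r -> has_integral m2 g s ->
  has_integral (sfproduct m1 m2) (fun p => f p.1 * g p.2) (r * s).
Proof.
move=> fr gs.
have mf := has_integral_measurable fr.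
have mg := has_integral_measurable gs.
case: fr gs => fi fr [gi gs].
have mfg : measurable_fun setT (EFin \o (fun p : T1 * T2 => f p.1 * g p.2)).
  apply/measurable_EFinP; apply: measurable_funM.
    exact: (measurableT_comp mf measurable_fst).
  exact: (measurableT_comp mg measurable_snd).
have inner x : (\int[m2]_y (f x * g y)%:E = (f x * s)%:E)%E.
  under eq_integral do rewrite EFinM.
  by rewrite integralZl// gs.
have fgi : (m1 \x m2)%E.-integrable setT (EFin \o (fun p : T1 * T2 => f p.1 * g p.2)).
  apply/integrable12ltyP => //.
  have [/integrableP[_ fo] /integrableP[mg' go]] := (fi, gi).
  have go' : (\int[m2]_y `|(g y)%:E| \is a fin_num)%E.
    by rewrite ge0_fin_numE//; apply: integral_ge0.
  rewrite (eq_integral (fun x => `|(f x)%:E| * (\int[m2]_y `|(g y)%:E|))%E); last first.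
    move=> x _; under eq_integral do rewrite /= normrM EFinM.
    rewrite ge0_integralZl//; by do 2 apply: measurableT_comp => //; exact/measurable_EFinP.
  rewrite -(fineK go') ge0_integralZr//.
  - apply: lte_mul_pinfty; [exact: integral_ge0| |exact: ltry].
    by rewrite ge0_fin_numE//; exact: integral_ge0.
  - by do 2 apply: measurableT_comp => //; exact/measurable_EFinP.
  - by rewrite lee_fin fine_ge0// integral_ge0.
split => //.
rewrite -(integral12_prod_meas1 fgi) /fubini_F/=.
under eq_integral do rewrite inner mulrC EFinM.
by rewrite integralZl// fr -EFinM mulrC.
Qed.

Lemma has_integral_cons d (T : measurableType d) (R : realType) (n : nat)
    (mu : {sigma_finite_measure set T -> \bar R})
    (m : {sigma_finite_measure set (n.-tuple T) -> \bar R})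
    (f : n.+1.-tuple T -> R) r : measurable_fun setT f ->
  has_integral (sfproduct mu m)
    (fun p => f [the n.+1.-tuple T of p.1 :: p.2]) r ->
  has_integral (cons_measure mu m) f r.
Proof.
move=> mf [fi fr].
have mc : measurable_fun setT (fun p : T * n.-tuple T => [the n.+1.-tuple T of p.1 :: p.2]).
  exact: measurable_cons.
have mf' : measurable_fun setT (EFin \o f) by exact/measurable_EFinP.
split; first exact: (integrable_pushforward mc mf' _ measurableT).
rewrite -fr; exact: (integral_pushforward mc mf' _ measurableT).
Qed.

Section complex_parts.
Context (R : rcfType).
Implicit Types x y : R[i].

Lemma complexRe_mul x y : complex.Re (x * y) =
  complex.Re x * complex.Re y - complex.Im x * complex.Im y.
Proof. by case: x y => a b [c e]. Qed.

Lemma complexIm_mul x y : complex.Im (x * y) =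
  complex.Re x * complex.Im y + complex.Im x * complex.Re y.
Proof. by case: x y => a b [c e]. Qed.

Lemma complexRe_conj x : complex.Re x^*%C = complex.Re x.
Proof. by case: x. Qed.

Lemma complexIm_conj x : complex.Im x^*%C = - complex.Im x.
Proof. by case: x. Qed.

End complex_parts.

Section has_cintegral.
Context d (T : measurableType d) (R : realType).
Implicit Types (mu : {measure set T -> \bar R}) (f g : T -> R[i]).

Definition has_cintegral mu f (c : R[i]) : Prop :=
  has_integral mu (fun x => complex.Re (f x)) (complex.Re c) /\
  has_integral mu (fun x => complex.Im (f x)) (complex.Im c).

Lemma has_cintegral_unique mu f b c :
  has_cintegral mu f b -> has_cintegral mu f c -> b = c.
Proof.
move=> [+ +] [+ +]; case: b c => b1 b2 [c1 c2] /= r1 i1 r2 i2.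
by rewrite (has_integral_unique r1 r2) (has_integral_unique i1 i2).
Qed.

Lemma has_cintegral0 mu : has_cintegral mu (fun=> 0) 0.
Proof. by split; exact: has_integral0. Qed.

Lemma has_cintegral_real mu (f : T -> R) r :
  has_integral mu f r -> has_cintegral mu (fun x => (f x)%:C) r%:C.
Proof. by split => //; exact: has_integral0. Qed.

Lemma has_cintegralD mu f g b c :
  has_cintegral mu f b -> has_cintegral mu g c ->
  has_cintegral mu (fun x => f x + g x) (b + c).
Proof.
move=> [fr fi] [gr gi]; split.
  under eq_fun do rewrite raddfD; rewrite raddfD; exact: has_integralD.
under eq_fun do rewrite raddfD; rewrite raddfD; exact: has_integralD.
Qed.

Lemma has_cintegralZ mu f b (k : R[i]) :
  has_cintegral mu f b -> has_cintegral mu (fun x => k * f x) (k * b).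
Proof.
move=> [fr fi]; split.
  under eq_fun do rewrite complexRe_mul; rewrite complexRe_mul.
  by apply: has_integralB; exact: has_integralZ.
under eq_fun do rewrite complexIm_mul; rewrite complexIm_mul.
by apply: has_integralD; exact: has_integralZ.
Qed.

Lemma has_cintegral_sum mu (I : Type) (s : seq I) (P : pred I)
    (f : I -> T -> R[i]) (c : I -> R[i]) :
  (forall i, P i -> has_cintegral mu (f i) (c i)) ->
  has_cintegral mu (fun x => \sum_(i <- s | P i) f i x) (\sum_(i <- s | P i) c i).
Proof.
move=> fc; elim: s => [|i s IHs].
  under eq_fun do rewrite big_nil; rewrite big_nil; exact: has_cintegral0.
under eq_fun do rewrite big_cons; rewrite big_cons.
by case: ifPn => Pi //; exact: has_cintegralD (fc i Pi) _.
Qed.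

Lemma has_cintegral_ae mu f g c :
  measurable_fun setT (fun x => complex.Re (g x)) ->
  measurable_fun setT (fun x => complex.Im (g x)) ->
  ae_eq mu setT f g -> has_cintegral mu f c -> has_cintegral mu g c.
Proof.
move=> mr mi fg [fr fi]; split.
  apply: (has_integral_ae mr _ fr).
  by apply: filterS fg => x /= /[swap] xT /(_ xT) ->.
apply: (has_integral_ae mi _ fi).
by apply: filterS fg => x /= /[swap] xT /(_ xT) ->.
Qed.

End has_cintegral.

Lemma has_cintegral_prod d1 d2 (T1 : measurableType d1) (T2 : measurableType d2)
    (R : realType) (m1 : {sigma_finite_measure set T1 -> \bar R})
    (m2 : {sigma_finite_measure set T2 -> \bar R})
    (f : T1 -> R[i]) (g : T2 -> R[i]) b c :
  has_cintegral m1 f b -> has_cintegral m2 g c ->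
  has_cintegral (sfproduct m1 m2) (fun p => f p.1 * g p.2) (b * c).
Proof.
move=> [fr fi] [gr gi]; split.
  under eq_fun do rewrite complexRe_mul; rewrite complexRe_mul.
  by apply: has_integralB; [exact: (has_integral_prod fr gr)|exact: (has_integral_prod fi gi)].
under eq_fun do rewrite complexIm_mul; rewrite complexIm_mul.
by apply: has_integralD; [exact: (has_integral_prod fr gi)|exact: (has_integral_prod fi gr)].
Qed.

(** Induction on the length. [E] splits the product on the tuple space, for measurability; [E']
    splits it on pairs, for the value. *)
Lemma has_cintegral_tuple d (T : measurableType d) (R : realType)
    (mu : {sigma_finite_measure set T -> \bar R}) (n : nat)
    (f : 'I_n -> T -> R[i]) (c : 'I_n -> R[i]) :
  (forall i, has_cintegral mu (f i) (c i)) ->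
  has_cintegral (tuple_measure mu n) (fun t => \prod_(i < n) f i (tnth t i))
    (\prod_(i < n) c i).
Proof.
elim: n f c => [|n IHn] f c fc.
  rewrite big_ord0; under eq_fun do rewrite big_ord0.
  by split; apply: ge0_has_integral => //= *; rewrite integral_dirac//= diracE mem_set// mul1e.
have IH := IHn _ _ (fun i => fc (lift ord0 i)).
have H := has_cintegral_prod (fc ord0) IH.
have E (t : n.+1.-tuple T) : \prod_(i < n.+1) f i (tnth t i) =
   f ord0 (thead t) * \prod_(i < n) f (lift ord0 i) (tnth (behead_tuple t) i).
  rewrite big_ord_recl; congr (_ * _); apply: eq_bigr => i _.
  by rewrite [in LHS](tuple_eta t) tnthS.
have E' (p : T * n.-tuple T) :
    \prod_(i < n.+1) f i (tnth [the n.+1.-tuple T of p.1 :: p.2] i) =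
    f ord0 p.1 * \prod_(i < n) f (lift ord0 i) (tnth p.2 i).
  by rewrite big_ord_recl tnth0; under eq_bigr do rewrite tnthS.
have mRe i : measurable_fun setT (fun x => complex.Re (f i x)).
  by case: (fc i) => /has_integral_measurable.
have mIm i : measurable_fun setT (fun x => complex.Im (f i x)).
  by case: (fc i) => _ /has_integral_measurable.
have mt : measurable_fun setT (fun t : n.+1.-tuple T => behead_tuple t).
  exact: measurable_behead.
have mh : measurable_fun setT (fun t : n.+1.-tuple T => thead t).
  exact: measurable_tnth.
have mprod : measurable_fun setT (fun t : n.-tuple T =>
    complex.Re (\prod_(i < n) f (lift ord0 i) (tnth t i))) /\
  measurable_fun setT (fun t : n.-tuple T =>
    complex.Im (\prod_(i < n) f (lift ord0 i) (tnth t i))).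
  by case: IH => /has_integral_measurable ? /has_integral_measurable.
have [mpR mpI] := mprod.
rewrite big_ord_recl; case: H => HR HI; split; apply: has_integral_cons.
- under eq_fun do rewrite E complexRe_mul.
  apply: measurable_funB; apply: measurable_funM.
  + exact: (measurableT_comp (mRe ord0) mh).
  + exact: (measurableT_comp mpR mt).
  + exact: (measurableT_comp (mIm ord0) mh).
  + exact: (measurableT_comp mpI mt).
- by under eq_fun do rewrite E'.
- under eq_fun do rewrite E complexIm_mul.
  apply: measurable_funD; apply: measurable_funM.
  + exact: (measurableT_comp (mRe ord0) mh).
  + exact: (measurableT_comp mpI mt).
  + exact: (measurableT_comp (mIm ord0) mh).
  + exact: (measurableT_comp mpR mt).
- by under eq_fun do rewrite E'.
Qed.

(** * Gaussian moments in the plane *)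

Section gauss_moments.
Local Notation mu := (@lebesgue_measure _).

Lemma has_integral_gauss (R : realType) (c : R) : 0 < c ->
  has_integral mu (fun x : R => expR (- (c * x ^+ 2))) (Num.sqrt (pi / c)).
Proof.
(* Then s^2 = 1 / (2c), and the centered normal density of standard deviation [s] is proportional to
   exp(- c x^2). *)
move=> c0; pose s : R := Num.sqrt ((2 * c)^-1).
have s2 : s ^+ 2 = (2 * c)^-1 by rewrite sqr_sqrtr// invr_ge0 mulr_ge0// ltW.
have s0 : s != 0 by rewrite sqrtr_eq0 -ltNge invr_gt0 mulr_gt0.
have E x : normal_pdf 0 s x = (Num.sqrt (pi / c))^-1 * expR (- (c * x ^+ 2)).
  rewrite normal_pdfE// /normal_peak /normal_fun s2 subr0.
  congr ((Num.sqrt _)^-1 * expR _); first by field; lra.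
  by field; lra.
have r0 : 0 < Num.sqrt (pi / c) by rewrite sqrtr_gt0 divr_gt0 ?pi_gt0.
have H : has_integral mu (normal_pdf 0 s) 1.
  by split; [exact: integrable_normal_pdf|exact: integral_normal_pdf].
have := has_integralZ (Num.sqrt (pi / c)) H; rewrite mulr1.
by under eq_fun do rewrite E mulrA mulfV ?gt_eqF// mul1r.
Qed.

(** Half of the exponent absorbs the monomial: with y = c x^2 / 2, |x|^k <= 1 + x^(2(k+1)), and
    x^(2(k+1)) = (2/c)^(k+1) y^(k+1) is controlled by y^(k+1) / (k+1)! <= exp(y). *)
Lemma gauss_monomial_bound (R : realType) (c : R) k : 0 < c ->
  exists2 K, 0 <= K & forall x : R,
    `|x ^+ k * expR (- (c * x ^+ 2))| <= K * expR (- (c / 2 * x ^+ 2)).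
Proof.
move=> c0; exists (1 + (2 / c) ^+ k.+1 * k.+1`!%:R).
  by rewrite addr_ge0// mulr_ge0// exprn_ge0// divr_ge0// ltW.
move=> x; rewrite normrM (ger0_norm (expR_ge0 _)).
pose y := c / 2 * x ^+ 2.
have y0 : 0 <= y by rewrite mulr_ge0 ?sqr_ge0// divr_ge0// ltW.
have -> : - (c * x ^+ 2) = - y + - y by rewrite /y; field.
rewrite expRD mulrA ler_wpM2r ?expR_ge0// -/y.
rewrite expRN ler_pdivrMr ?expR_gt0//.
have yk := expR_ge1Dxn k y0.
have xk : `|x| ^+ k <= 1 + (x ^+ 2) ^+ k.+1.
  have [x1|x1] := leP `|x| 1.
    apply: (le_trans (y := 1)); first by rewrite exprn_ile1.
    by rewrite lerDl exprn_ge0// sqr_ge0.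
  rewrite -[x ^+ 2]real_normK ?num_real// -exprM.
  apply: (le_trans (y := `|x| ^+ (2 * k.+1))); last by rewrite lerDr.
  by rewrite ler_eXn2l//; lia.
rewrite normrX; apply: (le_trans xk).
have -> : (x ^+ 2) ^+ k.+1 = (2 / c) ^+ k.+1 * k.+1`!%:R * (y ^+ k.+1 / k.+1`!%:R).
  rewrite /y exprMn -!exprMn mulrACA mulfV ?pnatr_eq0 -?lt0n ?fact_gt0// mulr1.
  by rewrite -exprMn; congr (_ ^+ _); field; lra.
rewrite [leRHS]mulrDl mul1r lerD//; first by rewrite -[leLHS]expR0 ler_expR.
rewrite ler_wpM2l//; first by rewrite mulr_ge0// exprn_ge0// divr_ge0// ltW.
by apply: le_trans yk; rewrite lerDr.
Qed.

Lemma integrable_gauss_monomial (R : realType) (c : R) k : 0 < c ->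
  mu.-integrable setT (EFin \o (fun x : R => x ^+ k * expR (- (c * x ^+ 2)))).
Proof.
move=> c0; have [K K0 Kb] := gauss_monomial_bound k c0.
have [Ki _] := has_integralZ K (has_integral_gauss (divr_gt0 c0 (ltr0n _ 2))).
apply: le_integrable Ki => //.
  apply/measurable_EFinP; apply: measurable_funM; first exact: exprn_measurable.
  by do 2 (apply: measurableT_comp => //); apply: measurable_funM.
by move=> x _ /=; rewrite lee_fin [leRHS]ger0_norm ?mulr_ge0 ?expR_ge0//.
Qed.


(** The integral over [-n, n] is F(n) - F(-n), which tends to 0; by dominated convergence it also
    tends to the full integral. This supplies integration by parts on the line. *)
Lemma integral_derivative0 (R : realType) (F f : R -> R) :
  (forall x : R, is_derive x 1 F (f x)) -> continuous f ->
  mu.-integrable setT (EFin \o f) ->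
  F n%:R @[n --> \oo] --> 0 -> F (- n%:R) @[n --> \oo] --> 0 ->
  (\int[mu]_x (f x)%:E = 0)%E.
Proof.
move=> Ff cf fi Fp Fn.
have cF : continuous F.
  by move=> x; apply: differentiable_continuous; apply/derivable1_diffP; case: (Ff x).
pose I n : set R := `[- n%:R, n%:R]%classic.
have mI n : measurable (I n) by exact: measurable_itv.
pose f_ n : R -> \bar R := fun x => (f x * \1_(I n) x)%:E.
have mf : measurable_fun setT f by exact: continuous_measurable_fun.
have [] := @dominated_convergence _ _ R mu setT measurableT f_ (EFin \o f)
    (abse \o (EFin \o f)).
- move=> n; apply/measurable_EFinP; apply: measurable_funM => //.
  by apply: measurable_indic; exact: mI.
- exact/measurable_EFinP.
- apply: aeW => x _; apply: cvg_near_cst.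
  have [m xm] : exists m : nat, `|x| <= m%:R.
    exists (Num.truncn `|x|).+1; apply: ltW; exact: truncnS_gt.
  exists m => // n /= mn.
  have Inx : I n x by rewrite /I /= in_itv /= -ler_norml (le_trans xm)// ler_nat.
  by rewrite /f_ indicE mem_set//= mulr1.
- exact: integrable_abse.
- apply: aeW => x n _; rewrite /f_/= lee_fin normrM ler_piMr//.
  by rewrite indicE; case: (_ \in _); rewrite ?normr0 ?normr1.
move=> _ _ H.
(* The shift to [n.+1] makes the interval nondegenerate, as the fundamental theorem of calculus
   requires. *)
have E n : (\int[mu]_x f_ n.+1 x = (F n.+1%:R - F (- n.+1%:R))%:E)%E.
  rewrite EFinB -(@continuous_FTC2 _ f).
  - rewrite [RHS]integral_mkcond; apply: eq_integral => x _.
    by rewrite patchE /f_ indicE; case: (_ \in _); rewrite ?mulr1 ?mulr0.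
  - by rewrite -subr_gt0 opprK ltr_wpDr.
  - exact: continuous_subspaceT.
  - split => [x _||].
    + by case: (Ff x).
    + by apply: cvg_at_right_filter; exact: cF.
    + by apply: cvg_at_left_filter; exact: cF.
  - by move=> x _; rewrite derive1E; case: (Ff x).
have H0 : (F n%:R - F (- n%:R))%:E @[n --> \oo] --> 0%:E.
  by apply: cvg_EFin; [exact: nearW|rewrite -[0]subr0; exact: cvgB].
move: H H0; rewrite -cvg_shiftS -[X in X -> _ -> _]/(_ --> _) => H.
rewrite -cvg_shiftS => H0.
apply: cvg_unique H _ => //.
by apply: cvg_trans H0; apply: near_eq_cvg; apply: nearW => n /=; rewrite E.
Qed.

(** Unnormalized moments of exp(- c x^2); the recurrence is integration by parts. *)
Fixpoint gauss_moment (R : realType) (c : R) k : R :=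
  match k with
  | 0 => Num.sqrt (pi / c)
  | 1 => 0
  | k'.+2 => k'.+1%:R / (2 * c) * gauss_moment c k'
  end.

(** [e] is 1 or -1, so both ends of the line are treated at once. The bound exp(- c n^2 / 2) is
    weakened to a multiple of 1/n, enough for the squeeze. *)
Lemma cvg_gauss_monomial (R : realType) (c : R) k (e : R) : 0 < c -> e ^+ 2 = 1 ->
  (fun x : R => x ^+ k * expR (- (c * x ^+ 2))) (e * n%:R) @[n --> \oo] --> 0.
Proof.
move=> c0 e2; have [K K0 Kb] := gauss_monomial_bound k c0.
rewrite -cvg_shiftS; apply: norm_cvg0.
apply: (@squeeze_cvgr _ _ _ _ (cst 0) (fun n => K * (c / 2)^-1 * harmonic n)).
- apply: nearW => n; rewrite normr_ge0/=; apply: (le_trans (Kb _)).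
  rewrite -[leRHS]mulrA; apply: ler_wpM2l => //; rewrite exprMn e2 mul1r -invfM expRN.
  have c2 : 0 < c / 2 by rewrite divr_gt0.
  rewrite lef_pV2 ?posrE ?expR_gt0// ?mulr_gt0//.
  apply: le_trans (expR_ge1Dx _).
  have n1 : 1 <= n.+1%:R :> R by rewrite ler1n.
  nra.
- exact: cvg_cst.
- rewrite -[0](mulr0 (K * (c / 2)^-1)); apply: cvgMr; exact: cvg_harmonic.
Qed.

Lemma has_integral_gauss_monomial (R : realType) (c : R) k : 0 < c ->
  has_integral mu (fun x : R => x ^+ k * expR (- (c * x ^+ 2))) (gauss_moment c k).
Proof.
move=> c0; have [m] := ubnP k; elim: m k => // m IH [_|k].
  by under eq_fun do rewrite expr0 mul1r; exact: has_integral_gauss.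
rewrite ltnS => km.
split; first exact: integrable_gauss_monomial.
(* The derivative of x^k exp(- c x^2): its vanishing integral links the moments of orders k - 1 and
   k + 1. For k = 0 the coefficient k cancels the term with [k.-1]. *)
pose f (x : R) := (k%:R * x ^+ k.-1 - 2 * c * x ^+ k.+1) * expR (- (c * x ^+ 2)).
have fE x : f x = k%:R * (x ^+ k.-1 * expR (- (c * x ^+ 2))) -
    2 * c * (x ^+ k.+1 * expR (- (c * x ^+ 2))) by rewrite /f; ring.
have I1 := integrable_gauss_monomial k.+1 c0.
have I2 := integrable_gauss_monomial k.-1 c0.
have H1 : has_integral mu (fun x : R => x ^+ k.+1 * expR (- (c * x ^+ 2)))
  (fine (\int[mu]_x (x ^+ k.+1 * expR (- (c * x ^+ 2)))%:E)).
  by split=> //; rewrite fineK//; exact: integrable_fin_num.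
have H2 : has_integral mu (fun x : R => k%:R * (x ^+ k.-1 * expR (- (c * x ^+ 2))))
   (2 * c * gauss_moment c k.+1).
  case: k km {f fE I1 I2 H1} => [|k] km.
    by rewrite /= mulr0; under eq_fun do rewrite mul0r; exact: has_integral0.
  have := has_integralZ k.+1%:R (IH k (ltnW km)).
  by congr has_integral; rewrite /=; field; lra.
have H3 := has_integralB H2 (has_integralZ (2 * c) H1).
have f0 : (\int[mu]_x (f x)%:E = 0)%E.
  apply: (@integral_derivative0 _ (fun x => x ^+ k * expR (- (c * x ^+ 2)))).
  - move=> x.
    have hX j : is_derive x 1 (fun y : R => y ^+ j) (j%:R * x ^+ j.-1).
      by split; [exact: exprn_derivable|rewrite exp_derive /GRing.scale/= mulr1].
    have h2 : is_derive x 1 (fun y : R => - (c * y ^+ 2)) (- (2 * c * x)).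
      have -> : - (2 * c * x) = - (c *: (2%:R * x ^+ 1)) by rewrite /GRing.scale/=; ring.
      exact: (is_deriveN (is_deriveZ c (hX 2%N))).
    have h3 : is_derive x 1 (fun y : R => expR (- (c * y ^+ 2)))
        (expR (- (c * x ^+ 2)) * - (2 * c * x)).
      exact: (is_derive1_comp (f := expR)).
    apply: (is_derive_eq (is_deriveM (hX k) h3)).
    rewrite /f [x ^+ k.+1]exprS /GRing.scale/=. ring.
  - move=> x; rewrite /f; apply: cvgM.
      apply: cvgB; apply: cvgM; try exact: cvg_cst; exact: exprn_continuous.
    apply: (cvg_comp _ expR); last exact: continuous_expR.
    by apply: (@cvgN _ R^o); apply: cvgM; [exact: cvg_cst|exact: exprn_continuous].
  - have [+ _] := H3; by under [X in _.-integrable _ (_ \o X) -> _]eq_fun do rewrite -fE.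
  - have := cvg_gauss_monomial k c0 (expr1n R 2).
    by under eq_fun do rewrite mul1r.
  - have e2 : (-1 : R) ^+ 2 = 1 by rewrite sqrrN expr1n.
    have := cvg_gauss_monomial k c0 e2.
    by under eq_fun do rewrite mulN1r.
have {}H3 : has_integral mu f (2 * c * gauss_moment c k.+1 -
     2 * c * fine (\int[mu]_x (x ^+ k.+1 * expR (- (c * x ^+ 2)))%:E)).
  by move: H3; congr has_integral; apply/esym/funext => x; exact: fE.
have [_] := H3; rewrite f0 => -[/esym/eqP]; rewrite subr_eq0 => /eqP/mulfI E.
by rewrite (proj2 H1); congr EFin; apply/esym; apply: E; rewrite mulf_neq0 ?gt_eqF.
Qed.

End gauss_moments.

Section plane_moments.
Context (R : realType) (c : R).
Hypothesis c0 : 0 < c.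
Local Notation m := (gauss_moment c).

(* The integral of x^a y^b w^i (w^* )^j exp(- c |w|^2), reduced to one-dimensional
   moments by expanding w = x + iy. Integration by parts in x and in y combines
   into the ladder relations [plane_moment_mull] and [plane_moment_mulr], which
   replace the use of polar coordinates. *)
Fixpoint plane_moment (a b i j : nat) : R[i] :=
  if i is i'.+1 then plane_moment a.+1 b i' j + 'i%C * plane_moment a b.+1 i' j
  else (fix pm0 (a b j : nat) := if j is j'.+1 then
    pm0 a.+1 b j' - 'i%C * pm0 a b.+1 j' else (m a * m b)%:C) a b j.

Arguments plane_moment : simpl never.

Lemma plane_moment00 a b : plane_moment a b 0 0 = (m a * m b)%:C.
Proof. by []. Qed.

Lemma plane_momentSl a b i j :
  plane_moment a b i.+1 j = plane_moment a.+1 b i j + 'i%C * plane_moment a b.+1 i j.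
Proof. by []. Qed.

Lemma plane_momentSr a b i j :
  plane_moment a b i j.+1 = plane_moment a.+1 b i j - 'i%C * plane_moment a b.+1 i j.
Proof.
elim: i a b => [//|i IH] a b.
rewrite plane_momentSl !IH !plane_momentSl; ring.
Qed.

Lemma gauss_momentS k : m k.+1 = k%:R / (2 * c) * m k.-1.
Proof. by case: k => [|k]//=; rewrite mul0r mul0r. Qed.

(** Integration by parts in x, where d/dx acts as 1 on both w and its conjugate. A truncated
    predecessor at 0 always has coefficient 0. The induction on the exponents is purely algebraic
    and starts from the one-dimensional recurrence. *)
Lemma plane_moment_ibp_Re a b i j : plane_moment a.+1 b i j =
  ((2 * c)^-1)%:C * (a%:R * plane_moment a.-1 b i j
     + i%:R * plane_moment a b i.-1 j + j%:R * plane_moment a b i j.-1).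
Proof.
elim: i a b => [|i IHi] a b.
  elim: j a b => [|j IHj] a b.
    rewrite !mul0r !addr0 !plane_moment00 gauss_momentS -mulrA mulrCA !rmorphM/= rmorph_nat.
    ring.
  rewrite [LHS]plane_momentSr (IHj a.+1 b) (IHj a b.+1) /= [a.+1%:R]mulrSr [j.+1%:R]mulrSr.
  case: a => [|a]; case: j {IHj} => [|j]; rewrite ?plane_momentSr /=; ring.
rewrite [LHS]plane_momentSl (IHi a.+1 b) (IHi a b.+1) /= [a.+1%:R]mulrSr [i.+1%:R]mulrSr.
case: a => [|a]; case: i {IHi} => [|i]; rewrite ?plane_momentSl /=; ring.
Qed.

(** The same in y, where d/dy acts as i on w and as -i on its conjugate. *)
Lemma plane_moment_ibp_Im a b i j : plane_moment a b.+1 i j =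
  ((2 * c)^-1)%:C * (b%:R * plane_moment a b.-1 i j
     + 'i%C * (i%:R * plane_moment a b i.-1 j - j%:R * plane_moment a b i j.-1)).
Proof.
elim: i a b => [|i IHi] a b.
  elim: j a b => [|j IHj] a b.
    rewrite !mul0r subr0 mulr0 !addr0 !plane_moment00 gauss_momentS.
    rewrite mulrCA !rmorphM/= rmorph_nat.
    ring.
  rewrite [LHS]plane_momentSr (IHj a.+1 b) (IHj a b.+1) /= [b.+1%:R]mulrSr [j.+1%:R]mulrSr.
  case: b => [|b]; case: j {IHj} => [|j]; rewrite ?plane_momentSr /=; ring.
rewrite [LHS]plane_momentSl (IHi a.+1 b) (IHi a b.+1) /= [b.+1%:R]mulrSr [i.+1%:R]mulrSr.
case: b => [|b]; case: i {IHi} => [|i]; rewrite ?plane_momentSl /=; ring.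
Qed.

(** In x + iy the derivatives of w cancel and those of its conjugate double: w exp(- c |w|^2) is
    -1/c times the derivative of the Gaussian in conj(w). *)
Lemma plane_moment_mull i j :
  plane_moment 0 0 i.+1 j = (j%:R / c)%:C * plane_moment 0 0 i j.-1.
Proof.
rewrite plane_momentSl plane_moment_ibp_Re plane_moment_ibp_Im.
have -> : (j%:R / c)%:C = j%:R * (((2 * c)^-1)%:C *+ 2) :> R[i].
  have -> : j%:R = (j%:R)%:C :> R[i] by rewrite rmorph_nat.
  by rewrite -rmorphMn -rmorphM; congr (_%:C); field; rewrite gt_eqF.
set k := ((2 * c)^-1)%:C; have i2 := sqr_i R. ring: i2.
Qed.

Lemma plane_moment_mulr i j :
  plane_moment 0 0 i j.+1 = (i%:R / c)%:C * plane_moment 0 0 i.-1 j.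
Proof.
rewrite plane_momentSr plane_moment_ibp_Re plane_moment_ibp_Im.
have -> : (i%:R / c)%:C = i%:R * (((2 * c)^-1)%:C *+ 2) :> R[i].
  have -> : i%:R = (i%:R)%:C :> R[i] by rewrite rmorph_nat.
  by rewrite -rmorphMn -rmorphM; congr (_%:C); field; rewrite gt_eqF.
set k := ((2 * c)^-1)%:C; have i2 := sqr_i R; ring: i2.
Qed.

Lemma plane_momentE i j :
  plane_moment 0 0 i j = if i == j then (pi * i`!%:R / c ^+ i.+1)%:C else 0.
Proof.
elim: i j => [|i IH] [|j].
- rewrite plane_moment00 /= -expr2 sqr_sqrtr ?divr_ge0 ?pi_ge0 ?ltW//.
  by rewrite fact0 mulr1 expr1.
- by rewrite plane_moment_mulr mul0r mul0r.
- by rewrite plane_moment_mull mul0r mul0r.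
- rewrite plane_moment_mull /= IH eqSS; case: eqP => [<-|]; last by rewrite mulr0.
  rewrite -rmorphM/= factS natrM [c ^+ i.+2]exprS.
  by congr (_%:C); field; rewrite expf_neq0 ?gt_eqF.
Qed.

Lemma has_cintegral_plane_moment a b i j :
  has_cintegral (lebesgueC R)
    (fun w => (w.1 ^+ a * w.2 ^+ b)%:C * (toC w ^+ i * (toC w)^*%C ^+ j) *
              (expR (- (c * normc (toC w) ^+ 2)))%:C)
    (plane_moment a b i j).
Proof.
elim: i j a b => [|i IHi].
  elim=> [|j IHj] a b.
    rewrite plane_moment00.
    have := has_cintegral_real (has_integral_prod
      (has_integral_gauss_monomial a c0) (has_integral_gauss_monomial b c0)).
    congr has_cintegral; apply/funext => -[x y].
    rewrite normc_sqr/= mulrDr opprD expRD !expr0 !mulr1 -rmorphM.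
    by congr (_%:C); ring.
  rewrite plane_momentSr.
  have := has_cintegralD (IHj a.+1 b) (has_cintegralZ (- 'i%C) (IHj a b.+1)).
  rewrite mulNr; congr has_cintegral; apply/funext => -[x y].
  rewrite [(x, y).1]/= [(x, y).2]/=.
  have -> : (toC (x, y))^*%C = x%:C - 'i%C * y%:C.
    by apply/eqP; rewrite eq_complex/=; apply/andP; split; apply/eqP; ring.
  rewrite !exprS !rmorphM; ring.
move=> j a b; rewrite plane_momentSl.
have := has_cintegralD (IHi j a.+1 b) (has_cintegralZ 'i%C (IHi j a b.+1)).
congr has_cintegral; apply/funext => -[x y]; rewrite [(x, y).1]/= [(x, y).2]/=.
have -> : toC (x, y) = x%:C + 'i%C * y%:C.
  by apply/eqP; rewrite eq_complex/=; apply/andP; split; apply/eqP; ring.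
rewrite !exprS !rmorphM; ring.
Qed.

Lemma has_cintegral_complex_gauss i j :
  has_cintegral (lebesgueC R)
    (fun w => toC w ^+ i * (toC w)^*%C ^+ j * (expR (- (c * normc (toC w) ^+ 2)))%:C)
    (if i == j then (pi * i`!%:R / c ^+ i.+1)%:C else 0).
Proof.
rewrite -plane_momentE; have := has_cintegral_plane_moment 0 0 i j.
by under eq_fun do rewrite !expr0 mulr1 mul1r.
Qed.

End plane_moments.

(** * Means of polynomials in independent complex Gaussians *)

Section gauss_expectation.
Context (R : realType) (I : finType) (N : nat).
Implicit Types (S : {pred I}) (t : I -> R[i]) (F G : (I -> R[i]) -> R[i]).

Definition monomial (al be : I -> nat) t : R[i] :=
  \prod_u (t u ^+ al u * (t u)^*%C ^+ be u).

(** Product over independent centered complex Gaussians g of variance 1/N, for which the mean of g^a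
    conj(g)^b is a! / N^a if a = b and 0 otherwise. *)
Definition monomial_mean (al be : I -> nat) : R[i] :=
  \prod_u (if al u == be u then ((al u)`!%:R / N%:R ^+ al u)%:C else 0).

(* [F] is a polynomial, of Gaussian mean [m], in the variables of [S] and their
   conjugates. *)
Definition has_mean S F (m : R[i]) : Prop :=
  exists (J : finType) (c : J -> R[i]) (al be : J -> I -> nat),
    [/\ forall j u, u \notin S -> al j u = 0 /\ be j u = 0,
        forall t, F t = \sum_j c j * monomial (al j) (be j) t &
        m = \sum_j c j * monomial_mean (al j) (be j)].

Lemma has_mean_monomial S c al be :
  (forall u, u \notin S -> al u = 0 /\ be u = 0) ->
  has_mean S (fun t => c * monomial al be t) (c * monomial_mean al be).
Proof.
move=> albe; exists unit, (fun=> c), (fun=> al), (fun=> be); split => //.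
- by move=> t; rewrite big_const card_unit /= addr0.
- by rewrite big_const card_unit /= addr0.
Qed.

Lemma monomial00 t : monomial (fun=> 0) (fun=> 0) t = 1.
Proof. by rewrite /monomial big1// => u _; rewrite !expr0 mulr1. Qed.

Lemma monomial_mean00 : monomial_mean (fun=> 0) (fun=> 0) = 1.
Proof. by rewrite /monomial_mean big1// => u _; rewrite /= fact0 expr0 divr1. Qed.

Lemma has_mean_cst S c : has_mean S (fun=> c) c.
Proof.
have := @has_mean_monomial S c (fun=> 0) (fun=> 0) (fun _ _ => conj erefl erefl).
by rewrite monomial_mean00 mulr1; under eq_fun do rewrite monomial00 mulr1.
Qed.

Lemma has_meanD S F G m n : has_mean S F m -> has_mean S G n ->
  has_mean S (fun t => F t + G t) (m + n).
Proof.
move=> [J [c [al [be [Jz JF ->]]]]] [K [d [al' [be' [Kz KG ->]]]]].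
exists (J + K)%type, (fun x => match x with inl j => c j | inr k => d k end).
exists (fun x => match x with inl j => al j | inr k => al' k end).
exists (fun x => match x with inl j => be j | inr k => be' k end).
split; last by rewrite big_sumType.
- by case.
- by move=> t; rewrite big_sumType/= JF KG.
Qed.

Lemma monomialM al be al' be' t :
  monomial (fun u => al u + al' u)%N (fun u => be u + be' u)%N t =
  monomial al be t * monomial al' be' t.
Proof.
by rewrite /monomial -big_split/=; apply: eq_bigr => u _; rewrite !exprD mulrACA.
Qed.

Lemma monomial_mean_indep S al be al' be' :
  (forall u, u \notin S -> al u = 0 /\ be u = 0) ->
  (forall u, u \in S -> al' u = 0 /\ be' u = 0) ->
  monomial_mean (fun u => al u + al' u)%N (fun u => be u + be' u)%N =
  monomial_mean al be * monomial_mean al' be'.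
Proof.
move=> z z'; rewrite /monomial_mean -big_split/=; apply: eq_bigr => u _.
have [/z' [-> ->]|/z [-> ->]] := boolP (u \in S).
  by rewrite !addn0 fact0 expr0 divr1 mulr1.
by rewrite !add0n fact0 expr0 divr1 mul1r.
Qed.

(** The mean of a product is not determined by the means of the factors, hence the existential; only
    stability of polynomials is claimed. *)
Lemma has_meanM S F G m n : has_mean S F m -> has_mean S G n ->
  exists p, has_mean S (fun t => F t * G t) p.
Proof.
move=> [J [c [al [be [Jz JF _]]]]] [K [d [al' [be' [Kz KG _]]]]].
eexists; exists (J * K)%type, (fun x => c x.1 * d x.2).
exists (fun x u => al x.1 u + al' x.2 u)%N, (fun x u => be x.1 u + be' x.2 u)%N.
split; last by [].
- by move=> [j k] u Su /=; have [-> ->] := Jz j u Su; have [-> ->] := Kz k u Su.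
- move=> t; rewrite JF KG big_distrlr/= pair_big; apply: eq_bigr => -[j k] _ /=.
  by rewrite monomialM; ring.
Qed.

(** When the variables are disjoint, each variable has its exponents from one factor only, so
    [monomial_mean] splits. *)
Lemma has_meanM_indep S S' F G m n : (forall u, u \in S -> u \notin S') ->
  has_mean S F m -> has_mean S' G n ->
  has_mean predT (fun t => F t * G t) (m * n).
Proof.
move=> SS' [J [c [al [be [Jz JF ->]]]]] [K [d [al' [be' [Kz KG ->]]]]].
exists (J * K)%type, (fun x => c x.1 * d x.2).
exists (fun x u => al x.1 u + al' x.2 u)%N, (fun x u => be x.1 u + be' x.2 u)%N.
split; first by move=> [j k] u.
- move=> t; rewrite JF KG big_distrlr/= pair_big; apply: eq_bigr => -[j k] _ /=.
  by rewrite monomialM; ring.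
- rewrite big_distrlr/= pair_big; apply: eq_bigr => -[j k] _ /=.
  rewrite (monomial_mean_indep (S := S)); [by ring| |].
    by move=> u Su; exact: Jz.
  by move=> u Su; apply: Kz; exact: SS'.
Qed.

Lemma has_mean_sub S S' F m : {subset S <= S'} ->
  has_mean S F m -> has_mean S' F m.
Proof.
move=> SS' [J [c [al [be [Jz JF ->]]]]]; exists J, c, al, be; split => // j u Su.
by apply: Jz; apply: contra Su => /SS'.
Qed.

Definition is_poly S F := exists m, has_mean S F m.

Lemma eq_is_poly S F G : F =1 G -> is_poly S F -> is_poly S G.
Proof. by move=> /funext ->. Qed.

Lemma is_poly_cst S c : is_poly S (fun=> c).
Proof. by exists c; exact: has_mean_cst. Qed.

Lemma is_polyD S F G : is_poly S F -> is_poly S G -> is_poly S (fun t => F t + G t).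
Proof. by move=> [m Fm] [n Gn]; exists (m + n); exact: has_meanD. Qed.

Lemma is_polyM S F G : is_poly S F -> is_poly S G -> is_poly S (fun t => F t * G t).
Proof. by move=> [m Fm] [n Gn]; exact: has_meanM Fm Gn. Qed.

Lemma is_poly_sum (K : Type) (s : seq K) (P : pred K) S (F : K -> (I -> R[i]) -> R[i]) :
  (forall k, P k -> is_poly S (F k)) -> is_poly S (fun t => \sum_(k <- s | P k) F k t).
Proof.
move=> SF; elim: s => [|k s IHs].
  by under eq_fun do rewrite big_nil; exact: is_poly_cst.
under eq_fun do rewrite big_cons; case Pk: (P k) => //.
by apply: is_polyD IHs; exact: SF.
Qed.

Lemma monomial1 (a b : nat) u t :
  monomial (fun v => (v == u) * a)%N (fun v => (v == u) * b)%N t =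
  t u ^+ a * (t u)^*%C ^+ b.
Proof.
rewrite /monomial (bigD1 u)//= eqxx !mul1n big1 ?mulr1// => v /negPf ->.
by rewrite !mul0n !expr0 mulr1.
Qed.

Lemma is_poly_monomial1 S u a b : u \in S ->
  is_poly S (fun t => t u ^+ a * (t u)^*%C ^+ b).
Proof.
move=> Su; have z v : v \notin S -> ((v == u) * a = 0 /\ (v == u) * b = 0)%N.
  by have [->|] := eqVneq v u; first by rewrite Su.
have H := has_mean_monomial 1 z; eexists; move: H; congr has_mean.
by apply/funext => t; rewrite mul1r monomial1.
Qed.

Lemma is_poly_var S u : u \in S -> is_poly S (fun t => t u).
Proof.
move=> /(is_poly_monomial1 1 0); congr is_poly; apply/funext => t.
by rewrite expr1 expr0 mulr1.
Qed.

Lemma is_poly_conj S F : is_poly S F -> is_poly S (fun t => (F t)^*%C).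
Proof.
move=> [m [J [c [al [be [Jz JF _]]]]]].
eexists; exists J, (fun j => (c j)^*%C), be, al; split; last by [].
  by move=> j u /(Jz j)[-> ->].
move=> t; rewrite JF rmorph_sum; apply: eq_bigr => j _.
rewrite rmorphM; congr (_ * _); rewrite rmorph_prod; apply: eq_bigr => u _.
by rewrite rmorphM !rmorphXn/= conjcK mulrC.
Qed.

Lemma is_poly_sub S S' F : {subset S <= S'} -> is_poly S F -> is_poly S' F.
Proof. by move=> SS' [m Fm]; exists m; exact: has_mean_sub Fm. Qed.

End gauss_expectation.

Section gauss_expectation_integral.
Context (R : realType) (I : finType) (N : nat).
Hypothesis N0 : (0 < N)%N.
Local Notation m := #|{: I}|.
Implicit Types (S : {pred I}) (F G : (I -> R[i]) -> R[i]).

Definition tuple_fun (w : m.-tuple (plane R)) (u : I) : R[i] :=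
  toC (tnth w (enum_rank u)).

Lemma has_cintegral_ginibre_density a b :
  has_cintegral (lebesgueC R)
    (fun w => toC w ^+ a * (toC w)^*%C ^+ b * (ginibre_density N (toC w))%:C)
    (if a == b then (a`!%:R / N%:R ^+ a)%:C else 0).
Proof.
have NR : 0 < N%:R :> R by rewrite ltr0n.
have := has_cintegralZ ((N%:R / pi)%:C) (has_cintegral_complex_gauss NR a b).
have -> : (N%:R / pi)%:C * (if a == b then (pi * a`!%:R / N%:R ^+ a.+1)%:C else 0)
   = (if a == b then (a`!%:R / N%:R ^+ a)%:C else 0) :> R[i].
  case: ifP => _; last by rewrite mulr0.
  rewrite -rmorphM exprS; congr (_%:C).
  have := pi_gt0 R; move: (pi : R) => p p0; field.
  by rewrite expf_neq0 ?gt_eqF.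
congr has_cintegral; apply/funext => w.
by rewrite mulrCA -rmorphM.
Qed.

Lemma has_cintegral_monomial al be :
  has_cintegral (tuple_measure (lebesgueC R) m)
    (fun w => monomial al be (tuple_fun w) *
       (\prod_u ginibre_density N (tuple_fun w u))%:C)
    (monomial_mean R N al be).
Proof.
have := has_cintegral_tuple (fun i : 'I_m =>
  has_cintegral_ginibre_density (al (enum_val i)) (be (enum_val i))).
rewrite -(big_enum_val (fun u => if al u == be u then ((al u)`!%:R / N%:R ^+ al u)%:C else 0))/=.
congr has_cintegral; apply/funext => w.
pose h (u : I) := tuple_fun w u ^+ al u * (tuple_fun w u)^*%C ^+ be u *
  (ginibre_density N (tuple_fun w u))%:C.
transitivity (\prod_u h u); last by rewrite rmorph_prod -big_split.
by rewrite [RHS](big_enum_val h); apply: eq_bigr => i _; rewrite /h /tuple_fun enum_valK.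
Qed.

Lemma has_cintegral_mean S F c : has_mean N S F c ->
  has_cintegral (tuple_measure (lebesgueC R) m)
    (fun w => F (tuple_fun w) * (\prod_u ginibre_density N (tuple_fun w u))%:C) c.
Proof.
move=> [J [a [al [be [_ JF ->]]]]].
have := has_cintegral_sum (index_enum J) (P := xpredT) (fun j _ =>
  has_cintegralZ (a j) (has_cintegral_monomial (al j) (be j))).
congr has_cintegral; apply/funext => w.
by rewrite JF mulr_suml; apply: eq_bigr => j _; rewrite mulrA.
Qed.

(** A functional on all functions, with default value 0 off the polynomials, so that means can be
    rewritten without carrying expansions. *)
Definition mean F : R[i] := xget 0 [set c | has_mean N predT F c].

(** A polynomial may have several expansions; they yield the same number because each computes the
    same Gaussian integral. *)
Lemma meanE S F c : has_mean N S F c -> mean F = c.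
Proof.
move=> Fc; have Fc' : has_mean N predT F c by exact: has_mean_sub Fc.
rewrite /mean; case: xgetP => [_ -> /has_cintegral_mean Fx|/(_ c) //].
exact: has_cintegral_unique Fx (has_cintegral_mean Fc).
Qed.

Lemma mean_integral S F : is_poly N S F ->
  has_cintegral (tuple_measure (lebesgueC R) m)
    (fun w => F (tuple_fun w) * (\prod_u ginibre_density N (tuple_fun w u))%:C) (mean F).
Proof. by move=> [c Fc]; rewrite (meanE Fc); exact: has_cintegral_mean Fc. Qed.

Lemma eq_mean F G : F =1 G -> mean F = mean G.
Proof. by move=> /funext ->. Qed.

Lemma mean_cst c : mean (fun=> c) = c.
Proof. exact: meanE (has_mean_cst _ predT c). Qed.

Lemma meanD S F G : is_poly N S F -> is_poly N S G ->
  mean (fun t => F t + G t) = mean F + mean G.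
Proof.
by move=> [c Fc] [d Gd]; rewrite (meanE Fc) (meanE Gd) (meanE (has_meanD Fc Gd)).
Qed.

Lemma mean_sum (K : Type) (s : seq K) (P : pred K) S (F : K -> (I -> R[i]) -> R[i]) :
  (forall k, P k -> is_poly N S (F k)) ->
  mean (fun t => \sum_(k <- s | P k) F k t) = \sum_(k <- s | P k) mean (F k).
Proof.
move=> SF; elim: s => [|k s IHs].
  by under eq_fun do rewrite big_nil; rewrite big_nil mean_cst.
under eq_fun do rewrite big_cons; rewrite big_cons; case Pk: (P k) => //.
by rewrite -IHs (meanD (SF k Pk))//; exact: is_poly_sum.
Qed.

Lemma meanM_indep S S' F G : (forall u, u \in S -> u \notin S') ->
  is_poly N S F -> is_poly N S' G -> mean (fun t => F t * G t) = mean F * mean G.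
Proof.
move=> SS' [c Fc] [d Gd].
by rewrite (meanE Fc) (meanE Gd) (meanE (has_meanM_indep SS' Fc Gd)).
Qed.

Lemma meanZ S c F : is_poly N S F -> mean (fun t => c * F t) = c * mean F.
Proof.
move=> [d Fd]; rewrite (@meanM_indep pred0 S (fun=> c) F) ?mean_cst//.
  exact: is_poly_cst.
by exists d.
Qed.

Lemma mean_monomial al be : mean (monomial al be) = monomial_mean R N al be.
Proof.
have := @has_mean_monomial R I N predT 1 al be; rewrite mul1r.
move=> /(_ (fun _ => ltac:(by [])))/meanE <-.
by congr mean; apply/funext => t; rewrite mul1r.
Qed.

Implicit Types (al be : I -> nat) (i j k l u : I).

Lemma monomial_mean_neq al be u : al u <> be u -> monomial_mean R N al be = 0.
Proof. by move=> /eqP/negPf ne; rewrite /monomial_mean (bigD1 u)//= ne mul0r. Qed.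

Lemma monomial_mean_eq al :
  monomial_mean R N al al = ((\prod_u (al u)`!)%:R / N%:R ^+ (\sum_u al u))%:C.
Proof.
rewrite /monomial_mean; under eq_bigr do rewrite eqxx.
by rewrite -rmorph_prod prodf_div natr_prod expr_sum.
Qed.

Lemma sum_eq1 i : (\sum_u (u == i) = 1)%N.
Proof. by rewrite (bigD1 i)//= eqxx big1// => u /negPf ->. Qed.

Lemma prodr_expr_eq (f : I -> R[i]) i : \prod_u f u ^+ (u == i) = f i.
Proof. by rewrite (bigD1 i)//= eqxx expr1 big1 ?mulr1// => u /negPf ->. Qed.

Lemma prodr_expr_eq2 (f : I -> R[i]) i k :
  \prod_u f u ^+ ((u == i) + (u == k)) = f i * f k.
Proof.
by under eq_bigr do rewrite exprD; rewrite big_split/= !prodr_expr_eq.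
Qed.

Lemma mean_pair i j : mean (fun t => t i * (t j)^*%C) = (i == j)%:R / N%:R.
Proof.
have := mean_monomial (fun u => nat_of_bool (u == i)) (fun u => nat_of_bool (u == j)).
have -> : monomial (fun u => nat_of_bool (u == i)) (fun u => nat_of_bool (u == j)) =
    (fun t : I -> R[i] => t i * (t j)^*%C).
  apply/funext => t; rewrite /monomial big_split prodr_expr_eq.
  by rewrite (prodr_expr_eq (fun u => (t u)^*%C)).
move=> ->; have [<-|ij] := eqVneq i j.
  rewrite monomial_mean_eq sum_eq1 big1 ?expr1 => [|u _]; last by case: eqP.
  by rewrite !mul1r fmorphV/= rmorph_nat.
by rewrite (monomial_mean_neq (u := i)) ?mul0r// eqxx (negPf ij).
Qed.

(** Wick's formula: the exponents of every variable and of its conjugate must agree, which leaves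
    the two pairings of {i, k} with {j, l}. *)
Lemma mean_two_pairs i j k l :
  mean (fun t => t i * (t j)^*%C * (t k * (t l)^*%C)) =
  ((i == j)%:R * (k == l)%:R + (i == l)%:R * (k == j)%:R) / N%:R ^+ 2.
Proof.
pose al u := ((u == i) + (u == k))%N; pose be u := ((u == j) + (u == l))%N.
have -> : (fun t : I -> R[i] => t i * (t j)^*%C * (t k * (t l)^*%C)) = monomial al be.
  apply/funext => t; rewrite /monomial big_split prodr_expr_eq2.
  by rewrite (prodr_expr_eq2 (fun u => (t u)^*%C)) mulrACA.
(* The extra term for i = k is the factorial 2! of a variable that occurs twice, that is, both
   pairings succeeding together. *)
have eq_mean : monomial_mean R N al al = (1 + (i == k)%:R) / N%:R ^+ 2.
  rewrite monomial_mean_eq big_split/= !sum_eq1 rmorphM fmorphV rmorphXn/= !rmorph_nat.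
  congr (_ / _); rewrite [RHS]addrC natr1; congr _%:R.
  have [ik|ik] := eqVneq i k.
    by rewrite (bigD1 i)//= /al -ik eqxx big1// => u /negPf ->.
  rewrite big1// => u _; rewrite /al; have [->|] := eqVneq u i; first by rewrite (negPf ik).
  by case: (u == k).
rewrite mean_monomial -!natrM !mulnb.
have [/andP[/eqP ij /eqP kl]|A] := boolP ((i == j) && (k == l)).
  have -> : be = al by rewrite /be /al ij kl.
  rewrite eq_mean -ij -kl; congr ((_ + _%:R) / _).
  by rewrite [k == i]eq_sym andbb.
have [/andP[/eqP il /eqP kj]|B] := boolP ((i == l) && (k == j)).
  have -> : be = al by apply/funext => u; rewrite /be /al il kj addnC.
  rewrite eq_mean; move: A; rewrite -il -kj [k == i]eq_sym andbb => /negPf ->.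
  by rewrite addrC.
rewrite !mulr0n addr0 mul0r.
(* Neither pairing is complete, so some variable has unequal exponents: [k] if [i] has a partner,
   and [i] itself otherwise. *)
have [ij|ij] := eqVneq i j.
  apply: (monomial_mean_neq (u := k)); move: A B; rewrite /al /be -ij !eqxx/=.
  by case: (k == i); case: (k == l).
have [il|il] := eqVneq i l.
  apply: (monomial_mean_neq (u := k)); move: A B; rewrite /al /be -il !eqxx/=.
  by case: (k == i); case: (k == j).
by apply: (monomial_mean_neq (u := i)); rewrite /al /be eqxx (negPf ij) (negPf il).
Qed.

End gauss_expectation_integral.

(** * Recursion over the columns of the Schur form *)

Section left_eigenvector.
Context (K : fieldType) (lam : nat -> K) (T : nat -> nat -> K).

(* Solves x T = lam_s x for T upper triangular with diagonal lam, normalized by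
   x_s = 1; each entry depends on all the previous ones. *)
Fixpoint left_eigenvector_seq s k : seq K :=
  if k is k'.+1 then
    let x := left_eigenvector_seq s k' in
    rcons x (if (k' < s)%N then 0 else if k' == s then 1 else
             (\sum_(i < k') x`_i * T i k') / (lam s - lam k'))
  else [::].

Definition left_eigenvector s k : K := (left_eigenvector_seq s k.+1)`_k.

Lemma size_left_eigenvector_seq s k : size (left_eigenvector_seq s k) = k.
Proof. by elim: k => //= k IH; rewrite size_rcons IH. Qed.

Lemma nth_left_eigenvector_seq s k i : (i < k)%N ->
  (left_eigenvector_seq s k)`_i = left_eigenvector s i.
Proof.
elim: k => // k IH; rewrite ltnS leq_eqVlt => /predU1P[->//|ik] /=.
by rewrite nth_rcons size_left_eigenvector_seq ik IH.
Qed.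

Lemma left_eigenvectorE s k : left_eigenvector s k =
  if (k < s)%N then 0 else if k == s then 1 else
  (\sum_(i < k) left_eigenvector s i * T i k) / (lam s - lam k).
Proof.
rewrite /left_eigenvector /= nth_rcons size_left_eigenvector_seq ltnn eqxx.
case: ifP => // _; case: ifP => // _; congr (_ / _); apply: eq_bigr => i _.
by rewrite nth_left_eigenvector_seq.
Qed.

Lemma left_eigenvector_lt s k : (k < s)%N -> left_eigenvector s k = 0.
Proof. by rewrite left_eigenvectorE => ->. Qed.

Lemma left_eigenvector_eq s : left_eigenvector s s = 1.
Proof. by rewrite left_eigenvectorE ltnn eqxx. Qed.

Lemma left_eigenvector_gt s k : (s < k)%N -> left_eigenvector s k =
  (\sum_(i < k) left_eigenvector s i * T i k) / (lam s - lam k).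
Proof. by move=> sk; rewrite left_eigenvectorE ltnNge (ltnW sk) gtn_eqF. Qed.

End left_eigenvector.

Section column.
Context (R : realType) (n : nat).
Local Notation N := n.+2.
Local Notation I := (upper N).
Local Notation mean := (@mean R I N).
Let N0 : (0 < N)%N := ltn0Sn _.
Implicit Types (t : I -> R[i]) (F G : (I -> R[i]) -> R[i]).

(** Indexed by natural numbers to match the recursion of [left_eigenvector]; only the values for i <
    k < N are used there. *)
Definition entry t (i k : nat) : R[i] :=
  if insub (inord i : 'I_N, inord k : 'I_N) is Some u then t u else 0.

(** The filtration by columns: [is_poly N (before k) F] plays the role of measurability with respect
    to the columns of index less than [k]. *)
Definition before (k : nat) : {pred I} := fun u => ((val u).2 < k)%N.

Lemma in_before k u : (u \in before k) = ((val u).2 < k)%N.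
Proof. by []. Qed.

Lemma entry_upper (i k : nat) : (i < k < N)%N ->
  exists u : I, [/\ forall t, entry t i k = t u, val (val u).1 = i &
    val (val u).2 = k].
Proof.
move=> /andP[ik kN]; have iN := ltn_trans ik kN.
have p : ((inord i : 'I_N) < (inord k : 'I_N))%N by rewrite !inordK.
exists (Sub (inord i, inord k) p); split; rewrite ?SubK/= ?inordK//.
by move=> t; rewrite /entry insubT.
Qed.

Lemma is_poly_entry i k : (i < k < N)%N -> is_poly N (before k.+1) (fun t => entry t i k).
Proof.
move=> /entry_upper[u [ut _ uk]].
have : u \in before k.+1 by rewrite in_before uk.
by move=> /(@is_poly_var R I N); congr is_poly; apply/funext => t; rewrite ut.
Qed.

Lemma is_poly_before k k' F : (k <= k')%N ->
  is_poly N (before k) F -> is_poly N (before k') F.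
Proof.
by move=> kk'; apply: is_poly_sub => u; rewrite !in_before => /leq_trans; apply.
Qed.

Lemma is_poly_left_eigenvector lam s k : (k < N)%N ->
  is_poly N (before k.+1) (fun t => left_eigenvector lam (entry t) s k).
Proof.
elim/ltn_ind: k => k IH kN.
have [ks|sk|<-] := ltngtP k s.
- apply: (eq_is_poly (F := fun=> 0)) (is_poly_cst _ _ 0) => t.
  by rewrite left_eigenvector_lt.
- apply: eq_is_poly => [t|]; first by rewrite left_eigenvector_gt//; reflexivity.
  apply: is_polyM; last exact: is_poly_cst.
  apply: is_poly_sum => i _; apply: is_polyM; last by apply: is_poly_entry; rewrite ltn_ord.
  have ik := ltn_ord i.
  exact: is_poly_before (leqW ik) (IH i ik (ltn_trans ik kN)).
- apply: (eq_is_poly (F := fun=> 1)) (is_poly_cst _ _ 1) => t.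
  by rewrite left_eigenvector_eq.
Qed.

Section wick.
Variable k : nat.
Hypothesis kN : (k < N)%N.
Implicit Types f g h l : 'I_k -> (I -> R[i]) -> R[i].

Let column_upper : exists u : 'I_k -> I, [/\ forall (i : 'I_k) t, entry t i k = t (u i),
  injective u & forall i : 'I_k, val (val (u i)).2 = k].
Proof.
have U (i : 'I_k) := entry_upper (introT andP (conj (ltn_ord i) kN)).
have [u Hu] := choice U; exists u; split => [i t|i j uij|i].
- by have [] := Hu i.
- have [_ ui _] := Hu i; have [_ uj _] := Hu j.
  by apply: val_inj; rewrite /= -ui -uj uij.
- by have [] := Hu i.
Qed.

(** The coefficients depend on earlier columns, hence are independent of column [k]; averaging over
    that column identifies the two summation indices and gives the factor 1/N. *)
Lemma mean_column_pair f g :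
  (forall i, is_poly N (before k) (f i)) -> (forall i, is_poly N (before k) (g i)) ->
  mean (fun t => (\sum_i f i t * entry t i k) * (\sum_j g j t * entry t j k)^*%C) =
  mean (fun t => \sum_i f i t * (g i t)^*%C) / N%:R.
Proof.
move=> fp gp; have [u [ut ui uk]] := column_upper.
pose c : {pred I} := fun v => val (val v).2 == k.
have uc i : u i \in c by rewrite unfold_in uk.
have dis v : v \in before k -> v \notin c by rewrite in_before unfold_in => /ltn_eqF ->.
have fg i j : is_poly N (before k) (fun t => f i t * (g j t)^*%C).
  by apply: is_polyM => //; exact: is_poly_conj.
have tt i j : is_poly N c (fun t => t (u i) * (t (u j))^*%C).
  by apply: is_polyM; [|apply: is_poly_conj]; exact: is_poly_var.
have fgtt i j : is_poly N predT (fun t => f i t * (g j t)^*%C * (t (u i) * (t (u j))^*%C)).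
  by apply: is_polyM; [move: (fg i j)|move: (tt i j)]; apply: is_poly_sub.
rewrite (eq_mean _ (G := fun t => \sum_i \sum_j
    (f i t * (g j t)^*%C * (t (u i) * (t (u j))^*%C)))); last first.
  move=> t; rewrite rmorph_sum big_distrlr; apply: eq_bigr => i _.
  by apply: eq_bigr => j _; rewrite rmorphM !ut mulrACA.
rewrite (mean_sum N0 _ (S := predT)); last by move=> i _; apply: is_poly_sum => j _.
rewrite (mean_sum N0 _ (S := before k))// mulr_suml; apply: eq_bigr => i _.
rewrite (mean_sum N0 _ (S := predT))// (bigD1 i)//= big1 => [|j ji].
  by rewrite addr0 (meanM_indep N0 dis)// mean_pair// eqxx mul1r.
by rewrite (meanM_indep N0 dis)// mean_pair// (inj_eq ui) eq_sym (negPf ji) mul0r mulr0.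
Qed.

Let sum_two_pairs (a : 'I_k -> 'I_k -> 'I_k -> 'I_k -> R[i]) :
  \sum_i \sum_j \sum_p \sum_q a i j p q *
    (((i == j)%:R * (p == q)%:R + (i == q)%:R * (p == j)%:R) / N%:R ^+ 2) =
  (\sum_i \sum_p a i i p p + \sum_i \sum_p a i p p i) / N%:R ^+ 2.
Proof.
rewrite -big_split/= mulr_suml; apply: eq_bigr => i _.
transitivity (\sum_j \sum_p \sum_q (a i j p q * (i == j)%:R * (p == q)%:R / N%:R ^+ 2
   + a i j p q * (i == q)%:R * (p == j)%:R / N%:R ^+ 2)).
  by do 3 (apply: eq_bigr => ? _); ring.
rewrite mulrDl !mulr_suml.
under eq_bigr do (under eq_bigr do rewrite big_split/=; rewrite big_split/=).
rewrite big_split/=; congr (_ + _).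
  rewrite (bigD1 i)//= [X in _ + X]big1 ?addr0 => [|j ji].
    apply: eq_bigr => p _; rewrite (bigD1 p)//= big1 ?addr0 => [|q qp].
      by rewrite !eqxx !mulr1.
    by rewrite [p == q]eq_sym (negPf qp) mulr0 mul0r.
  apply: big1 => p _; apply: big1 => q _.
  by rewrite [i == j]eq_sym (negPf ji) mulr0 !mul0r.
apply: eq_bigr => j _.
rewrite (bigD1 j)//= [X in _ + X]big1 ?addr0 => [|p pj].
  rewrite (bigD1 i)//= big1 ?addr0 => [|q qi]; first by rewrite !eqxx !mulr1.
  by rewrite [i == q]eq_sym (negPf qi) mulr0 !mul0r.
by apply: big1 => q _; rewrite (negPf pj) mulr0 !mul0r.
Qed.

(** Same averaging with Wick's formula: the second term is the crossed pairing, in which [g] and [l]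
    exchange their partners. It couples B D with |C|^2. *)
Lemma mean_column_two_pairs f g h l :
  (forall i, is_poly N (before k) (f i)) -> (forall i, is_poly N (before k) (g i)) ->
  (forall i, is_poly N (before k) (h i)) -> (forall i, is_poly N (before k) (l i)) ->
  mean (fun t =>
    (\sum_i f i t * entry t i k) * (\sum_j g j t * entry t j k)^*%C *
    ((\sum_i h i t * entry t i k) * (\sum_j l j t * entry t j k)^*%C)) =
  mean (fun t =>
    (\sum_i f i t * (g i t)^*%C) * (\sum_p h p t * (l p t)^*%C) +
    (\sum_i f i t * (l i t)^*%C) * (\sum_p h p t * (g p t)^*%C)) / N%:R ^+ 2.
Proof.
move=> fp gp hp lp; have [u [ut ui uk]] := column_upper.
pose c : {pred I} := fun v => val (val v).2 == k.
have uc i : u i \in c by rewrite unfold_in uk.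
have dis v : v \in before k -> v \notin c by rewrite in_before unfold_in => /ltn_eqF ->.
pose F i j p q t := f i t * (g j t)^*%C * (h p t * (l q t)^*%C).
pose U i j p q (t : I -> R[i]) := t (u i) * (t (u j))^*%C * (t (u p) * (t (u q))^*%C).
have Fp i j p q : is_poly N (before k) (F i j p q).
  by do 2 (apply: is_polyM); try exact: is_poly_conj.
have Up i j p q : is_poly N c (U i j p q).
  have V v := @is_poly_var R I N _ _ (uc v).
  by do 2 (apply: is_polyM); try exact: is_poly_conj; exact: V.
have FUp i j p q : is_poly N predT (fun t => F i j p q t * U i j p q t).
  by apply: is_polyM; [move: (Fp i j p q)|move: (Up i j p q)]; apply: is_poly_sub.
rewrite (eq_mean _ (G := fun t => \sum_i \sum_j \sum_p \sum_q
    (F i j p q t * U i j p q t))); last first.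
  move=> t; rewrite !rmorph_sum !big_distrlr; apply: eq_bigr => i _.
  rewrite [RHS]exchange_big; apply: eq_bigr => p _; rewrite big_distrlr.
  apply: eq_bigr => j _; apply: eq_bigr => q _.
  by rewrite /F /U !rmorphM !ut/=; ring.
have sump (J : Type) (s : seq J) S (G : J -> (I -> R[i]) -> R[i]) :
    (forall j, is_poly N S (G j)) -> is_poly N S (fun t => \sum_(j <- s) G j t).
  by move=> Gp; apply: is_poly_sum.
rewrite (mean_sum N0 _ (S := predT)); last by move=> i _; do 3 (apply: (sump) => ?).
under eq_bigr => i _.
  rewrite (mean_sum N0 _ (S := predT)); last by move=> j _; do 2 (apply: (sump) => ?).
  under eq_bigr => j _.
    rewrite (mean_sum N0 _ (S := predT)); last by move=> p _; apply: (sump) => ?.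
    under eq_bigr => p _.
      rewrite (mean_sum N0 _ (S := predT))//.
      under eq_bigr => q _.
        rewrite (meanM_indep N0 dis)// /U mean_two_pairs// !(inj_eq ui).
        over.
      over.
    over.
  over.
rewrite (sum_two_pairs (fun i j p q => mean (F i j p q))); congr (_ / _).
rewrite (eq_mean _ (G := fun t =>
  \sum_i \sum_p F i i p p t + \sum_i \sum_p F i p p i t)); last first.
  move=> t; rewrite !big_distrlr; congr (_ + _).
  by apply: eq_bigr => i _; apply: eq_bigr => p _; rewrite /F/=; ring.
rewrite (meanD N0 (S := before k)); [|by do 2 (apply: (sump) => ?)..].
congr (_ + _);
  (rewrite (mean_sum N0 _ (S := before k)); last by move=> i _; apply: (sump) => ?);
  by apply: eq_bigr => i _; rewrite (mean_sum N0 _ (S := before k)).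
Qed.

End wick.
End column.

Section column_recursion.
Context (R : realType) (n : nat) (lam : nat -> R[i]).
Local Notation N := n.+2.
Local Notation I := (upper N).
Local Notation mean := (@mean R I N).
Let N0 : (0 < N)%N := ltn0Sn _.
Implicit Types (t : I -> R[i]) (V F G : (I -> R[i]) -> R[i]).

(** Partial sums over the first [k] coordinates: the index pairs (0, 0), (1, 1) and (0, 1) give B, D
    and C when k = N. *)
Definition left_dot r s k t : R[i] :=
  \sum_(i < k) left_eigenvector lam (entry t) r i *
               (left_eigenvector lam (entry t) s i)^*%C.

Definition column_dot s k t : R[i] :=
  \sum_(i < k) left_eigenvector lam (entry t) s i * entry t i k.

Lemma is_poly_left_eigenvector_before s k i : (k <= N)%N -> (i < k)%N ->
  is_poly N (before k) (fun t => left_eigenvector lam (entry t) s i).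
Proof.
move=> kN ik; apply: (is_poly_before ik).
by apply: is_poly_left_eigenvector; rewrite (leq_trans ik).
Qed.

Lemma is_poly_left_dot r s k : (k <= N)%N -> is_poly N (before k) (left_dot r s k).
Proof.
move=> kN; apply: is_poly_sum => i _; apply: is_polyM; last apply: is_poly_conj.
  exact: is_poly_left_eigenvector_before.
exact: is_poly_left_eigenvector_before.
Qed.

Lemma is_poly_column_dot s k : (k < N)%N -> is_poly N (before k.+1) (column_dot s k).
Proof.
move=> kN; apply: is_poly_sum => i _; apply: is_polyM.
  by apply: is_poly_left_eigenvector_before => //; rewrite ltnS ltnW.
by apply: is_poly_entry; rewrite ltn_ord.
Qed.

Lemma left_dotC r s k t : (left_dot r s k t)^*%C = left_dot s r k t.
Proof.
rewrite /left_dot rmorph_sum; apply: eq_bigr => i _.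
by rewrite rmorphM/= conjcK mulrC.
Qed.

Lemma left_dotS r s k t : (r < k)%N -> (s < k)%N -> left_dot r s k.+1 t =
  left_dot r s k t + (lam r - lam k)^-1 * ((lam s - lam k)^-1)^*%C *
    (column_dot r k t * (column_dot s k t)^*%C).
Proof.
move=> rk sk; rewrite /left_dot big_ord_recr/= !left_eigenvector_gt//; congr (_ + _).
by rewrite rmorphM mulrACA mulrC.
Qed.

Section step.
Variables (k : nat) (V : (I -> R[i]) -> R[i]).
Hypotheses (kN : (k < N)%N) (Vp : is_poly N (before k) V).

(** The weight [V] is absorbed into the first family of coefficients, which remains polynomial in
    the earlier columns. *)
Lemma mean_column_dot r s :
  mean (fun t => V t * (column_dot r k t * (column_dot s k t)^*%C)) =
  mean (fun t => V t * left_dot r s k t) / N%:R.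
Proof.
pose f r (i : 'I_k) t := left_eigenvector lam (entry t) r i.
have fp s' i : is_poly N (before k) (f s' i).
  by apply: is_poly_left_eigenvector_before => //; exact: ltnW.
have := mean_column_pair kN (f := fun i t => V t * f r i t) (g := f s)
  (fun i => is_polyM Vp (fp r i)) (fp s).
rewrite (eq_mean _ (G := fun t => V t * (column_dot r k t * (column_dot s k t)^*%C))).
  move=> ->; congr (_ / _); apply: eq_mean => t.
  by rewrite mulr_sumr; apply: eq_bigr => i _; rewrite mulrA.
move=> t; rewrite mulrA; congr (_ * _).
by rewrite mulr_sumr; apply: eq_bigr => i _; rewrite mulrA.
Qed.

Lemma mean_column_dot2 r s r' s' :
  mean (fun t => V t * (column_dot r k t * (column_dot s k t)^*%C *
                        (column_dot r' k t * (column_dot s' k t)^*%C))) =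
  mean (fun t => V t * (left_dot r s k t * left_dot r' s' k t) +
                 V t * (left_dot r s' k t * left_dot r' s k t)) / N%:R ^+ 2.
Proof.
pose f r (i : 'I_k) t := left_eigenvector lam (entry t) r i.
have fp q i : is_poly N (before k) (f q i).
  by apply: is_poly_left_eigenvector_before => //; exact: ltnW.
have := mean_column_two_pairs kN (f := fun i t => V t * f r i t) (g := f s)
  (h := f r') (l := f s') (fun i => is_polyM Vp (fp r i)) (fp s) (fp r') (fp s').
rewrite (eq_mean _ (G := fun t => V t * (column_dot r k t * (column_dot s k t)^*%C *
  (column_dot r' k t * (column_dot s' k t)^*%C)))).
  move=> ->; congr (_ / _); apply: eq_mean => t.
  rewrite [V t * (_ * _)]mulrA [V t * (left_dot r s' k t * _)]mulrA.
  by congr (_ * _ + _ * _) => //; rewrite mulr_sumr; apply: eq_bigr => i _; rewrite mulrA.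
move=> t; rewrite [RHS]mulrA; congr (_ * _); rewrite [RHS]mulrA; congr (_ * _).
by rewrite mulr_sumr; apply: eq_bigr => i _; rewrite mulrA.
Qed.

End step.

Lemma meanDZ c (F G : (I -> R[i]) -> R[i]) : is_poly N predT F -> is_poly N predT G ->
  mean (fun t => c * F t + G t) = c * mean F + mean G.
Proof.
move=> Fp Gp; rewrite (meanD N0 (S := predT))//.
  by rewrite (meanZ N0 (S := predT)).
by apply: is_polyM => //; exact: is_poly_cst.
Qed.

Lemma is_poly_predT (S : {pred I}) F : is_poly N S F -> is_poly N predT F.
Proof. exact: is_poly_sub. Qed.

(** Eight terms, each a scalar times an expression of known mean, nested to the right as successive
    uses of [meanDZ] require. *)
Let step_expansion (W al be B D C C' a b ac bc u v uc vc : R[i]) :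
  W * (al * ((B + a * ac * (u * uc)) * (D + b * bc * (v * vc))) +
       be * ((C + a * bc * (u * vc)) * (C' + b * ac * (v * uc)))) =
  al * (W * (B * D)) + (al * (a * ac) * (W * D * (u * uc)) +
  (al * (b * bc) * (W * B * (v * vc)) +
  (al * (a * ac * (b * bc)) * (W * (u * uc * (v * vc))) +
  (be * (W * (C * C')) + (be * (a * bc) * (W * C' * (u * vc)) +
  (be * (b * ac) * (W * C * (v * uc)) +
   be * (a * ac * (b * bc)) * (W * (u * vc * (v * uc))))))))).
Proof. by ring. Qed.

(* Both coordinates of the pair of products below are propagated by the same
   matrix, up to a scalar: (al, be) is an eigenvector, of eigenvalue mu, of the
   matrix [[1, 1], [1, 1 - delta]] with delta = N |z|^2. *)
Lemma mean_left_dotS (z al be mu : R[i]) k V :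
  lam 0%N = 0 -> lam 1%N = z -> lam k != 0 -> lam k != z -> (1 < k < N)%N ->
  al + be = mu * al -> al + be - N%:R * (z * z^*%C) * be = mu * be ->
  is_poly N (before k) V ->
  let X k t := al * (left_dot 0 0 k t * left_dot 1 1 k t) +
               be * (left_dot 0 1 k t * left_dot 1 0 k t) in
  let p := (lam k * (lam k)^*%C)^-1 in
  let q := ((z - lam k) * (z - lam k)^*%C)^-1 in
  mean (fun t => V t * X k.+1 t) =
  (1 + (p + q) / N%:R + mu * (p * q) / N%:R ^+ 2) * mean (fun t => V t * X k t).
Proof.
move=> l0 l1 lk0 lkz /andP[k1 kN] eig1 eig2 Vp X p q.
have k0 : (0 < k)%N by exact: ltnW.
have dp r s : is_poly N (before k) (left_dot r s k).
  by apply: is_poly_left_dot; exact: ltnW.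
have cp r : is_poly N predT (column_dot r k) := is_poly_predT (is_poly_column_dot r kN).
have Vdp r s : is_poly N (before k) (fun t => V t * left_dot r s k t).
  exact: is_polyM.
have Vdp' r s r' s' : is_poly N (before k) (fun t =>
    V t * (left_dot r s k t * left_dot r' s' k t)).
  by apply: is_polyM => //; exact: is_polyM.
pose u := column_dot 0 k; pose v := column_dot 1 k.
pose a := (lam 0%N - lam k)^-1; pose b := (lam 1%N - lam k)^-1.
pose x := mean (fun t => V t * (left_dot 0 0 k t * left_dot 1 1 k t)).
pose y := mean (fun t => V t * (left_dot 0 1 k t * left_dot 1 0 k t)).
have one r s r' s' : mean (fun t => V t * left_dot r s k t *
    (column_dot r' k t * (column_dot s' k t)^*%C)) =
  mean (fun t => V t * (left_dot r s k t * left_dot r' s' k t)) / N%:R.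
  rewrite (mean_column_dot kN (Vdp r s)); congr (_ / _).
  by apply: eq_mean => t; rewrite mulrA.
have onep r s r' s' : is_poly N predT (fun t => V t * left_dot r s k t *
    (column_dot r' k t * (column_dot s' k t)^*%C)).
  apply: is_polyM; first exact: is_poly_predT (Vdp r s).
  by apply: is_polyM; [|apply: is_poly_conj]; exact: cp.
have twop r s r' s' : is_poly N predT (fun t => V t *
    (column_dot r k t * (column_dot s k t)^*%C *
    (column_dot r' k t * (column_dot s' k t)^*%C))).
  apply: is_polyM; first exact: is_poly_predT Vp.
  by do 2 apply: is_polyM; try (apply: is_poly_conj); exact: cp.
have zero := is_poly_predT (Vdp' _ _ _ _).
have E0 : mean (fun t => V t * X k t) = al * x + be * y.
  transitivity (mean (fun t => al * (V t * (left_dot 0 0 k t * left_dot 1 1 k t)) +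
    be * (V t * (left_dot 0 1 k t * left_dot 1 0 k t)))).
    by apply: eq_mean => t; rewrite mulrDr; congr (_ + _); exact: mulrCA.
  rewrite meanDZ//; first by rewrite (meanZ N0 (S := before k)).
  by apply: is_polyM => //; exact: is_poly_cst.
have E1 : mean (fun t => V t * X k.+1 t) =
  al * x + (al * (a * a^*%C) * (x / N%:R) + (al * (b * b^*%C) * (x / N%:R) +
  (al * (a * a^*%C * (b * b^*%C)) * ((x + y) / N%:R ^+ 2) +
  (be * y + (be * (a * b^*%C) * (y / N%:R) + (be * (b * a^*%C) * (y / N%:R) +
   be * (a * a^*%C * (b * b^*%C)) * ((y + x) / N%:R ^+ 2))))))).
  rewrite (eq_mean _ (G := fun t =>
    al * (V t * (left_dot 0 0 k t * left_dot 1 1 k t)) +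
    (al * (a * a^*%C) * (V t * left_dot 1 1 k t * (u t * (u t)^*%C)) +
    (al * (b * b^*%C) * (V t * left_dot 0 0 k t * (v t * (v t)^*%C)) +
    (al * (a * a^*%C * (b * b^*%C)) * (V t * (u t * (u t)^*%C * (v t * (v t)^*%C))) +
    (be * (V t * (left_dot 0 1 k t * left_dot 1 0 k t)) +
    (be * (a * b^*%C) * (V t * left_dot 1 0 k t * (u t * (v t)^*%C)) +
    (be * (b * a^*%C) * (V t * left_dot 0 1 k t * (v t * (u t)^*%C)) +
    be * (a * a^*%C * (b * b^*%C)) * (V t * (u t * (v t)^*%C * (v t * (u t)^*%C)))
    )))))))); last by move=> t; rewrite /X !left_dotS//; exact: step_expansion.
  have mZ c F := @meanZ R I N N0 predT c F.
  have ZP c F (Fp : is_poly N predT F) := is_polyM (is_poly_cst N predT c) Fp.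
  (* [p8] up to [p2] state that the successive tails of the nested sum are polynomial. *)
  have p8 := ZP (be * (a * a^*%C * (b * b^*%C))) _ (twop 0 1 1 0).
  have p7 := is_polyD (ZP (be * (b * a^*%C)) _ (onep 0 1 1 0)) p8.
  have p6 := is_polyD (ZP (be * (a * b^*%C)) _ (onep 1 0 0 1)) p7.
  have p5 := is_polyD (ZP be _ (zero 0 1 1 0)) p6.
  have p4 := is_polyD (ZP (al * (a * a^*%C * (b * b^*%C))) _ (twop 0 0 1 1)) p5.
  have p3 := is_polyD (ZP (al * (b * b^*%C)) _ (onep 0 0 1 1)) p4.
  have p2 := is_polyD (ZP (al * (a * a^*%C)) _ (onep 1 1 0 0)) p3.
  rewrite (meanDZ _ (zero 0 0 1 1) p2) (meanDZ _ (onep 1 1 0 0) p3).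
  rewrite (meanDZ _ (onep 0 0 1 1) p4) (meanDZ _ (twop 0 0 1 1) p5).
  rewrite (meanDZ _ (zero 0 1 1 0) p6) (meanDZ _ (onep 1 0 0 1) p7).
  rewrite (meanDZ _ (onep 0 1 1 0) p8) (mZ _ _ (twop 0 1 1 0)).
  have xC : mean (fun t => V t * (left_dot 1 1 k t * left_dot 0 0 k t)) = x.
    by apply: eq_mean => t; congr (_ * _); exact: mulrC.
  have yC : mean (fun t => V t * (left_dot 1 0 k t * left_dot 0 1 k t)) = y.
    by apply: eq_mean => t; congr (_ * _); exact: mulrC.
  have xy := meanD N0 (Vdp' 0 0 1 1) (Vdp' 0 1 1 0).
  have yx := meanD N0 (Vdp' 0 1 1 0) (Vdp' 0 0 1 1).
  congr (_ * _ + (_ * _ + (_ * _ + (_ * _ + (_ * _ + (_ * _ + (_ * _ + _ * _))))))).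
  - by rewrite (one 1 1 0 0) xC.
  - exact: one 0 0 1 1.
  - by rewrite (mean_column_dot2 kN Vp 0 0 1 1) xy.
  - by rewrite (one 1 0 0 1) yC.
  - exact: one 0 1 1 0.
  - by rewrite (mean_column_dot2 kN Vp 0 1 1 0) yx.
have Np : N%:R != 0 :> R[i] by rewrite pnatr_eq0.
have pE : p = a * a^*%C.
  rewrite /p /a l0 sub0r rmorphV ?unitfE ?oppr_eq0//= rmorphN/= -invfM.
  by rewrite mulrNN.
have qE : q = b * b^*%C.
  by rewrite /q /b l1 rmorphV ?unitfE ?subr_eq0 1?eq_sym//= -invfM.
have zab : a - b = z * (a * b).
  rewrite /a /b l0 l1 sub0r; field.
  by rewrite lk0 subr_eq0 eq_sym lkz.
have zabC : a^*%C - b^*%C = z^*%C * (a^*%C * b^*%C).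
  by have := congr1 (@conjc R) zab; rewrite rmorphB !rmorphM.
(* The only terms not already written in p and q. The squared modulus of a - b = z a b removes them,
   and delta enters here. *)
have cross : a * b^*%C + b * a^*%C = p + q - z * z^*%C * (p * q).
  have h : (a - b) * (a^*%C - b^*%C) = z * (a * b) * (z^*%C * (a^*%C * b^*%C)).
    by rewrite zab zabC.
  transitivity (p + q - (a - b) * (a^*%C - b^*%C)); first by rewrite pE qE; ring.
  by rewrite h pE qE; ring.
rewrite E1 E0.
transitivity (al * x + be * y + al * (p + q) * (x / N%:R) +
  be * (a * b^*%C + b * a^*%C) * (y / N%:R) +
  (p * q) * (al + be) * ((x + y) / N%:R ^+ 2)); first by rewrite pE qE; ring.
transitivity (al * x + be * y + (p + q) / N%:R * (al * x + be * y) +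
  (p * q) / N%:R ^+ 2 * (mu * al * x + mu * be * y)); last by ring.
by rewrite cross -eig1 -eig2; field.
Qed.

End column_recursion.

(** * Means of the overlaps given the eigenvalues *)

Section mean_overlaps.
Context (R : realType) (n : nat) (lam : nat -> R[i]) (z : R[i]).
Local Notation N := n.+2.
Local Notation I := (upper N).
Local Notation mean := (@mean R I N).
Let N0 : (0 < N)%N := ltn0Sn _.
Implicit Types (t : I -> R[i]) (V F G : (I -> R[i]) -> R[i]).
Hypotheses (l0 : lam 0%N = 0) (l1 : lam 1%N = z) (z0 : z != 0).
Hypothesis lk : forall k, (1 < k < N)%N -> lam k != 0 /\ lam k != z.

(** The scalar by which a column with diagonal entry [l] acts on an eigenvector of [[1, 1],
    [1, 1 - delta]] of eigenvalue [mu]. *)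
Definition eigenvalue_factor (mu l : R[i]) : R[i] :=
  let p := (l * l^*%C)^-1 in
  let q := ((z - l) * (z - l)^*%C)^-1 in
  1 + (p + q) / N%:R + mu * (p * q) / N%:R ^+ 2.

Lemma mean_left_dot (al be mu : R[i]) V :
  al + be = mu * al -> al + be - N%:R * (z * z^*%C) * be = mu * be ->
  is_poly N (before 2) V ->
  let X k t := al * (left_dot lam 0 0 k t * left_dot lam 1 1 k t) +
               be * (left_dot lam 0 1 k t * left_dot lam 1 0 k t) in
  mean (fun t => V t * X N t) =
  (\prod_(2 <= k < N) eigenvalue_factor mu (lam k)) * mean (fun t => V t * X 2%N t).
Proof.
move=> eig1 eig2 Vp X.
suff H k : (1 < k <= N)%N -> mean (fun t => V t * X k t) =
    (\prod_(2 <= j < k) eigenvalue_factor mu (lam j)) * mean (fun t => V t * X 2%N t).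
  by apply: H; rewrite leqnn.
elim: k => // k IH; rewrite ltnS leq_eqVlt => /andP[/predU1P[<- _|k1 kN]].
  by rewrite big_geq// mul1r.
have [lk0 lkz] : lam k != 0 /\ lam k != z by apply: lk; rewrite k1.
rewrite (mean_left_dotS l0 l1 lk0 lkz _ eig1 eig2); last 2 first.
- by rewrite k1.
- by apply: is_poly_before Vp.
rewrite IH; last by rewrite k1 ltnW.
by rewrite big_nat_recr//= mulrCA mulrA.
Qed.

Definition beta t : R[i] :=
  left_eigenvector lam (entry t) 0 1 * (left_eigenvector lam (entry t) 0 1)^*%C.

Let left_eigenvector01 t : left_eigenvector lam (entry t) 0 1 = - z^-1 * entry t 0 1.
Proof.
rewrite left_eigenvector_gt// big_ord_recl big_ord0 addr0 left_eigenvector_eq mul1r.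
by rewrite l0 l1 sub0r invrN mulrC.
Qed.

Let left_eigenvector10 t : left_eigenvector lam (entry t) 1 0 = 0.
Proof. exact: left_eigenvector_lt. Qed.

Let left_dot2 t :
  [/\ left_dot lam 0 0 2 t = 1 + beta t, left_dot lam 1 1 2 t = 1 &
      left_dot lam 0 1 2 t * left_dot lam 1 0 2 t = beta t].
Proof.
pose b r i := left_eigenvector lam (entry t) r i.
have S r s : left_dot lam r s 2 t = b r 0%N * (b s 0%N)^*%C + b r 1%N * (b s 1%N)^*%C.
  by rewrite /left_dot big_ord_recl big_ord1.
rewrite !S /b !left_eigenvector_eq left_eigenvector10 !rmorph0 !rmorph1 /beta.
by split; ring.
Qed.

(** [beta] is |T_12|^2 / |z|^2, and |T_12|^2 is exponential of mean 1/N; hence the moments 1/delta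
    and 2/delta^2. *)
Let beta_mean : [/\ is_poly N (before 2) beta,
  mean beta = (N%:R * (z * z^*%C))^-1 &
  mean (fun t => beta t * beta t) = 2 / (N%:R * (z * z^*%C)) ^+ 2].
Proof.
have kN : (0 < 1 < N)%N by [].
have [u [ut _ uk]] := entry_upper R kN.
have zz : z * z^*%C != 0 by rewrite mulf_neq0// conjc_eq0.
have Np : N%:R != 0 :> R[i] by rewrite pnatr_eq0.
have bE t : beta t = (z * z^*%C)^-1 * (t u * (t u)^*%C).
  rewrite /beta left_eigenvector01 ut rmorphM rmorphN rmorphV ?unitfE//=.
  by rewrite mulrACA mulrNN -invfM.
have up : is_poly N (before 2) (fun t => t u * (t u)^*%C).
  have V : is_poly N (before 2) (fun t => t u) by apply: is_poly_var; rewrite in_before uk.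
  by apply: is_polyM => //; exact: is_poly_conj.
split.
- apply: (eq_is_poly (F := fun t => (z * z^*%C)^-1 * (t u * (t u)^*%C))) => //.
  by apply: is_polyM => //; exact: is_poly_cst.
- rewrite (eq_mean _ bE) (meanZ N0 _ up) mean_pair// eqxx mul1r -invfM.
  by rewrite [N%:R * _]mulrC.
- rewrite (eq_mean _ (G := fun t => (z * z^*%C)^-1 ^+ 2 *
    (t u * (t u)^*%C * (t u * (t u)^*%C)))); last by move=> t; rewrite !bE; ring.
  rewrite (meanZ N0 (S := before 2)); last exact: is_polyM.
  rewrite mean_two_pairs// eqxx -[true%:R]/(1 : R[i]); field.
  apply/and3P; split => //.
  by move: z0; rewrite -conjc_eq0.
Qed.

Variable A : R[i].
Hypotheses (A0 : A != 0) (A1 : A + 1 != 0) (A_1 : A - 1 != 0) (A2 : 1 + A ^+ 2 != 0).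
Hypothesis delta_A : N%:R * (z * z^*%C) = A - A^-1.
Let f x := \prod_(2 <= k < N) eigenvalue_factor (1 - x) (lam k).

(** The eigenvectors are (A, 1), of eigenvalue 1 + 1/A, and (1, -A), of eigenvalue 1 - A; the second
    coordinates use delta = A - 1/A. On the right stands the value after two columns, where B D = 1
    + beta and |C|^2 = beta. *)
Let eig V : is_poly N (before 2) V ->
  mean (fun t => V t * (A * (left_dot lam 0 0 N t * left_dot lam 1 1 N t) +
               1 * (left_dot lam 0 1 N t * left_dot lam 1 0 N t))) =
  f (- A^-1) * mean (fun t => V t * (A * (1 + beta t) + beta t)) /\
  mean (fun t => V t * (1 * (left_dot lam 0 0 N t * left_dot lam 1 1 N t) +
               - A * (left_dot lam 0 1 N t * left_dot lam 1 0 N t))) =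
  f A * mean (fun t => V t * (1 + beta t - A * beta t)).
Proof.
move=> Vp; split.
  rewrite (mean_left_dot (mu := 1 - - A^-1))//; last 2 first.
  - by field.
  - by rewrite delta_A; field.
  congr (_ * _); apply: eq_mean => t.
  by have [-> -> ->] := left_dot2 t; rewrite mulr1 mul1r.
rewrite (mean_left_dot (mu := 1 - A))//; last 2 first.
- by ring.
- by rewrite delta_A; field.
congr (_ * _); apply: eq_mean => t.
by have [-> -> ->] := left_dot2 t; rewrite mulr1 mul1r mulNr.
Qed.

Let mean_quadratic c0 c1 c2 :
  mean (fun t => c2 * (beta t * beta t) + (c1 * beta t + c0)) =
  c2 * (2 / (A - A^-1) ^+ 2) + (c1 / (A - A^-1) + c0).
Proof.
have [/is_poly_predT bp b1 b2] := beta_mean.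
have bbp := is_polyM bp bp.
have cp c := @is_poly_cst R I N predT c.
rewrite (meanDZ _ bbp (is_polyD (is_polyM (cp c1) bp) (cp c0))).
by rewrite (meanDZ _ bp (cp c0)) mean_cst// b1 b2 delta_A.
Qed.

Let split_mean V al be : is_poly N (before 2) V ->
  mean (fun t => V t * (al * (left_dot lam 0 0 N t * left_dot lam 1 1 N t) +
                        be * (left_dot lam 0 1 N t * left_dot lam 1 0 N t))) =
  al * mean (fun t => V t * (left_dot lam 0 0 N t * left_dot lam 1 1 N t)) +
  be * mean (fun t => V t * (left_dot lam 0 1 N t * left_dot lam 1 0 N t)).
Proof.
move=> Vp0; have Vp := is_poly_predT Vp0.
have dp r s : @is_poly R I N predT (left_dot lam r s N).
  exact: is_poly_predT (is_poly_left_dot lam r s (leqnn N)).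
have Vdp r s r' s' : is_poly N predT (fun t =>
    V t * (left_dot lam r s N t * left_dot lam r' s' N t)).
  by apply: is_polyM => //; exact: is_polyM.
rewrite -(meanZ N0 be (Vdp _ _ _ _)) -meanDZ//; last first.
  by apply: is_polyM => //; exact: is_poly_cst.
by apply: eq_mean => t; rewrite mulrDr; congr (_ + _); exact: mulrCA.
Qed.

Let A2_1 : A ^+ 2 - 1 != 0.
Proof. by rewrite (_ : A ^+ 2 - 1 = (A + 1) * (A - 1)) ?mulf_neq0//; ring. Qed.

(** The two eigenvectors are orthogonal with the same square 1 + A^2, which is the origin of the
    prefactor 1 / (1 + a^2). *)
Let solve_eig (x y m1 m2 : R[i]) : A * x + 1 * y = m1 -> 1 * x + - A * y = m2 ->
  x = (1 + A ^+ 2)^-1 * (A * m1 + m2) /\ y = (1 + A ^+ 2)^-1 * (m1 - A * m2).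
Proof. by move=> <- <-; split; field. Qed.

(** The weight is V = [beta], the contribution of the right eigenvectors to |O_12|^2; the second
    coordinate |C|^2 is extracted. *)
Lemma mean_overlap_offdiag :
  mean (fun t => beta t * (left_dot lam 0 1 N t * left_dot lam 1 0 N t)) =
  (1 + A ^+ 2)^-1 * (A ^+ 2 / (A + 1) ^+ 2 * f A + A ^+ 2 / (A - 1) ^+ 2 * f (- A^-1)).
Proof.
have [bp _ _] := beta_mean.
have [e1 e2] := eig bp.
have q1 : mean (fun t => beta t * (A * (1 + beta t) + beta t)) =
    (A + 1) * (2 / (A - A^-1) ^+ 2) + (A / (A - A^-1) + 0).
  rewrite (eq_mean _ (G := fun t => (A + 1) * (beta t * beta t) + (A * beta t + 0))).
    exact: mean_quadratic.
  by move=> t; ring.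
have q2 : mean (fun t => beta t * (1 + beta t - A * beta t)) =
    (1 - A) * (2 / (A - A^-1) ^+ 2) + (1 / (A - A^-1) + 0).
  rewrite (eq_mean _ (G := fun t => (1 - A) * (beta t * beta t) + (1 * beta t + 0))).
    exact: mean_quadratic.
  by move=> t; ring.
have {}e1 := etrans (esym (split_mean _ _ bp)) (etrans e1 (congr1 (fun v => _ * v) q1)).
have {}e2 := etrans (esym (split_mean _ _ bp)) (etrans e2 (congr1 (fun v => _ * v) q2)).
(* With delta = (A^2 - 1)/A the values in [q1] and [q2] collapse to A^2/(A - 1)^2 and -A/(A +
   1)^2. *)
apply: etrans (proj2 (solve_eig e1 e2)) _; field.
by rewrite A1 A_1 A2 A0 A2_1.
Qed.

(** The weight is now V = 1 + [beta], the squared norm of the right eigenvector of z, and the first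
    coordinate B D is extracted. *)
Lemma mean_overlap_diag :
  mean (fun t => (1 + beta t) * (left_dot lam 0 0 N t * left_dot lam 1 1 N t)) =
  (1 + A ^+ 2)^-1 * (1 / (A + 1) ^+ 2 * f A + A ^+ 4 / (A - 1) ^+ 2 * f (- A^-1)).
Proof.
have [bp _ _] := beta_mean.
have bp1 : is_poly N (before 2) (fun t => 1 + beta t).
  by apply: is_polyD => //; exact: is_poly_cst.
have [e1 e2] := eig bp1.
have q1 : mean (fun t => (1 + beta t) * (A * (1 + beta t) + beta t)) =
    (A + 1) * (2 / (A - A^-1) ^+ 2) + ((2 * A + 1) / (A - A^-1) + A).
  rewrite (eq_mean _ (G := fun t => (A + 1) * (beta t * beta t) + ((2 * A + 1) * beta t + A))).
    exact: mean_quadratic.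
  by move=> t; ring.
have q2 : mean (fun t => (1 + beta t) * (1 + beta t - A * beta t)) =
    (1 - A) * (2 / (A - A^-1) ^+ 2) + ((2 - A) / (A - A^-1) + 1).
  rewrite (eq_mean _ (G := fun t => (1 - A) * (beta t * beta t) + ((2 - A) * beta t + 1))).
    exact: mean_quadratic.
  by move=> t; ring.
have {}e1 := etrans (esym (split_mean _ _ bp1)) (etrans e1 (congr1 (fun v => _ * v) q1)).
have {}e2 := etrans (esym (split_mean _ _ bp1)) (etrans e2 (congr1 (fun v => _ * v) q2)).
(* Here [q1] and [q2] collapse to A^3/(A - 1)^2 and 1/(A + 1)^2. *)
apply: etrans (proj1 (solve_eig e1 e2)) _; field.
by rewrite A1 A_1 A2 A0 A2_1.
Qed.

End mean_overlaps.

(** * Overlaps of a triangular matrix *)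

Section triangular_overlap.
Context (R : realType) (n : nat) (lam : nat -> R[i]) (T : nat -> nat -> R[i]).
Local Notation N := n.+2.
Variable G : 'M[R[i]]_N.
Hypothesis GE : forall i j : 'I_N,
  G i j = if i == j then lam i else if (i < j)%N then T i j else 0.
Hypothesis lam_inj : forall i j : 'I_N, lam i = lam j -> i = j.
Local Notation lev := (left_eigenvector lam T).

Lemma sum_triangular (x : nat -> R[i]) (k : 'I_N) :
  \sum_(i < N) x i * G i k = \sum_(i < k) x i * T i k + x k * lam k.
Proof.
rewrite (bigID (fun i : 'I_N => (i < k)%N))/=; congr (_ + _).
  rewrite -(big_mkord xpredT (fun i => x i * T i k)) (big_nat_widen _ _ N)/=; last first.
    exact: ltnW.
  rewrite big_mkord; apply: eq_bigr => i ik; rewrite GE ik ifF//.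
  by apply/negbTE; apply: contraTneq ik => ->; rewrite ltnn.
rewrite (bigD1 k) ?ltnn//= big1 ?addr0 => [|i /andP[ik ki]].
  by rewrite GE eqxx.
by rewrite GE (negPf ki) (negPf ik) mulr0.
Qed.

Definition left_mx : 'M[R[i]]_N := \matrix_(s, k) lev s k.

Lemma left_mx_mul : left_mx *m G = diag_mx (\row_s lam s) *m left_mx.
Proof.
apply/matrixP => s k; rewrite mul_diag_mx !mxE.
under eq_bigr do rewrite mxE.
rewrite (sum_triangular (lev s)).
have [ks|sk|/val_inj ks] := ltngtP k s.
- rewrite big1 ?add0r ?left_eigenvector_lt ?mul0r ?mulr0// => i _.
  by rewrite left_eigenvector_lt ?mul0r// (ltn_trans _ ks).
- rewrite [lev s k]left_eigenvector_gt//; field.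
  by rewrite subr_eq0; apply: contraTneq sk => /lam_inj ->; rewrite ltnn.
- rewrite ks left_eigenvector_eq big1 ?add0r ?mul1r ?mulr1// => i _.
  by rewrite left_eigenvector_lt ?mul0r// -ks.
Qed.

(** Forward substitution: distinct eigenvalues force the coordinates before [s] to vanish, and those
    after [s] obey the recursion of [left_eigenvector], scaled by x_s. *)
Lemma left_eigenvector_unique (x : nat -> R[i]) (s : 'I_N) :
  (forall k : 'I_N, \sum_(i < N) x i * G i k = lam s * x k) ->
  forall k : 'I_N, x k = x s * lev s k.
Proof.
move=> xG; suff H k : (k < N)%N -> x k = x s * lev s k by move=> k; exact: H.
elim/ltn_ind: k => k IH kN.
have := xG (Ordinal kN); rewrite sum_triangular/= => e.
have {}e : x k * (lam s - lam k) = \sum_(i < k) x i * T i k.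
  by rewrite mulrBr [x k * _]mulrC -e; ring.
have sk0 : k != s -> lam s - lam k != 0.
  apply: contraNneq => /eqP; rewrite subr_eq0 => /eqP.
  by move=> /(lam_inj (j := Ordinal kN)) ->.
have [ks|sk|->] := ltngtP k s; last by rewrite left_eigenvector_eq mulr1.
- rewrite left_eigenvector_lt// mulr0; apply/eqP.
  rewrite -(mulIr_eq0 _ (mulIf (sk0 _))) ?ltn_eqF// e big1// => i _.
  rewrite IH ?left_eigenvector_lt ?mulr0 ?mul0r//.
    by rewrite (ltn_trans _ ks).
  by rewrite (ltn_trans _ kN).
- rewrite left_eigenvector_gt// mulrA mulr_sumr.
  under eq_bigr => i _ do rewrite mulrA -IH// ?(ltn_trans _ kN)//.
  by rewrite -e mulfK// sk0// gtn_eqF.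
Qed.

Lemma left_mx_unit : left_mx \in unitmx.
Proof.
rewrite unitmxE -det_tr det_trig.
  rewrite big1 ?unitr1// => i _; by rewrite !mxE left_eigenvector_eq.
by apply/is_trig_mxP => i j ij; rewrite !mxE left_eigenvector_lt.
Qed.

(** The rows of [left_mx] and the columns of its inverse form a biorthogonal family, so the choice
    in [overlap] is made in a nonempty set. Any other family differs by factors c_s on the left and
    1/c_s on the right, which cancel in the overlap. *)
Lemma overlap_triangular (i j : 'I_N) :
  overlap G (fun i : 'I_N => lam i) i j =
  (\sum_k (invmx left_mx k j)^*%C * invmx left_mx k i) *
  (\sum_(k < N) (lev j k)^*%C * lev i k).
Proof.
set v := _ * _; rewrite /overlap.
have lu := left_mx_unit.
have scalar (x y : 'cV[R[i]]_N) : (map_mx Num.conj x^T *m y) 0 0 = \sum_k (x k 0)^*%C * y k 0.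
  by rewrite mxE; apply: eq_bigr => k _; rewrite !mxE.
set P := [set o | _].
have Pv : P v.
  split; first exact: lam_inj.
  exists (fun i => col i (invmx left_mx)), (fun i => (row i left_mx)^T); split; last first.
    rewrite !scalar; congr (_ * _); apply: eq_bigr => k _; by rewrite !mxE.
  split => [s|s|s r].
  - have : G *m invmx left_mx = invmx left_mx *m diag_mx (\row_s lam s).
      rewrite -[LHS]mul1mx -(mulVmx lu) -mulmxA (mulmxA left_mx) left_mx_mul.
      by rewrite -(mulmxA (diag_mx _) left_mx) mulmxV// mulmx1.
    move=> /matrixP e; apply/colP => k; move: (e k s).
    rewrite mul_mx_diag !mxE [RHS]mulrC => <-.
    by apply: eq_bigr => m _; rewrite mxE.
  - by rewrite trmxK -row_mul left_mx_mul; apply/rowP => k; rewrite mxE mul_diag_mx !mxE.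
  - rewrite trmxK; apply/matrixP => a b; rewrite !ord1 !mxE eqxx mulr1n.
    have /matrixP/(_ s r) := mulmxV lu; rewrite !mxE => <-.
    by apply: eq_bigr => m _; rewrite !mxE.
case: xgetP => [y _ [_ [Rv [Lv [[_ LG LR] ->]]]]|noP]; last by case: (noP v).
pose c s := Lv s s 0.
have Lc (s k : 'I_N) : Lv s k 0 = c s * lev s k.
  pose x m := if insub m is Some k' then Lv s k' 0 else 0.
  have xE (m : 'I_N) : x m = Lv s m 0 by rewrite /x valK.
  rewrite -xE (left_eigenvector_unique (s := s)) ?xE// => m.
  move/matrixP: (LG s) => /(_ 0 m); rewrite !mxE xE => <-.
  by apply: eq_bigr => m' _; rewrite xE mxE.
have LRc (s r : 'I_N) : c s * \sum_(k < N) lev s k * Rv r k 0 = (s == r)%:R.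
  move/matrixP: (LR s r) => /(_ 0 0); rewrite !mxE eqxx mulr1n => <-.
  by rewrite mulr_sumr; apply: eq_bigr => k _; rewrite mxE Lc mulrA.
have c0 s : c s != 0.
  apply/negP => /eqP c0; have := LRc s s; rewrite c0 mul0r eqxx => /eqP.
  by rewrite eq_sym oner_eq0.
(* Rescaled by [c], the vectors [Rv] are the columns of a right inverse of [left_mx], hence of its
   inverse. *)
have Rc (r k : 'I_N) : Rv r k 0 = invmx left_mx k r / c r.
  pose Rm : 'M[R[i]]_N := \matrix_(k, r) (Rv r k 0 * c r).
  have LRm : left_mx *m Rm = 1%:M.
    apply/matrixP => s r'; rewrite !mxE.
    under eq_bigr do rewrite !mxE mulrA.
    rewrite -mulr_suml -[X in _ = X](mulfK (c0 s)).
    have := LRc s r'; have [<- e|sr] := eqVneq s r'.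
      by rewrite mulrC e mulfK.
    by move=> /eqP; rewrite mulf_eq0 (negPf (c0 s))/= => /eqP ->; rewrite !mul0r.
  have -> : invmx left_mx = Rm.
    by rewrite -[RHS]mul1mx -(mulVmx lu) -mulmxA LRm mulmx1.
  by rewrite mxE mulfK.
rewrite !scalar /v.
transitivity ((\sum_k (c j)^-1^*%C * (c i)^-1 * ((invmx left_mx k j)^*%C * invmx left_mx k i)) *
   (\sum_(k < N) (c j)^*%C * c i * ((lev j k)^*%C * lev i k))).
  by congr (_ * _); apply: eq_bigr => k _; rewrite ?Rc ?Lc rmorphM; ring.
rewrite -!mulr_sumr mulrACA -[RHS]mul1r; congr (_ * _).
by rewrite mulrACA -rmorphM !mulVf// rmorph1 mul1r.
Qed.

Let invmx_left_mx (v w : 'cV[R[i]]_N) : left_mx *m v = w -> invmx left_mx *m w = v.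
Proof. by move=> <-; rewrite mulmxA mulVmx ?mul1mx// left_mx_unit. Qed.

Let left_mx0 : left_mx *m delta_mx 0 0 = delta_mx 0 0 :> 'cV_N.
Proof.
apply/colP => s; rewrite -colE !mxE eqxx andbT.
by have [->|s0] := eqVneq s 0; rewrite ?left_eigenvector_eq// left_eigenvector_lt ?lt0n.
Qed.

(** The right eigenvector for z lives in the leading 2 x 2 block, so the inverse of [left_mx] is
    needed in its first two columns only. *)
Let left_mx1 :
  left_mx *m (delta_mx 1 0 - lev 0 1 *: delta_mx 0 0) = delta_mx 1 0 :> 'cV_N.
Proof.
rewrite mulmxBr -scalemxAr left_mx0 -colE; apply/colP => s; rewrite !mxE eqxx !andbT.
case: (unliftP 0 s) => [s'|] -> /=; last by rewrite mulr1 subrr.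
rewrite mulr0 subr0; case: (unliftP 0 s') => [s''|] -> /=.
  by rewrite left_eigenvector_lt.
by rewrite left_eigenvector_eq.
Qed.

Let invmx_left_mx0 (k : 'I_N) : invmx left_mx k 0 = (k == 0)%:R.
Proof.
have /colP/(_ k) := invmx_left_mx left_mx0.
by rewrite -colE !mxE eqxx andbT.
Qed.

Let invmx_left_mx1 (k : 'I_N) :
  invmx left_mx k 1 = (k == 1)%:R - lev 0 1 * (k == 0)%:R.
Proof.
have /colP/(_ k) := invmx_left_mx left_mx1.
by rewrite -colE !mxE eqxx !andbT.
Qed.

Let sum01 (F : 'I_N -> R[i]) : (forall k, k != 0 -> k != 1 -> F k = 0) ->
  \sum_k F k = F 0 + F 1.
Proof.
move=> F0; rewrite (bigD1 0)//= (bigD1 1)//= big1 ?addr0// => k /andP[].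
exact: F0.
Qed.

Let invmx_left_mx01 : [/\ invmx left_mx 0 0 = 1, invmx left_mx 1 0 = 0,
  invmx left_mx 0 1 = - lev 0 1 & invmx left_mx 1 1 = 1].
Proof.
by rewrite !invmx_left_mx0 !invmx_left_mx1 /= mulr1 mulr0 subr0 sub0r.
Qed.

Let invmx_left_mx_ge2 k : k != 0 -> k != 1 ->
  invmx left_mx k 0 = 0 /\ invmx left_mx k 1 = 0.
Proof.
move=> /negPf k0 /negPf k1.
by rewrite invmx_left_mx0 invmx_left_mx1 k0 k1 mulr0 subr0.
Qed.

Let dot r s := \sum_(k < N) lev r k * (lev s k)^*%C.

Let dotE r s : \sum_(k < N) (lev s k)^*%C * lev r k = dot r s.
Proof. by apply: eq_bigr => k _; rewrite mulrC. Qed.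

Lemma overlap_triangular00 :
  overlap G (fun i : 'I_N => lam i) 0 0 = dot 0 0.
Proof.
rewrite overlap_triangular dotE sum01 => [|k /invmx_left_mx_ge2 H /H[-> _]];
  last by rewrite mulr0.
by have [-> -> _ _] := invmx_left_mx01; rewrite rmorph1 rmorph0 !mulr0 addr0 !mul1r.
Qed.

Lemma overlap_triangular11 :
  overlap G (fun i : 'I_N => lam i) 1 1 = (1 + lev 0 1 * (lev 0 1)^*%C) * dot 1 1.
Proof.
rewrite overlap_triangular dotE sum01 => [|k /invmx_left_mx_ge2 H /H[_ ->]];
  last by rewrite mulr0.
by have [_ _ -> ->] := invmx_left_mx01; rewrite rmorph1 rmorphN; ring.
Qed.

Lemma overlap_triangular01 :
  overlap G (fun i : 'I_N => lam i) 0 1 = - (lev 0 1)^*%C * dot 0 1.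
Proof.
rewrite overlap_triangular dotE sum01 => [|k /invmx_left_mx_ge2 H /H[-> _]];
  last by rewrite mulr0.
by have [-> -> -> ->] := invmx_left_mx01; rewrite rmorph1 rmorphN; ring.
Qed.

End triangular_overlap.

(** * Closed forms and determinants *)

Section closed_forms.
Context (R : realType).
Implicit Types (x delta : R) (k n : nat).

Lemma partial_exp0S k delta :
  partial_exp 0 k.+1 delta = partial_exp 0 k delta + delta ^+ k.+1 / k.+1`!%:R.
Proof. by rewrite /partial_exp /= big_nat_recr. Qed.

Lemma partial_exp00 delta : partial_exp 0 0 delta = 1.
Proof. by rewrite /partial_exp /= big_nat1 expr0 fact0 divr1. Qed.

Lemma partial_exp1 k delta : partial_exp 1 k delta = partial_exp 0 k delta - 1.
Proof.
rewrite /partial_exp /= [in RHS]big_ltn// expr0 fact0 divr1; ring.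
Qed.

(** For k < 2 the formula rests on the sign convention for reversed ranges; it lets all k be treated
    alike. *)
Lemma partial_exp3 k delta :
  partial_exp 3 k delta = partial_exp 0 k delta - (1 + delta + delta ^+ 2 / 2).
Proof.
have e0 : \sum_(0 <= i < 3) delta ^+ i / i`!%:R = 1 + delta + delta ^+ 2 / 2.
  by rewrite !big_nat_recr//= big_geq// !factS fact0 !mul1n; field.
rewrite -e0 /partial_exp leq0n; case: ifPn => [k3|].
  by rewrite [in RHS](big_cat_nat (n := 3))//=; ring.
rewrite -ltnNge => k3.
by rewrite [X in _ - X](big_cat_nat (n := k.+1))//=; [ring|exact: ltnW].
Qed.

Lemma partial_exp_gt0 k delta : 0 < delta -> 0 < partial_exp 1 k.+1 delta.
Proof.
move=> d0; rewrite /partial_exp/= big_ltn// ltr_pwDl//.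
  by rewrite divr_gt0 ?exprn_gt0.
by apply: sumr_ge0 => i _; rewrite divr_ge0// exprn_ge0// ltW.
Qed.

(* [norm_poly] and [overlap_poly] are the determinants of the moment matrices of
   the squared Vandermonde product against |w|^2 |z - w|^2 exp(- N |w|^2) and
   against its product with the overlap factor, once the common diagonal scaling
   pi i! / N^(i + 3) is factored out of row i. *)
Definition norm_poly delta n : R :=
  n`!%:R * n.+1`!%:R * partial_exp 1 n.+1 delta / delta.

Definition overlap_poly x delta n : R := norm_poly delta n * d_ n x delta.

Lemma norm_poly_rec delta n : delta != 0 ->
  norm_poly delta n.+2 =
  (n%:R + 2) * (n%:R + 3 + delta) * norm_poly delta n.+1
  - delta * (n%:R + 1) * (n%:R + 2) ^+ 2 * norm_poly delta n.
Proof.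
move=> d0; rewrite /norm_poly !partial_exp1 !partial_exp0S !factS !natrM !exprS.
(* With the truncated exponential, delta^n, n! and n replaced by free variables, the recurrence
   becomes an identity of rational functions. *)
move: (partial_exp 0 n delta) (delta ^+ n) => s q.
have : n`!%:R != 0 :> R by rewrite pnatr_eq0 -lt0n fact_gt0.
move: (n`!%:R) => f f0.
rewrite -![n.+3%:R]natr1 -![n.+2%:R]natr1 -![n.+1%:R]natr1.
have n1 : n%:R + 1 != 0 :> R by rewrite natr1 pnatr_eq0.
have n2 : n%:R + 1 + 1 != 0 :> R by rewrite !natr1 pnatr_eq0.
have n3 : n%:R + 1 + 1 + 1 != 0 :> R by rewrite !natr1 pnatr_eq0.
move: n1 n2 n3; move: (n%:R : R) => v n1 n2 n3.
field.
by rewrite d0 f0 n1 n2 n3.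
Qed.

Lemma norm_poly0 delta : delta != 0 -> norm_poly delta 0 = 1.
Proof.
move=> d0; rewrite /norm_poly partial_exp1 partial_exp0S partial_exp00 !factS fact0.
by field.
Qed.

Lemma norm_poly1 delta : delta != 0 -> norm_poly delta 1 = delta + 2.
Proof.
move=> d0; rewrite /norm_poly partial_exp1 !partial_exp0S partial_exp00 !factS fact0.
by field.
Qed.

Lemma norm_poly_gt0 delta n : 0 < delta -> 0 < norm_poly delta n.
Proof.
by move=> d0; rewrite /norm_poly divr_gt0// mulr_gt0 ?partial_exp_gt0//.
Qed.

Section overlap_poly.
Variables (x delta : R).
Hypotheses (d0 : 0 < delta) (x0 : x != 0) (x1 : x - 1 != 0) (dx : delta = x - x^-1).

(** The denominator e_1^(n+1)(delta) of [d_] cancels, leaving an expression linear in the truncated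
    exponential, ready for the same generalization. *)
Let overlap_polyE n : overlap_poly x delta n =
  n`!%:R * n.+1`!%:R * (n%:R + 2) * (n%:R + 3) / delta *
  (u_ n x / (x - 1) ^+ 2 * partial_exp 3 n delta - delta * u_ n x / (2 * x)
   + ((x - 1) ^+ 2)^-1 *
     ((x ^+ 2 + (n%:R + 2) * x + (n%:R + 1) * (n%:R + 3)) / n.+3`!%:R) *
     delta ^+ n.+1).
Proof.
have e0 : partial_exp 1 n.+1 delta != 0 by rewrite gt_eqF ?partial_exp_gt0.
rewrite /overlap_poly /norm_poly /d_ !addn1 !addn2 !addn3.
rewrite -[n.+3%:R]natr1 -[n.+2%:R]natr1 -[n.+1%:R]natr1.
have -> : n%:R + 1 + 1 + 1 = n%:R + 3 :> R by ring.
have -> : n%:R + 1 + 1 = n%:R + 2 :> R by ring.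
have key e f p q w : e != 0 ->
    f * e / delta * (p * q / e * w) = f * p * q / delta * w.
  by move=> e0'; field; rewrite e0' gt_eqF.
exact: key.
Qed.

(** The coefficients are those of the expansion of the tridiagonal moment matrix of the overlap
    weight; 1 - x is the eigenvalue of the second column matrix. *)
Lemma overlap_poly_rec n :
  overlap_poly x delta n.+2 =
  ((n%:R + 2) * (n%:R + 5) + delta * (n%:R + 3) + 1 - x) * overlap_poly x delta n.+1
  - delta * (n%:R + 1) * (n%:R + 3) ^+ 2 * overlap_poly x delta n.
Proof.
rewrite !overlap_polyE /u_ !addn3 !partial_exp3 !partial_exp0S !factS !natrM !exprS.
move: (partial_exp 0 n delta) (delta ^+ n) => s q.
have : n`!%:R != 0 :> R by rewrite pnatr_eq0 -lt0n fact_gt0.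
move: (n`!%:R) => f f0.
rewrite -![n.+4.+1%:R]natr1 -![n.+4%:R]natr1 -![n.+3%:R]natr1 -![n.+2%:R]natr1 -![n.+1%:R]natr1.
have n1 : n%:R + 1 != 0 :> R by rewrite natr1 pnatr_eq0.
have n2 : n%:R + 1 + 1 != 0 :> R by rewrite !natr1 pnatr_eq0.
have n3 : n%:R + 1 + 1 + 1 != 0 :> R by rewrite !natr1 pnatr_eq0.
have n4 : n%:R + 1 + 1 + 1 + 1 != 0 :> R by rewrite !natr1 pnatr_eq0.
have n5 : n%:R + 1 + 1 + 1 + 1 + 1 != 0 :> R by rewrite !natr1 pnatr_eq0.
move: n1 n2 n3 n4 n5; move: (n%:R : R) => v n1 n2 n3 n4 n5.
(* Replacing delta by x - 1/x turns the division by delta into one by x^2 - 1, nonzero because delta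
   > 0. *)
have xx : x ^+ 2 - 1 != 0.
  apply: contraTneq d0 => xx; rewrite dx (_ : x - x^-1 = (x ^+ 2 - 1) / x); last by field.
  by rewrite xx mul0r ltxx.
by rewrite dx; field; rewrite x0 f0 n1 n2 n3 n4 n5 x1 -expr2 xx.
Qed.

Let xx : x ^+ 2 - 1 != 0.
Proof.
apply: contraTneq d0 => xx; rewrite dx (_ : x - x^-1 = (x ^+ 2 - 1) / x); last by field.
by rewrite xx mul0r ltxx.
Qed.

Lemma overlap_poly0 : overlap_poly x delta 0 = 1.
Proof.
rewrite overlap_polyE /u_ partial_exp3 partial_exp00 !factS fact0 dx.
by field; rewrite x0 x1 -expr2 xx.
Qed.

Lemma overlap_poly1 : overlap_poly x delta 1 = 5 - x + 2 * delta.
Proof.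
rewrite overlap_polyE /u_ partial_exp3 partial_exp0S partial_exp00 !factS fact0 dx.
by field; rewrite x0 x1 -expr2 xx.
Qed.

End overlap_poly.
End closed_forms.

(** * Integrals against the squared Vandermonde determinant *)

Section andreief.
Context (R : realType) (n : nat).
Variables (h : plane R -> R[i]) (m : nat -> nat -> R[i]).
Hypothesis hm : forall i j,
  has_cintegral (lebesgueC R) (fun w => toC w ^+ i * (toC w)^*%C ^+ j * h w) (m i j).

Lemma normc_sqrC (x : R[i]) : (normc x ^+ 2)%:C = x * x^*%C.
Proof.
rewrite normc_sqr; case: x => a b; apply/eqP; rewrite eq_complex/=.
by apply/andP; split; apply/eqP; ring.
Qed.

Lemma vandermonde_sqr (l : 'I_n -> R[i]) :
  (\prod_(j < n) \prod_(k < n | (j < k)%N) normc (l j - l k) ^+ 2)%:C =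
  \sum_(s : 'S_n) \sum_(r : 'S_n) (-1) ^+ s * (-1) ^+ r *
     \prod_k (l k ^+ s k * (l k)^*%C ^+ r k).
Proof.
pose V := Vandermonde n (\row_k l k).
have detV : \det V = \sum_(s : 'S_n) (-1) ^+ s * \prod_k l k ^+ s k.
  rewrite -det_tr; apply: eq_bigr => s _; congr (_ * _).
  by apply: eq_bigr => k _; rewrite !mxE.
have detVC : (\det V)^*%C = \sum_(s : 'S_n) (-1) ^+ s * \prod_k (l k)^*%C ^+ s k.
  rewrite detV rmorph_sum; apply: eq_bigr => s _; rewrite rmorphM rmorph_sign.
  by congr (_ * _); rewrite rmorph_prod; apply: eq_bigr => k _; rewrite rmorphXn.
transitivity (\det V * (\det V)^*%C).
  rewrite det_Vandermonde rmorph_prod rmorph_prod -big_split; apply: eq_bigr => j _.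
  rewrite !rmorph_prod -big_split; apply: eq_bigr => k _.
  by rewrite !mxE; apply: etrans (normc_sqrC _) _; rewrite -opprB rmorphN mulrNN.
rewrite detVC detV big_distrlr; apply: eq_bigr => s _; apply: eq_bigr => r _.
by rewrite big_split mulrACA.
Qed.

(** Expanding both determinants over permutations s and r factorizes the integral over the points.
    For fixed s, the signed sum over r is the determinant of the row-permuted moment matrix, whose
    sign cancels that of s: n! equal terms. *)
Lemma andreief :
  has_cintegral (tuple_measure (lebesgueC R) n)
    (fun t => (\prod_(j < n) \prod_(k < n | (j < k)%N)
                 normc (toC (tnth t j) - toC (tnth t k)) ^+ 2)%:C *
              \prod_(k < n) h (tnth t k))
    (n`!%:R * \det (\matrix_(i < n, j < n) m i j)).
Proof.
set M := (\matrix_(_, _) _).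
have H (s r : 'S_n) := has_cintegralZ ((-1) ^+ s * (-1) ^+ r) (has_cintegral_tuple
  (fun k => hm (s k) (r k))).
have {}H := has_cintegral_sum (index_enum 'S_n) (P := xpredT) (fun s _ =>
  has_cintegral_sum (index_enum 'S_n) (P := xpredT) (fun r _ => H s r)).
have -> : n`!%:R * \det M = \sum_(s : 'S_n) \sum_(r : 'S_n)
    (-1) ^+ s * (-1) ^+ r * \prod_k m (s k) (r k).
  transitivity (\sum_(s : 'S_n) \det M).
    by rewrite sumr_const card_Sn mulr_natl.
  apply: eq_bigr => s _.
  transitivity ((-1) ^+ s * \det (row_perm s M)).
    by rewrite row_permE det_mulmx det_perm mulrA -signr_addb addbb mul1r.
  rewrite mulr_sumr; apply: eq_bigr => r _; rewrite mulrA; congr (_ * _).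
  by apply: eq_bigr => k _; rewrite !mxE.
move: H; congr has_cintegral; apply/funext => t.
rewrite vandermonde_sqr mulr_suml; apply: eq_bigr => s _.
rewrite mulr_suml; apply: eq_bigr => r _.
by rewrite -[RHS]mulrA; congr (_ * _); rewrite -big_split.
Qed.

End andreief.

Section tridiagonal.
Context (K : comNzRingType) (m : nat -> nat -> K).
Hypothesis m0 : forall i j, (i.+1 < j)%N -> m i j = 0 /\ m j i = 0.
Local Notation D n := (\det (\matrix_(i < n, j < n) m i j)).

Let bump_n k : bump k k = k.+1.
Proof. by rewrite /bump leqnn. Qed.

Let bump_lt k i : (i < k)%N -> bump k i = i.
Proof. by move=> ik; rewrite /bump leqNgt ik. Qed.

(** The last row has two entries; the minor of the off-diagonal one is expanded along its last
    column, where a single entry survives. *)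
Lemma det_tridiagonal n :
  D n.+2 = m n.+1 n.+1 * D n.+1 - m n.+1 n * m n n.+1 * D n.
Proof.
rewrite (expand_det_row _ ord_max) big_ord_recr big_ord_recr/= big1; last first.
  move=> i _; rewrite mxE; have in1 : (i.+1 < n.+1)%N by rewrite ltnS.
  by have [_ ->] := m0 in1; rewrite mul0r.
rewrite add0r addrC; congr (_ + _).
  rewrite mxE; congr (_ * _); rewrite /cofactor -signr_odd oddD addbb mul1r.
  by congr (\det _); apply/matrixP => i j; rewrite !mxE !lift_max.
rewrite mxE/= /cofactor (expand_det_col _ ord_max) big_ord_recr big1 ?add0r; last first.
  move=> i _; rewrite !mxE/=; set a := m _ _; suff -> : a = 0 by rewrite mul0r.
  have ilt := ltn_ord i; have in1 : (i.+1 < n.+1)%N by [].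
  by rewrite /a bump_n bump_lt 1?ltnW//; have [] := m0 in1.
rewrite /= add0r !mxE/= bump_n bump_lt// /cofactor.
rewrite -signr_odd oddD/= addNb addbb/= mulN1r -[_ ^+ (_ + _)]signr_odd oddD addbb mul1r.
rewrite mulrN mulrA; congr (- (_ * \det _)).
apply/matrixP => i j; rewrite !mxE/=.
by rewrite !(bump_lt (ltn_ord _)) (bump_lt (leqW (ltn_ord i))).
Qed.

End tridiagonal.

(** Only products of symmetric off-diagonal entries enter the recurrence, so the phase of z
    disappears and a real sequence P remains once the scales [c] are factored out. *)
Lemma det_tridiagonal_scaled (R : realType) (m : nat -> nat -> R[i]) (c dg od P : nat -> R) n :
  (forall i j, (i.+1 < j)%N -> m i j = 0 /\ m j i = 0) ->
  (forall k, m k k = (c k * dg k)%:C) ->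
  (forall k, m k.+1 k * m k k.+1 = (c k * c k.+1 * od k)%:C) ->
  P 0%N = 1 -> P 1%N = dg 0%N ->
  (forall k, P k.+2 = dg k.+1 * P k.+1 - od k * P k) ->
  \det (\matrix_(i < n, j < n) m i j) = ((\prod_(i < n) c i) * P n)%:C.
Proof.
move=> m0 mdg mod P0 P1 PS.
have D0 : \det (\matrix_(i < 0, j < 0) m i j) = ((\prod_(i < 0) c i) * P 0%N)%:C.
  by rewrite det_mx00 big_ord0 P0 mulr1.
have D1 : \det (\matrix_(i < 1, j < 1) m i j) = ((\prod_(i < 1) c i) * P 1%N)%:C.
  by rewrite det_mx11 mxE mdg big_ord1 P1.
suff [] : \det (\matrix_(i < n, j < n) m i j) = ((\prod_(i < n) c i) * P n)%:C /\
  \det (\matrix_(i < n.+1, j < n.+1) m i j) = ((\prod_(i < n.+1) c i) * P n.+1)%:C by [].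
elim: n => [//|k [IH1 IH2]]; split => //.
rewrite det_tridiagonal// IH1 IH2 mdg mod -!rmorphM -rmorphB; congr (_%:C).
by rewrite !big_ord_recr/= PS; ring.
Qed.

Section weight_moments.
Context (R : realType) (N : nat) (z : R[i]).
Hypothesis N0 : (0 < N)%N.
Let NR : 0 < N%:R :> R. Proof. by rewrite ltr0n. Qed.
Let N_neq0 : N%:R != 0 :> R. Proof. by rewrite gt_eqF. Qed.

Let g a b : R[i] := if a == b then (pi * a`!%:R / N%:R ^+ a.+1)%:C else 0.

(** Here p and q are the squared distances themselves, the inverses of those in [eigenvalue_factor].
    The triple (1, 0, 0) is the weight of the density, and (1, 1/N, (1 - x)/N^2) its product with
    the factor for mu = 1 - x. *)
Definition weight (s0 s1 s2 : R[i]) (w : plane R) : R[i] :=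
  let l := toC w in let p := l * l^*%C in let q := (z - l) * (z - l)^*%C in
  (s0 * (p * q) + s1 * (p + q) + s2) * (expR (- (N%:R * normc l ^+ 2)))%:C.

Definition weight_moment (s0 s1 s2 : R[i]) i j : R[i] :=
  s0 * (z * z^*%C * g i.+1 j.+1 - z^*%C * g i.+2 j.+1 - z * g i.+1 j.+2 + g i.+2 j.+2) +
  s1 * (2 * g i.+1 j.+1 + z * z^*%C * g i j - z^*%C * g i.+1 j - z * g i j.+1) +
  s2 * g i j.

Lemma has_cintegral_weight s0 s1 s2 i j :
  has_cintegral (lebesgueC R)
    (fun w => toC w ^+ i * (toC w)^*%C ^+ j * weight s0 s1 s2 w)
    (weight_moment s0 s1 s2 i j).
Proof.
have H a b := has_cintegral_complex_gauss NR a b.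
pose s : seq (R[i] * (nat * nat)) := [:: (s0 * (z * z^*%C), (i.+1, j.+1));
  (- s0 * z^*%C, (i.+2, j.+1)); (- s0 * z, (i.+1, j.+2)); (s0, (i.+2, j.+2));
  (s1 * 2, (i.+1, j.+1)); (s1 * (z * z^*%C), (i, j)); (- s1 * z^*%C, (i.+1, j));
  (- s1 * z, (i, j.+1)); (s2, (i, j))].
have := has_cintegral_sum s (P := xpredT) (fun x _ => has_cintegralZ x.1 (H x.2.1 x.2.2)).
have -> : weight_moment s0 s1 s2 i j = \sum_(x <- s) x.1 * g x.2.1 x.2.2.
  by rewrite /s !big_cons big_nil /weight_moment /=; ring.
congr has_cintegral; apply/funext => w.
rewrite /s !big_cons big_nil /weight.
have -> : (z - toC w)^*%C = z^*%C - (toC w)^*%C by exact: rmorphB.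
move: (toC w) ((toC w)^*%C) (expR _)%:C => l lc e.
by cbn [fst snd]; rewrite !exprS; ring.
Qed.

Let gE a b : a != b -> g a b = 0. Proof. by rewrite /g => /negPf ->. Qed.

(** Multiplication by p = |l|^2 keeps the difference of the exponents of l and conj(l), and by q =
    |z - l|^2 changes it by at most one. *)
Lemma weight_moment_band s0 s1 s2 i j : (i.+1 < j)%N ->
  weight_moment s0 s1 s2 i j = 0 /\ weight_moment s0 s1 s2 j i = 0.
Proof.
move=> ij; rewrite /weight_moment; split; rewrite !gE; try ring;
  by apply/eqP; lia.
Qed.

Let delta := N%:R * normc z ^+ 2.
Let c k : R := pi * k`!%:R / N%:R ^+ k.+3.
Let Nz : z * z^*%C = (delta / N%:R)%:C.
Proof. by rewrite -normc_sqrC /delta mulrC mulKf. Qed.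

Let gd k : g k k = (pi * k`!%:R / N%:R ^+ k.+1)%:C. Proof. by rewrite /g eqxx. Qed.

Let weight_momentD s0 s1 s2 k : weight_moment s0%:C s1%:C s2%:C k k =
  (c k * (s0 * (delta * k.+1%:R + k.+1%:R * k.+2%:R) +
    N%:R * s1 * (2 * k.+1%:R + delta) + N%:R ^+ 2 * s2))%:C.
Proof.
have e1 a : g a.+1 a = 0 by apply: gE; apply/eqP; lia.
have e2 a : g a a.+1 = 0 by apply: gE; apply/eqP; lia.
rewrite /weight_moment !e1 !e2.
rewrite !gd Nz !mulr0 !subr0 -(rmorph_nat (real_complex R) 2).
rewrite -!rmorphM -!rmorphD -!rmorphM -!rmorphD; congr (_%:C).
rewrite /c !factS !natrM !exprS; field.
by rewrite N_neq0 expf_neq0.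
Qed.

Let weight_momentU s0 s1 s2 k :
  weight_moment s0%:C s1%:C s2%:C k.+1 k * weight_moment s0%:C s1%:C s2%:C k k.+1 =
  (c k * c k.+1 * (delta * k.+1%:R * (s0 * k.+2%:R + N%:R * s1) ^+ 2))%:C.
Proof.
have e0 a : g a.+1 a = 0 by apply: gE; apply/eqP; lia.
have e1 a : g a a.+1 = 0 by apply: gE; apply/eqP; lia.
have e2 a : g a.+2 a = 0 by apply: gE; apply/eqP; lia.
have e3 a : g a a.+2 = 0 by apply: gE; apply/eqP; lia.
have -> : weight_moment s0%:C s1%:C s2%:C k.+1 k =
    - z * (s0%:C * g k.+2 k.+2 + s1%:C * g k.+1 k.+1).
  by rewrite /weight_moment !(e0, e1, e2, e3); ring.
have -> : weight_moment s0%:C s1%:C s2%:C k k.+1 =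
    - z^*%C * (s0%:C * g k.+2 k.+2 + s1%:C * g k.+1 k.+1).
  by rewrite /weight_moment !(e0, e1, e2, e3); ring.
rewrite mulrACA mulrNN Nz !gd -!rmorphM -!rmorphD -!rmorphM; congr (_%:C).
rewrite /c !factS !natrM !exprS; field.
by rewrite N_neq0 expf_neq0.
Qed.

Lemma det_overlap_weight (x : R) n : 0 < delta -> x != 0 -> x - 1 != 0 ->
  delta = x - x^-1 ->
  \det (\matrix_(i < n, j < n)
    weight_moment 1%:C (N%:R^-1)%:C ((1 - x) / N%:R ^+ 2)%:C i j) =
  ((\prod_(i < n) c i) * overlap_poly x delta n)%:C.
Proof.
move=> d0 x0 x1 dx.
(* The entries left by s0 = 1, s1 = 1/N and s2 = (1 - x)/N^2 after the scale [c] is removed; all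
   powers of N cancel. *)
pose dg i := delta * i.+1%:R + i.+1%:R * i.+2%:R + 2 * i.+1%:R + delta + (1 - x).
pose od i := delta * i.+1%:R * i.+3%:R ^+ 2.
apply: (det_tridiagonal_scaled (dg := dg) (od := od)).
- by move=> i j; exact: weight_moment_band.
- move=> k; rewrite weight_momentD; congr (_%:C); rewrite /dg; field.
  exact: N_neq0.
- move=> k; rewrite weight_momentU; congr (_%:C); rewrite /od mulfV//.
  by rewrite -[k.+3%:R]natr1; ring.
- exact: overlap_poly0.
- by rewrite overlap_poly1// /dg; ring.
- move=> k; rewrite overlap_poly_rec// /dg /od.
  by rewrite -![k.+3%:R]natr1 -![k.+2%:R]natr1 -![k.+1%:R]natr1; ring.
Qed.

Lemma det_norm_weight n : 0 < delta ->
  \det (\matrix_(i < n, j < n) weight_moment 1%:C 0%:C 0%:C i j) =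
  ((\prod_(i < n) c i) * norm_poly delta n)%:C.
Proof.
move=> d0.
have d0' : delta != 0 by rewrite gt_eqF.
pose dg i := delta * i.+1%:R + i.+1%:R * i.+2%:R : R.
pose od i := delta * i.+1%:R * i.+2%:R ^+ 2.
apply: (det_tridiagonal_scaled (dg := dg) (od := od)).
- by move=> i j; exact: weight_moment_band.
- by move=> k; rewrite weight_momentD; congr (_%:C); rewrite /dg; ring.
- by move=> k; rewrite weight_momentU; congr (_%:C); rewrite /od; ring.
- exact: norm_poly0.
- by rewrite norm_poly1// /dg; ring.
- move=> k; rewrite norm_poly_rec// /dg /od.
  by rewrite -![k.+3%:R]natr1 -![k.+2%:R]natr1 -![k.+1%:R]natr1; ring.
Qed.

End weight_moments.

(** * Integration against the law of the Schur form *)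

Section density.
Context d (T : measurableType d) (R : realType).
Variables (nu mu : {measure set T -> \bar R}) (h : T -> R).
Hypotheses (mh : measurable_fun setT h) (h0 : forall x, 0 <= h x).
Hypothesis nuE : forall A, measurable A -> nu A = (\int[mu]_(x in A) (h x)%:E)%E.

Import HBNNSimple.

(** True for indicators by [nuE], for simple functions by linearity, and in general by monotone
    convergence. *)
Lemma ge0_integral_density (g : T -> R) :
  measurable_fun setT g -> (forall x, 0 <= g x) ->
  (\int[nu]_x (g x)%:E = \int[mu]_x (g x * h x)%:E)%E.
Proof.
move=> mg g0.
have mg' : measurable_fun setT (EFin \o g) by exact/measurable_EFinP.
pose f_ := nnsfun_approx measurableT mg'.
have cf x : (f_ n x)%:E @[n --> \oo] --> (g x)%:E.
  by apply: cvg_nnsfun_approx => //= y _; rewrite lee_fin.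
have nd x m n : (m <= n)%N -> f_ m x <= f_ n x.
  by move=> mn; exact/lefP/nd_nnsfun_approx.
transitivity (limn (fun n => \int[nu]_x (f_ n x)%:E))%E.
  rewrite -monotone_convergence//.
  - by apply: eq_integral => y _; apply/esym/cvg_lim => //; exact: cf.
  - by move=> n; exact/measurable_EFinP.
  - by move=> n y _; rewrite lee_fin.
  - by move=> y _ m n mn; rewrite lee_fin; exact: nd.
rewrite (_ : (fun n => _) = (fun n => \int[mu]_x (f_ n x * h x)%:E)%E); last first.
  apply/funext => n.
  transitivity (\sum_(k \in range (f_ n))
      \int[nu]_x (k * \1_(f_ n @^-1` [set k]) x)%:E)%E.
    under eq_integral do rewrite fimfunE -fsumEFin//.
    rewrite ge0_integral_fsum//; last first.
      by move=> y x _; rewrite nnfun_muleindic_ge0.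
    by move=> y; apply/measurable_EFinP; apply: measurable_funM => //; exact: measurable_indic.
  transitivity (\sum_(k \in range (f_ n))
      \int[mu]_x (k * \1_(f_ n @^-1` [set k]) x * h x)%:E)%E.
    apply: eq_fsbigr => r; rewrite inE => -[y _ <-].
    under eq_integral do rewrite EFinM.
    rewrite ge0_integralZl//; last 2 first.
    - by apply/measurable_EFinP; exact: measurable_indic.
    - by rewrite lee_fin.
    rewrite integral_indic// setIT nuE//.
    under [RHS]eq_integral do rewrite -mulrA EFinM.
    rewrite ge0_integralZl//; last 3 first.
    - by apply/measurable_EFinP; apply: measurable_funM => //; exact: measurable_indic.
    - by move=> x _; rewrite lee_fin mulr_ge0.
    - by rewrite lee_fin.
    congr (_ * _)%E; rewrite integral_mkcond; apply: eq_integral => x _.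
    by rewrite patchE indicE; case: (_ \in _); rewrite ?mul1r ?mul0r.
  rewrite -ge0_integral_fsum//.
  - apply: eq_integral => x _; rewrite fsumEFin// [in RHS]fimfunE; congr (_%:E).
    rewrite !fsbig_finite//= big_distrl/=; apply: eq_bigr => i _. by [].
  - move=> r; apply/measurable_EFinP; apply: measurable_funM => //.
    by apply: measurable_funM => //; exact: measurable_indic.
  - move=> r x _; rewrite EFinM; apply: mule_ge0; last by rewrite lee_fin.
    by rewrite EFinM nnfun_muleindic_ge0.
rewrite -monotone_convergence//.
- apply: eq_integral => y _; apply/cvg_lim => //.
  under eq_fun do rewrite EFinM; rewrite EFinM.
  by apply: cvgeZr => //; exact: cf.
- by move=> n; apply/measurable_EFinP; apply: measurable_funM.
- by move=> n y _; rewrite lee_fin mulr_ge0.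
- by move=> y _ m n mn; rewrite lee_fin ler_wpM2r// nd.
Qed.

End density.

Section complex_measurable.
Context d (T : measurableType d) (R : realType).
Implicit Types f g : T -> R[i].

Definition complex_measurable f :=
  measurable_fun setT (fun x => complex.Re (f x)) /\
  measurable_fun setT (fun x => complex.Im (f x)).

Lemma eq_complex_measurable f g : f =1 g -> complex_measurable f -> complex_measurable g.
Proof. by move=> /funext ->. Qed.

Lemma complex_measurable_cst c : complex_measurable (fun=> c).
Proof. by split; exact: measurable_cst. Qed.

Lemma complex_measurable_real (f : T -> R) :
  measurable_fun setT f -> complex_measurable (fun x => (f x)%:C).
Proof. by split => //; exact: measurable_cst. Qed.

Lemma complex_measurableD f g : complex_measurable f -> complex_measurable g ->
  complex_measurable (fun x => f x + g x).
Proof.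
by move=> [fr fi] [gr gi]; split; under eq_fun do rewrite raddfD; exact: measurable_funD.
Qed.

Lemma complex_measurableM f g : complex_measurable f -> complex_measurable g ->
  complex_measurable (fun x => f x * g x).
Proof.
move=> [fr fi] [gr gi]; split.
  under eq_fun do rewrite complexRe_mul.
  by apply: measurable_funB; exact: measurable_funM.
under eq_fun do rewrite complexIm_mul.
by apply: measurable_funD; exact: measurable_funM.
Qed.

Lemma complex_measurableN f : complex_measurable f -> complex_measurable (fun x => - f x).
Proof.
move=> fm; have := complex_measurableM (complex_measurable_cst (-1)) fm.
by under eq_fun do rewrite mulN1r.
Qed.

Lemma complex_measurableJ f : complex_measurable f -> complex_measurable (fun x => (f x)^*%C).
Proof.
move=> [fr fi]; split; first by under eq_fun do rewrite complexRe_conj.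
by under eq_fun do rewrite complexIm_conj; exact: measurableT_comp.
Qed.

(** On nonnegative reals the inverse is the power of exponent -1, including at 0, where both are
    0. *)
Lemma measurable_inv_ge0 (f : T -> R) : measurable_fun setT f ->
  (forall x, 0 <= f x) -> measurable_fun setT (fun x => (f x)^-1).
Proof.
move=> mf f0; under eq_fun do rewrite -powR_inv1//.
by apply: (measurableT_comp (measurable_powR _)).
Qed.

Lemma complex_measurableV f : complex_measurable f -> complex_measurable (fun x => (f x)^-1).
Proof.
move=> fm; have [fr fi] := fm.
have E x : (f x)^-1 = ((normc (f x) ^+ 2)^-1)%:C * (f x)^*%C.
  rewrite normc_sqr; case: (f x) => a b; apply/eqP; rewrite eq_complex/=.
  by apply/andP; split; apply/eqP; ring.
under eq_fun do rewrite E.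
apply: complex_measurableM; last exact: complex_measurableJ.
apply: complex_measurable_real; apply: measurable_inv_ge0 => [|x]; last exact: sqr_ge0.
exact: measurable_normc_sqr.
Qed.

Lemma complex_measurable_sum (I : Type) (s : seq I) (P : pred I) (f : I -> T -> R[i]) :
  (forall i, P i -> complex_measurable (f i)) ->
  complex_measurable (fun x => \sum_(i <- s | P i) f i x).
Proof.
move=> mf; elim: s => [|i s IH].
  by under eq_fun do rewrite big_nil; exact: complex_measurable_cst.
under eq_fun do rewrite big_cons; case Pi: (P i) => //.
by apply: complex_measurableD => //; exact: mf.
Qed.

Lemma complex_measurableX f k : complex_measurable f -> complex_measurable (fun x => f x ^+ k).
Proof.
move=> mf; elim: k => [|k IH].
  by under eq_fun do rewrite expr0; exact: complex_measurable_cst.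
by under eq_fun do rewrite exprS; exact: complex_measurableM.
Qed.

End complex_measurable.

(** * The Schur form as a measurable function of its coordinates *)

Section schur.
Context (R : realType) (n : nat) (z : R[i]).
Local Notation N := n.+2.
Local Notation I := (upper N).
Local Notation mu1 := (tuple_measure (lebesgueC R) n).
Local Notation mu2 := (tuple_measure (lebesgueC R) #|{: I}|).
Implicit Types (w : schur_space R n) (l : n.-tuple (plane R)).

Definition schur_eigenvalue l (k : nat) : R[i] :=
  nth 0 [:: 0, z & [seq toC x | x <- l]] k.

Lemma schur_eigenvalueSS l (k : 'I_n) : schur_eigenvalue l k.+2 = toC (tnth l k).
Proof.
rewrite /schur_eigenvalue /= (nth_map (tnth l k)) ?size_tuple//.
by rewrite -tnth_nth.
Qed.

Lemma complex_measurable_toC d (T : measurableType d) (f : T -> plane R) :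
  measurable_fun setT f -> complex_measurable (fun x => toC (f x)).
Proof.
move=> mf; split.
  exact: (measurableT_comp measurable_fst mf).
exact: (measurableT_comp measurable_snd mf).
Qed.

Lemma complex_measurable_eigenvalue k :
  complex_measurable (fun w => schur_eigenvalue w.1 k).
Proof.
case: k => [|[|k]]; [exact: complex_measurable_cst..|].
have [kn|nk] := ltnP k n.
  apply: (eq_complex_measurable (f := fun w : schur_space R n => toC (tnth w.1 (Ordinal kn)))).
    by move=> w; rewrite -schur_eigenvalueSS.
  apply: complex_measurable_toC.
  exact: (measurableT_comp (measurable_tnth (Ordinal kn)) measurable_fst).
apply: (eq_complex_measurable (f := fun=> 0)); last exact: complex_measurable_cst.
by move=> w; rewrite /schur_eigenvalue /= nth_default ?size_map ?size_tuple.
Qed.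

Lemma complex_measurable_entry i k :
  complex_measurable (fun w => entry (tuple_fun w.2) i k).
Proof.
rewrite /entry; case: insub => [u|]; last exact: complex_measurable_cst.
apply: complex_measurable_toC.
exact: (measurableT_comp (measurable_tnth (enum_rank u)) measurable_snd).
Qed.

Definition schur_left_eigenvector w s k : R[i] :=
  left_eigenvector (schur_eigenvalue w.1) (entry (tuple_fun w.2)) s k.

Lemma complex_measurable_left_eigenvector s k :
  complex_measurable (fun w => schur_left_eigenvector w s k).
Proof.
rewrite /schur_left_eigenvector; elim/ltn_ind: k => k IH.
have [ks|sk|<-] := ltngtP k s.
- apply: (eq_complex_measurable (f := fun=> 0)); last exact: complex_measurable_cst.
  by move=> w; rewrite left_eigenvector_lt.
- apply: eq_complex_measurable => [w|]; first by rewrite left_eigenvector_gt//; reflexivity.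
  apply: complex_measurableM.
    apply: complex_measurable_sum => i _; apply: complex_measurableM; first exact: IH.
    exact: complex_measurable_entry.
  apply: complex_measurableV; apply: complex_measurableD.
    exact: complex_measurable_eigenvalue.
  by apply: complex_measurableN; exact: complex_measurable_eigenvalue.
- apply: (eq_complex_measurable (f := fun=> 1)); last exact: complex_measurable_cst.
  by move=> w; rewrite left_eigenvector_eq.
Qed.

Definition schur_left_dot w r s : R[i] :=
  left_dot (schur_eigenvalue w.1) r s N (tuple_fun w.2).

Lemma complex_measurable_left_dot r s :
  complex_measurable (fun w => schur_left_dot w r s).
Proof.
apply: complex_measurable_sum => i _; apply: complex_measurableM.
  exact: complex_measurable_left_eigenvector.
by apply: complex_measurableJ; exact: complex_measurable_left_eigenvector.
Qed.

Definition schur_beta w : R[i] := beta (schur_eigenvalue w.1) (tuple_fun w.2).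

Lemma complex_measurable_beta : complex_measurable schur_beta.
Proof.
have m01 := complex_measurable_left_eigenvector 0 1.
exact: complex_measurableM m01 (complex_measurableJ m01).
Qed.

End schur.

Section schur_overlaps.
Context (R : realType) (n : nat) (z : R[i]).
Hypothesis z0 : z != 0.
Local Notation N := n.+2.
Local Notation I := (upper N).
Local Notation lam := (schur_eigenvalue z).
Implicit Types (w : schur_space R n) (l : n.-tuple (plane R)).

Lemma normc_sqr_eq0 (x : R[i]) : (normc x ^+ 2 == 0) = (x == 0).
Proof.
rewrite sqrf_eq0; apply/eqP/eqP => [/eq0_normc//|->].
by rewrite /= expr0n addr0 sqrtr0.
Qed.

(** The density vanishes exactly on coincidences: it has a factor for each pair among 0, z and the
    free eigenvalues, except the pair (0, z), which [z0] covers. *)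
Lemma eigenvalue_weight_neq0 l : (eigenvalue_weight z l != 0) <->
  (forall i j : 'I_N, lam l i = lam l j -> i = j).
Proof.
have SS (k : 'I_n) := schur_eigenvalueSS z l k.
rewrite /eigenvalue_weight mulf_eq0 negb_or; split.
  move=> /andP[/prodf_neq0 V /prodf_neq0 W].
  have l0 (k : 'I_n) : lam l k.+2 != 0.
    by have := W k isT; rewrite 2!mulf_eq0 !negb_or SS !normc_sqr_eq0 => /andP[/andP[]].
  have lz (k : 'I_n) : lam l k.+2 != z.
    have := W k isT; rewrite 2!mulf_eq0 !negb_or SS !normc_sqr_eq0 subr_eq0 eq_sym.
    by move=> /andP[/andP[_]]; rewrite eq_sym.
  have lt i j : (i < j < N)%N -> lam l i != lam l j.
    case: j => [|[|j]]; rewrite ?ltn0 ?andbF// => /andP[ij jN].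
      by case: i ij => // _; rewrite eq_sym.
    have jn : (j < n)%N by [].
    case: i ij => [|[|i]] ij; first by rewrite eq_sym (l0 (Ordinal jn)).
      by rewrite eq_sym (lz (Ordinal jn)).
    have ij' : (i < j)%N by [].
    have := V (Ordinal (ltn_trans ij' jn)) isT => /prodf_neq0/(_ (Ordinal jn) ij').
    by rewrite normc_sqr_eq0 subr_eq0 -!SS.
  move=> i j e; apply/val_inj; case: (ltngtP i j) => // h.
    by have := lt i j; rewrite h ltn_ord => /(_ isT); rewrite e eqxx.
  by have := lt j i; rewrite h ltn_ord => /(_ isT); rewrite e eqxx.
move=> inj; have neq (i j : nat) : (i < N)%N -> (j < N)%N -> i != j -> lam l i != lam l j.
  move=> iN jN ij; apply: contra ij => /eqP e.
  by have /(congr1 val)/= -> := inj (Ordinal iN) (Ordinal jN) e.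
apply/andP; split; apply/prodf_neq0 => k _.
  apply/prodf_neq0 => j kj; rewrite normc_sqr_eq0 subr_eq0 -!SS neq//.
  - by rewrite !ltnS.
  - by rewrite !ltnS.
  - by rewrite !eqSS ltn_eqF.
have kN : (k.+2 < N)%N by rewrite !ltnS.
apply: mulf_neq0; last by rewrite gt_eqF ?expR_gt0.
apply: mulf_neq0; rewrite normc_sqr_eq0 -SS.
  exact: (neq k.+2 0%N kN isT isT).
by rewrite subr_eq0; exact: (neq 1%N k.+2 isT kN isT).
Qed.

Lemma schur_mxE w (i j : 'I_N) : schur_mx z w i j =
  if i == j then lam w.1 i else
  if (i < j)%N then entry (tuple_fun w.2) i j else 0.
Proof.
rewrite mxE; case: ifP => // _; rewrite /entry !inord_val.
by case: insubP => [u /= -> _//|/= /negPf ->].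
Qed.

(** An explicit expression, measurable and nonnegative everywhere, standing in for the overlap,
    which is defined by choice; they agree when the eigenvalues are distinct. *)
Definition offdiag_overlap w : R[i] :=
  schur_beta z w * (schur_left_dot z w 0 1 * schur_left_dot z w 1 0).

Definition diag_overlap w : R[i] :=
  (1 + schur_beta z w) * (schur_left_dot z w 0 0 * schur_left_dot z w 1 1).

Lemma schur_overlap_degenerate w (i j : 'I_N) :
  eigenvalue_weight z w.1 = 0 -> schur_overlap z i j w = 0.
Proof.
move=> w0; rewrite /schur_overlap /overlap; case: xgetP => // y _ [inj _].
have := (eigenvalue_weight_neq0 w.1).2 inj.
by rewrite w0 eqxx.
Qed.

Lemma schur_overlap_offdiag w : eigenvalue_weight z w.1 != 0 ->
  `|schur_overlap z 0 1 w| ^+ 2 = offdiag_overlap w.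
Proof.
move=> /eigenvalue_weight_neq0 inj.
have := overlap_triangular01 (schur_mxE w) inj.
rewrite -/(schur_overlap z 0 1 w) => ->.
have E (b c : R[i]) : `|- b^*%C * c| ^+ 2 = b * b^*%C * (c * c^*%C).
  by rewrite sqr_normc rmorphM rmorphN/= conjcK; ring.
rewrite E; congr (_ * (_ * _)); exact: left_dotC.
Qed.

Lemma schur_overlap_diag w : eigenvalue_weight z w.1 != 0 ->
  schur_overlap z 0 0 w * schur_overlap z 1 1 w = diag_overlap w.
Proof.
move=> /eigenvalue_weight_neq0 inj.
rewrite [X in X * _](overlap_triangular00 (schur_mxE w) inj).
by rewrite [X in _ * X](overlap_triangular11 (schur_mxE w) inj) mulrCA.
Qed.

Lemma schur_left_dot_ge0 w r : 0 <= schur_left_dot z w r r.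
Proof. by apply: sumr_ge0 => i _; exact: mulcJ_ge0. Qed.

Lemma schur_beta_ge0 w : 0 <= schur_beta z w.
Proof. exact: mulcJ_ge0. Qed.

Lemma offdiag_overlap_ge0 w : 0 <= offdiag_overlap w.
Proof.
apply: mulr_ge0; first exact: schur_beta_ge0.
have <- : (schur_left_dot z w 0 1)^*%C = schur_left_dot z w 1 0 by exact: left_dotC.
exact: mulcJ_ge0.
Qed.

Lemma diag_overlap_ge0 w : 0 <= diag_overlap w.
Proof.
apply: mulr_ge0; first by rewrite addr_ge0 ?schur_beta_ge0.
by apply: mulr_ge0; exact: schur_left_dot_ge0.
Qed.

Lemma complex_measurable_offdiag_overlap : complex_measurable offdiag_overlap.
Proof.
apply: complex_measurableM; first exact: complex_measurable_beta.
by apply: complex_measurableM; exact: complex_measurable_left_dot.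
Qed.

Lemma complex_measurable_diag_overlap : complex_measurable diag_overlap.
Proof.
apply: complex_measurableM.
  apply: complex_measurableD; first exact: complex_measurable_cst.
  exact: complex_measurable_beta.
by apply: complex_measurableM; exact: complex_measurable_left_dot.
Qed.

Local Notation mu1 := (tuple_measure (lebesgueC R) n).
Local Notation mu2 := (tuple_measure (lebesgueC R) #|{: I}|).

(** Tonelli's theorem, available since [X] is nonnegative: for fixed eigenvalues the inner integral
    is a Gaussian mean. At coincident eigenvalues, where the mean is not controlled, the density is
    zero. *)
Lemma integral_schur_density (X : schur_space R n -> R[i])
    (F : n.-tuple (plane R) -> (I -> R[i]) -> R[i]) (f : n.-tuple (plane R) -> R[i]) S v :
  complex_measurable X -> (forall w, 0 <= X w) ->
  (forall w, X w = F w.1 (tuple_fun w.2)) ->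
  (forall l, eigenvalue_weight z l != 0 -> is_poly N S (F l) /\ mean N (F l) = f l) ->
  has_cintegral mu1 (fun l => (eigenvalue_weight z l)%:C * f l) v ->
  (\int[sfproduct mu1 mu2]_w (complex.Re (X w) * schur_density z w)%:E =
   (complex.Re v)%:E)%E.
Proof.
move=> [mX _] X0 XF Ff [[_ fv] _].
have mXd : measurable_fun setT (fun w => (complex.Re (X w) * schur_density z w)%:E).
  by apply/measurable_EFinP; apply: measurable_funM => //; exact: measurable_schur_density.
rewrite (fubini_tonelli1 (m1 := mu1) (m2 := mu2) _ mXd); last first.
  move=> w; rewrite lee_fin mulr_ge0 ?schur_density_ge0//.
  by have := X0 w; rewrite lecE => /andP[].
rewrite -fv; apply: eq_integral => l _; rewrite /fubini_F.
have [w0|w0] := eqVneq (eigenvalue_weight z l) 0.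
  rewrite w0 mul0r; apply: integral0_eq => t _.
  by rewrite /schur_density w0 mul0r mulr0.
have [Fp Fm] := Ff _ w0.
have [Fr _] := mean_integral (ltn0Sn _) Fp.
have [_ H] := has_integralZ (eigenvalue_weight z l) Fr.
transitivity (eigenvalue_weight z l * complex.Re (mean N (F l)))%:E; last first.
  by rewrite Fm complexRe_mul /= mul0r subr0.
rewrite -H; apply: eq_integral => t _; congr (_%:E).
by rewrite XF /schur_density complexRe_mul /= mulr0 subr0; ring.
Qed.

End schur_overlaps.

(** * Integrals over the free eigenvalues *)

Section overlap_integrals.
Context (R : realType) (n : nat) (z : R[i]).
Hypothesis z0 : z != 0.
Local Notation N := n.+2.
Local Notation I := (upper N).
Local Notation lam := (schur_eigenvalue z).
Local Notation mu1 := (tuple_measure (lebesgueC R) n).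
Let N0 : (0 < N)%N := ltn0Sn _.
Let delta : R := N%:R * normc z ^+ 2.
Let d0 : 0 < delta.
Proof. by rewrite mulr_gt0 ?ltr0n// lt_def normc_sqr_eq0 z0 sqr_ge0. Qed.

Definition base_weight (p : plane R) : R :=
  normc (toC p) ^+ 2 * normc (z - toC p) ^+ 2 * expR (- (N%:R * normc (toC p) ^+ 2)).

Definition factor_weight (x : R) (p : plane R) : R[i] :=
  (base_weight p)%:C * eigenvalue_factor n z (1 - x)%:C (toC p).

Let base_weightC p : (base_weight p)%:C =
  toC p * (toC p)^*%C * ((z - toC p) * (z - toC p)^*%C) *
  (expR (- (N%:R * normc (toC p) ^+ 2)))%:C.
Proof. by rewrite -!normc_sqrC -!rmorphM. Qed.

Lemma base_weightE p : (base_weight p)%:C = weight N z 1%:C 0%:C 0%:C p.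
Proof. by rewrite base_weightC /weight rmorph1 rmorph0 mul0r !addr0 mul1r. Qed.

(** The factors |l|^2 |z - l|^2 of the density clear the denominators of [eigenvalue_factor]. *)
Lemma factor_weightE x p : toC p != 0 -> toC p != z ->
  factor_weight x p = weight N z 1%:C (N%:R^-1)%:C ((1 - x) / N%:R ^+ 2)%:C p.
Proof.
move=> p0 pz; rewrite /factor_weight /eigenvalue_factor base_weightC.
have -> : ((1 - x) / N%:R ^+ 2)%:C = (1 - x)%:C / N%:R ^+ 2 :> R[i].
  by rewrite rmorphM fmorphV rmorphXn rmorph_nat.
have -> : (N%:R^-1)%:C = N%:R^-1 :> R[i] by rewrite fmorphV rmorph_nat.
rewrite /weight rmorph1 mul1r.
have P0 : toC p * (toC p)^*%C != 0 by rewrite mulf_neq0 ?conjc_eq0.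
have Q0 : (z - toC p) * (z - toC p)^*%C != 0.
  by rewrite mulf_neq0 ?conjc_eq0 ?subr_eq0 1?eq_sym.
have NC : N%:R != 0 :> R[i] by rewrite pnatr_eq0.
set P := toC p * _ in P0 *; set Q := (z - _) * _ in Q0 *.
set e := (expR _)%:C; set M := N%:R in NC *; clearbody P Q e M.
by field; rewrite NC P0 Q0.
Qed.

Lemma complex_measurable_base_weight : complex_measurable (fun p => (base_weight p)%:C).
Proof.
have mt : complex_measurable (fun p : plane R => toC p) by exact: complex_measurable_toC.
have mq : complex_measurable (fun p : plane R => z - toC p).
  by apply: complex_measurableD; [exact: complex_measurable_cst|exact: complex_measurableN].
have mp2 : measurable_fun setT (fun p : plane R => normc (toC p) ^+ 2).
  by case: mt; exact: measurable_normc_sqr.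
apply: complex_measurable_real; apply: measurable_funM.
  by apply: measurable_funM => //; case: mq; exact: measurable_normc_sqr.
apply: (measurableT_comp (@measurable_expR R)).
by apply: measurableT_comp => //; exact: measurable_funM.
Qed.

Lemma complex_measurable_factor_weight x : complex_measurable (factor_weight x).
Proof.
apply: complex_measurableM; first exact: complex_measurable_base_weight.
have mt : complex_measurable (fun p : plane R => toC p) by exact: complex_measurable_toC.
have mq : complex_measurable (fun p : plane R => z - toC p).
  by apply: complex_measurableD; [exact: complex_measurable_cst|exact: complex_measurableN].
have mc c := @complex_measurable_cst _ (plane R) R c.
have mP := complex_measurableV (complex_measurableM mt (complex_measurableJ mt)).
have mQ := complex_measurableV (complex_measurableM mq (complex_measurableJ mq)).
exact: complex_measurableD
  (complex_measurableD (mc 1) (complex_measurableM (complex_measurableD mP mQ) (mc _)))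
  (complex_measurableM (complex_measurableM (mc _) (complex_measurableM mP mQ)) (mc _)).
Qed.

Let set1_pair (p : plane R) : [set p] = [set p.1] `*` [set p.2].
Proof.
by case: p => a b; apply/seteqP; split => [[c e] [-> ->]//|[c e] [/= -> ->]].
Qed.

Lemma lebesgueC_point (p : plane R) : lebesgueC R [set p] = 0%E.
Proof.
rewrite set1_pair.
rewrite [LHS]product_measure1E; [|exact: measurable_set1..].
by rewrite [X in (X * _)%E](lebesgue_measure_set1 p.1) mul0e.
Qed.

Lemma measurable_point (p : plane R) : measurable [set p].
Proof.
rewrite set1_pair.
by apply: measurableX; exact: measurable_set1.
Qed.

(* Since 0^-1 = 0, [factor_weight] vanishes at 0 and z instead of extending the
   polynomial [weight]: the two agree only almost everywhere. *)
Lemma has_cintegral_factor_weight x i j :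
  has_cintegral (lebesgueC R)
    (fun p => toC p ^+ i * (toC p)^*%C ^+ j * factor_weight x p)
    (weight_moment N z 1%:C (N%:R^-1)%:C ((1 - x) / N%:R ^+ 2)%:C i j).
Proof.
have := has_cintegral_weight z N0 1%:C (N%:R^-1)%:C ((1 - x) / N%:R ^+ 2)%:C i j.
have [mr mi] : complex_measurable (fun p : plane R =>
    toC p ^+ i * (toC p)^*%C ^+ j * factor_weight x p).
  have mt : complex_measurable (fun p : plane R => toC p) by exact: complex_measurable_toC.
  apply: complex_measurableM; last exact: complex_measurable_factor_weight.
  by apply: complex_measurableM; apply: complex_measurableX => //; exact: complex_measurableJ.
apply: has_cintegral_ae => //.
pose pz : plane R := (complex.Re z, complex.Im z).
exists ([set (0, 0)] `|` [set pz]); split.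
- by apply: measurableU; exact: measurable_point.
- apply/eqP; rewrite eq_le measure_ge0 andbT.
  apply: le_trans (measureU2 _ _ _) _; [exact: measurable_point..|].
  rewrite [X in (X + _ <= _)%E](lebesgueC_point (0, 0)).
  by rewrite [X in (_ + X <= _)%E](lebesgueC_point pz) adde0.
- move=> p /= /not_implyP[_]; apply: contra_notP => /not_orP[p0 pz0].
  rewrite factor_weightE//.
  + by apply/eqP => -[p1 p2]; apply: p0; case: p p1 p2 {pz0} => a b /= -> ->.
  + by apply/eqP => pE; apply: pz0; rewrite /pz -pE; case: p {p0 pE}.
Qed.

Definition factor_prod (x : R) (l : n.-tuple (plane R)) : R[i] :=
  \prod_(2 <= k < N) eigenvalue_factor n z (1 - x)%:C (lam l k).

(** The n! of Andreief's formula times the diagonal scales; common to both determinants, it cancels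
    in the conditional mean. *)
Let c : R := n`!%:R * \prod_(i < n) (pi * i`!%:R / N%:R ^+ i.+3).

Let c_gt0 : 0 < c.
Proof.
rewrite /c mulr_gt0 ?ltr0n ?fact_gt0//; apply: prodr_gt0 => i _.
by rewrite divr_gt0 ?exprn_gt0 ?ltr0n// mulr_gt0 ?pi_gt0// ltr0n fact_gt0.
Qed.

Let eigenvalue_weightE (l : n.-tuple (plane R)) :
  (eigenvalue_weight z l)%:C =
  (\prod_(j < n) \prod_(k < n | (j < k)%N)
     normc (toC (tnth l j) - toC (tnth l k)) ^+ 2)%:C *
  \prod_(k < n) (base_weight (tnth l k))%:C.
Proof. by rewrite -rmorph_prod -rmorphM. Qed.

Lemma has_cintegral_eigenvalue_weight :
  has_cintegral mu1 (fun l => (eigenvalue_weight z l)%:C) (c * norm_poly delta n)%:C.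
Proof.
have hm i j : has_cintegral (lebesgueC R)
    (fun p => toC p ^+ i * (toC p)^*%C ^+ j * (base_weight p)%:C)
    (weight_moment N z 1%:C 0%:C 0%:C i j).
  have := has_cintegral_weight z N0 1%:C 0%:C 0%:C i j.
  by congr has_cintegral; apply/funext => p; rewrite base_weightE.
have := andreief n hm; rewrite det_norm_weight//.
have -> : n`!%:R * ((\prod_(i < n) (pi * i`!%:R / N%:R ^+ i.+3)) * norm_poly delta n)%:C
    = (c * norm_poly delta n)%:C :> R[i].
  by rewrite /c -(rmorph_nat (real_complex R)) -rmorphM; congr (_%:C); ring.
by congr has_cintegral; apply/funext => l; rewrite eigenvalue_weightE.
Qed.

Lemma has_cintegral_factor_prod (x : R) : x != 0 -> x - 1 != 0 -> delta = x - x^-1 ->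
  has_cintegral mu1 (fun l => (eigenvalue_weight z l)%:C * factor_prod x l)
    (c * norm_poly delta n * d_ n x delta)%:C.
Proof.
move=> x0 x1 dx; have := andreief n (has_cintegral_factor_weight x).
rewrite (det_overlap_weight N0 n d0 x0 x1 dx).
have -> : n`!%:R * ((\prod_(i < n) (pi * i`!%:R / N%:R ^+ i.+3)) * overlap_poly x delta n)%:C
    = (c * norm_poly delta n * d_ n x delta)%:C :> R[i].
  rewrite /c -(rmorph_nat (real_complex R)) -rmorphM /overlap_poly; congr (_%:C); ring.
congr has_cintegral; apply/funext => l.
rewrite eigenvalue_weightE -mulrA; congr (_ * _).
rewrite /factor_prod 2!big_add1/= big_mkord -big_split; apply: eq_bigr => k _.
by rewrite schur_eigenvalueSS.
Qed.

Let a := a_ delta.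

(** The numbers a and -1/a are the two roots of X^2 - delta X - 1, so they add up to delta; and a >
    1 because delta > 0. *)
Lemma a_delta_facts : [/\ a != 0, a + 1 != 0, a - 1 != 0 & delta = a - a^-1].
Proof.
have s1 : 1 <= Num.sqrt (1 + delta ^+ 2 / 4).
  rewrite -[leLHS]sqrtr1; apply: ler_wsqrtr.
  by rewrite lerDl divr_ge0// sqr_ge0.
have a1 : 1 < a by rewrite /a /a_ ltr_pwDl// divr_gt0.
have aV : - a^-1 = delta / 2 - Num.sqrt (1 + delta ^+ 2 / 4) := b_E delta.
split; try by (apply/eqP; lra).
by rewrite aV /a /a_; field.
Qed.

Lemma has_cintegral_combination (u v : R) :
  has_cintegral mu1 (fun l => (eigenvalue_weight z l)%:C *
    ((1 + a ^+ 2)^-1%:C * (u%:C * factor_prod a l + v%:C * factor_prod (b_ delta) l)))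
    (c * norm_poly delta n * ((1 + a ^+ 2)^-1 *
      (u * d_ n a delta + v * d_ n (b_ delta) delta)))%:C.
Proof.
have [a0 ap am da] := a_delta_facts.
have H1 := has_cintegral_factor_prod a0 am da.
(* b = -1/a solves the same equation delta = x - 1/x, and b - 1 = - (a + 1)/a is nonzero. *)
have H2 : has_cintegral mu1 (fun l => (eigenvalue_weight z l)%:C * factor_prod (b_ delta) l)
    (c * norm_poly delta n * d_ n (b_ delta) delta)%:C.
  apply: has_cintegral_factor_prod.
  - by rewrite /b_ oppr_eq0 invr_eq0.
  - rewrite /b_ -/a (_ : - a^-1 - 1 = - (a + 1) / a); last by field.
    by rewrite mulf_neq0 ?invr_eq0// oppr_eq0.
  - by rewrite /b_ -/a invrN invrK da; ring.
have := has_cintegralZ ((1 + a ^+ 2)^-1%:C) (has_cintegralD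
  (has_cintegralZ u%:C H1) (has_cintegralZ v%:C H2)).
rewrite -!rmorphM -rmorphD -rmorphM.
have -> : (1 + a ^+ 2)^-1 * (u * (c * norm_poly delta n * d_ n a delta) +
    v * (c * norm_poly delta n * d_ n (b_ delta) delta)) =
  c * norm_poly delta n * ((1 + a ^+ 2)^-1 * (u * d_ n a delta + v * d_ n (b_ delta) delta)).
  by ring.
by congr has_cintegral; apply/funext => l; ring.
Qed.

(** Hides the value of the total mass: afterwards only its positivity and the proportionality of the
    two integrals matter. *)
Lemma overlap_integrals : exists2 Z : R, 0 < Z &
  has_cintegral mu1 (fun l => (eigenvalue_weight z l)%:C) Z%:C /\
  forall u v : R,
  has_cintegral mu1 (fun l => (eigenvalue_weight z l)%:C *
    ((1 + a ^+ 2)^-1%:C * (u%:C * factor_prod a l + v%:C * factor_prod (b_ delta) l)))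
    (Z * ((1 + a ^+ 2)^-1 * (u * d_ n a delta + v * d_ n (b_ delta) delta)))%:C.
Proof.
exists (c * norm_poly delta n); first by rewrite mulr_gt0 ?norm_poly_gt0.
split; [exact: has_cintegral_eigenvalue_weight|exact: has_cintegral_combination].
Qed.

End overlap_integrals.

Lemma mnormalizeE d (T : measurableType d) (R : realType)
    (mu : {measure set T -> \bar R}) (P : probability T R) (Z : R) A :
  mu setT = Z%:E -> Z != 0 -> mnormalize mu P A = (mu A * Z^-1%:E)%E.
Proof. by move=> muT /negPf Z0; rewrite /mnormalize muT eqe Z0. Qed.

(** * Expectations under the conditional law *)

Section schur_expectation.
Context (R : realType) (n : nat) (z : R[i]).
Hypothesis z0 : z != 0.
Local Notation N := n.+2.
Local Notation I := (upper N).
Local Notation mu := (sfproduct (tuple_measure (lebesgueC R) n)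
  (tuple_measure (lebesgueC R) #|{: I}|)).
Let delta : R := N%:R * normc z ^+ 2.

(** The case X = 1: the entries above the diagonal contribute total mass one. *)
Lemma integral_schur_density1 (Z : R) :
  has_cintegral (tuple_measure (lebesgueC R) n)
    (fun l => (eigenvalue_weight z l)%:C) Z%:C ->
  (\int[mu]_w (schur_density z w)%:E = Z%:E)%E.
Proof.
move=> HZ; have H : has_cintegral (tuple_measure (lebesgueC R) n)
    (fun l => (eigenvalue_weight z l)%:C * 1) Z%:C.
  by move: HZ; congr has_cintegral; apply/funext => l; rewrite mulr1.
have := @integral_schur_density R n z (fun=> 1) (fun _ _ => 1) (fun=> 1) predT Z%:C.
move=> /(_ (complex_measurable_cst _ 1) (fun _ => ler01) (fun _ => erefl)) E.
rewrite -[RHS]E//.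
  by apply: eq_integral => w _; rewrite mul1r.
by move=> l _; split; [exact: is_poly_cst|exact: mean_cst].
Qed.

Lemma schur_law_density (Z : R) : 0 < Z ->
  (\int[mu]_w (schur_density z w)%:E = Z%:E)%E ->
  forall A, measurable A ->
  schur_law n z A = (\int[mu]_(w in A) (Z^-1 * schur_density z w)%:E)%E.
Proof.
move=> Z0 HZ A mA; rewrite /schur_law.
apply: etrans (@mnormalizeE _ _ _ (density_measure mu (measurable_schur_density z)
  (@schur_density_ge0 R n z)) _ Z A HZ (negbT (gt_eqF Z0))) _.
under [RHS]eq_integral do rewrite EFinM.
rewrite muleC -ge0_integralZl//.
- by apply/measurable_EFinP/measurable_funTS; exact: measurable_schur_density.
- by move=> w _; rewrite lee_fin schur_density_ge0.
- by rewrite lee_fin invr_ge0 ltW.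
Qed.

(* [X] is a rational expression, meaningful only for distinct eigenvalues; the
   other configurations do not matter because the density vanishes there. *)
Lemma schur_expectation (X : schur_space R n -> R[i]) (Y : schur_space R n -> R)
    (F : n.-tuple (plane R) -> (I -> R[i]) -> R[i]) (f : n.-tuple (plane R) -> R[i])
    S (Z r : R) :
  complex_measurable X -> (forall w, 0 <= X w) ->
  (forall w, X w = F w.1 (tuple_fun w.2)) ->
  (forall w, Y w = if eigenvalue_weight z w.1 == 0 then 0 else complex.Re (X w)) ->
  (forall l, eigenvalue_weight z l != 0 -> is_poly N S (F l) /\ mean N (F l) = f l) ->
  0 < Z -> has_cintegral (tuple_measure (lebesgueC R) n)
    (fun l => (eigenvalue_weight z l)%:C) Z%:C ->
  has_cintegral (tuple_measure (lebesgueC R) n)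
    (fun l => (eigenvalue_weight z l)%:C * f l) (Z * r)%:C ->
  ('E_(schur_law n z)[Y] = r%:E)%E.
Proof.
move=> mX X0 XF YX Ff Z0 HZ Hr.
have W0 w : 0 <= eigenvalue_weight z (w : schur_space R n).1.
  apply: mulr_ge0.
    by apply: prodr_ge0 => j _; apply: prodr_ge0 => k _; exact: sqr_ge0.
  apply: prodr_ge0 => k _; apply: mulr_ge0; last exact: expR_ge0.
  by rewrite mulr_ge0 ?sqr_ge0.
have mW : measurable_fun setT (fun w : schur_space R n => eigenvalue_weight z w.1).
  exact: (measurableT_comp (measurable_eigenvalue_weight z) measurable_fst).
(* Because 0^-1 = 0, the product of the weight with its inverse is the indicator of distinct
   eigenvalues; this yields the measurability of [Y]. *)
have YE w : Y w = complex.Re (X w) * (eigenvalue_weight z w.1 * (eigenvalue_weight z w.1)^-1).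
  by rewrite YX; case: eqVneq => [->|w0]; rewrite ?mul0r ?mulr0// mulfV ?mulr1.
have XR w : 0 <= complex.Re (X w) by have := X0 w; rewrite lecE => /andP[].
have mY : measurable_fun setT Y.
  rewrite (funext YE); apply: measurable_funM; first by case: mX.
  exact: measurable_funM mW (measurable_inv_ge0 mW W0).
have Y0 w : 0 <= Y w by rewrite YX; case: ifP.
have HZ' := integral_schur_density1 HZ.
rewrite unlock (ge0_integral_density (h := fun w => Z^-1 * schur_density z w) _ _
  (schur_law_density Z0 HZ'))//; last 2 first.
- by apply: measurable_funM => //; exact: measurable_schur_density.
- by move=> w; rewrite mulr_ge0 ?invr_ge0 ?(ltW Z0) ?schur_density_ge0.
have YD w : (Y w * (Z^-1 * schur_density z w))%:E =
    (Z^-1%:E * (complex.Re (X w) * schur_density z w)%:E)%E.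
  rewrite -EFinM YX; case: eqVneq => [w0|_]; last by congr (_%:E); ring.
  by rewrite /schur_density w0 !(mul0r, mulr0).
under eq_integral do rewrite YD.
rewrite ge0_integralZl//; last 3 first.
- apply/measurable_EFinP; apply: measurable_funM; first by case: mX.
  exact: measurable_schur_density.
- by move=> w _; rewrite lee_fin mulr_ge0 ?schur_density_ge0.
- by rewrite lee_fin invr_ge0 ltW.
rewrite (integral_schur_density mX X0 XF Ff Hr) -EFinM; congr (_%:E).
by rewrite mulKf// gt_eqF.
Qed.

End schur_expectation.

Lemma complex_mean_real d (T : measurableType d) (R : realType) (P : probability T R)
    (X : T -> R[i]) (r : R) : (forall w, complex.Im (X w) = 0) ->
  ('E_P[fun w => complex.Re (X w)] = r%:E)%E -> complex_mean P X r%:C.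
Proof.
move=> X0 Xr; split => //.
by under eq_fun do rewrite X0; exact: expectation_cst.
Qed.

(** * The two overlap means in closed form *)

Section overlap_means.
Context (R : realType) (n : nat) (z : R[i]).
Hypothesis z0 : z != 0.
Local Notation N := n.+2.
Local Notation I := (upper N).
Local Notation lam := (schur_eigenvalue z).
Let delta : R := N%:R * normc z ^+ 2.
Let a : R := a_ delta.
Local Notation A := (a%:C : R[i]).

Let A_facts : [/\ A != 0, A + 1 != 0, A - 1 != 0, 1 + A ^+ 2 != 0 &
  N%:R * (z * z^*%C) = A - A^-1].
Proof.
have [a0 ap am da] := a_delta_facts n z0.
have realC_eq0 (x : R) : (x%:C == 0 :> R[i]) = (x == 0) by rewrite fmorph_eq0.
split.
- by rewrite realC_eq0.
- by rewrite -(rmorph1 (real_complex R)) -rmorphD realC_eq0.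
- by rewrite -(rmorph1 (real_complex R)) -rmorphB realC_eq0.
- rewrite -(rmorph1 (real_complex R)) -rmorphXn -rmorphD realC_eq0 gt_eqF//.
  by rewrite ltr_pwDl// sqr_ge0.
- rewrite -normc_sqrC -(rmorph_nat (real_complex R)) -fmorphV -rmorphM -rmorphB.
  by congr (_%:C).
Qed.

Let factor_prodE (l : n.-tuple (plane R)) x :
  factor_prod z x l = \prod_(2 <= k < N) eigenvalue_factor n z (1 - x%:C) (lam l k).
Proof. by rewrite /factor_prod rmorphB rmorph1. Qed.

Let b_C : (b_ delta)%:C = - A^-1.
Proof. by rewrite /b_ rmorphN fmorphV. Qed.

Let eigenvalue_ok (l : n.-tuple (plane R)) : eigenvalue_weight z l != 0 ->
  forall k, (1 < k < N)%N -> lam l k != 0 /\ lam l k != z.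
Proof.
move=> /(eigenvalue_weight_neq0 z0) inj k /andP[k1 kN]; split.
  by apply/eqP => e; have /(congr1 val)/= := inj (Ordinal kN) 0 e; move: k1 => /[swap] ->.
by apply/eqP => e; have /(congr1 val)/= := inj (Ordinal kN) 1 e; move: k1 => /[swap] ->.
Qed.

Let is_poly_beta (l : n.-tuple (plane R)) : is_poly N predT (beta (n := n) (lam l)).
Proof.
have p01 : is_poly N predT (fun t : I -> R[i] => left_eigenvector (lam l) (entry t) 0 1).
  exact: is_poly_predT (is_poly_left_eigenvector (lam l) 0 (isT : (1 < N)%N)).
by apply: is_polyM => //; exact: is_poly_conj.
Qed.

Let is_poly_dot (l : n.-tuple (plane R)) r s :
  is_poly N predT (left_dot (n := n) (lam l) r s N).
Proof. exact: is_poly_predT (is_poly_left_dot (lam l) r s (leqnn N)). Qed.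

Let ge0_Im (x : R[i]) : 0 <= x -> complex.Im x = 0.
Proof. by rewrite lecE => /andP[/eqP]. Qed.

Let real_coefE : ((1 + a ^+ 2)^-1)%:C = (1 + A ^+ 2)^-1.
Proof. by rewrite fmorphV rmorphD rmorph1 rmorphXn. Qed.

Let real_coef2E k : (a ^+ k / (a + 1) ^+ 2)%:C = A ^+ k / (A + 1) ^+ 2 /\
  (a ^+ k / (a - 1) ^+ 2)%:C = A ^+ k / (A - 1) ^+ 2.
Proof.
by split; rewrite rmorphM fmorphV !rmorphXn ?rmorphB ?rmorphD rmorph1.
Qed.

Lemma complex_mean_offdiag_overlap :
  complex_mean (schur_law n z) (fun w => `|schur_overlap z 0 1 w| ^+ 2)
    ((1 + a ^+ 2)^-1 * (a ^+ 2 / (a + 1) ^+ 2 * d_ n a delta +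
                        a ^+ 2 / (a - 1) ^+ 2 * d_ n (b_ delta) delta))%:C.
Proof.
have [A0 Ap Am A2 dA] := A_facts.
have [Z Z0 [HZ Hc]] := overlap_integrals n z0.
have {}Hc := Hc (a ^+ 2 / (a + 1) ^+ 2) (a ^+ 2 / (a - 1) ^+ 2).
apply: complex_mean_real => [w|].
  have [w0|w0] := eqVneq (eigenvalue_weight z w.1) 0.
    by rewrite (schur_overlap_degenerate z0 _ _ w0) normr0 expr0n.
  by rewrite (schur_overlap_offdiag z0 w0); exact/ge0_Im/offdiag_overlap_ge0.
apply: (schur_expectation (S := predT) (F := fun l t => beta (lam l) t *
  (left_dot (lam l) 0 1 N t * left_dot (lam l) 1 0 N t)) _ _ _ _ _ Z0 HZ Hc).
- exact: complex_measurable_offdiag_overlap.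
- exact: offdiag_overlap_ge0.
- by [].
- move=> w; rewrite -[LHS]/(complex.Re (`|schur_overlap z 0 1 w| ^+ 2)).
  case: eqVneq => [w0|w0].
    by rewrite (schur_overlap_degenerate z0 _ _ w0) normr0 expr0n.
  by rewrite (schur_overlap_offdiag z0 w0).
- move=> l w0; split.
    by apply: is_polyM => //; exact: is_polyM.
  rewrite (mean_overlap_offdiag _ _ z0 (eigenvalue_ok w0) A0 Ap Am A2 dA)//.
  have [-> _] := real_coef2E 2; have [_ ->] := real_coef2E 2.
  by rewrite !factor_prodE b_C real_coefE.
Qed.

Lemma complex_mean_diag_overlap :
  complex_mean (schur_law n z) (fun w => schur_overlap z 0 0 w * schur_overlap z 1 1 w)
    ((1 + a ^+ 2)^-1 * (1 / (a + 1) ^+ 2 * d_ n a delta +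
                        a ^+ 4 / (a - 1) ^+ 2 * d_ n (b_ delta) delta))%:C.
Proof.
have [A0 Ap Am A2 dA] := A_facts.
have [Z Z0 [HZ Hc]] := overlap_integrals n z0.
have {}Hc := Hc (1 / (a + 1) ^+ 2) (a ^+ 4 / (a - 1) ^+ 2).
apply: complex_mean_real => [w|].
  have [w0|w0] := eqVneq (eigenvalue_weight z w.1) 0.
    by rewrite (schur_overlap_degenerate z0 _ _ w0) mul0r.
  by rewrite (schur_overlap_diag z0 w0); exact/ge0_Im/diag_overlap_ge0.
apply: (schur_expectation (S := predT) (F := fun l t => (1 + beta (lam l) t) *
  (left_dot (lam l) 0 0 N t * left_dot (lam l) 1 1 N t)) _ _ _ _ _ Z0 HZ Hc).
- exact: complex_measurable_diag_overlap.
- exact: diag_overlap_ge0.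
- by [].
- move=> w; rewrite -[LHS]/(complex.Re (schur_overlap z 0 0 w * schur_overlap z 1 1 w)).
  case: eqVneq => [w0|w0].
    by rewrite (schur_overlap_degenerate z0 _ _ w0) mul0r.
  by rewrite (schur_overlap_diag z0 w0).
- move=> l w0; split.
    apply: is_polyM; last exact: is_polyM.
    by apply: is_polyD => //; exact: is_poly_cst.
  rewrite (mean_overlap_diag _ _ z0 (eigenvalue_ok w0) A0 Ap Am A2 dA)//.
  have [-> _] := real_coef2E 0; have [_ ->] := real_coef2E 4.
  by rewrite !factor_prodE b_C real_coefE expr0.
Qed.

End overlap_means.

Unset Implicit Arguments.

(* N = n + 2; the indices 1 and 2 of the paper are 0 and 1 in 'I_n.+2. *)
Theorem proposition3p6 (R : realType) (n : nat) (z : R[i]) (hz : z != 0) :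
  let N := n.+2 in
  let delta : R := N%:R * normc z ^+ 2 in
  let a := a_ delta in
  let b := b_ delta in
  let P := schur_law n z in
  let O (i j : 'I_N) := schur_overlap z i j in
  complex_mean P (fun w => `|O 0 1 w| ^+ 2)
    ((1 + a ^+ 2)^-1 *
     (a ^+ 2 / (a + 1) ^+ 2 * d_ (N - 2) a delta +
      a ^+ 2 / (a - 1) ^+ 2 * d_ (N - 2) b delta))%:C
  /\
  complex_mean P (fun w => O 0 0 w * O 1 1 w)
    ((1 + a ^+ 2)^-1 *
     (1 / (a + 1) ^+ 2 * d_ (N - 2) a delta +
      a ^+ 4 / (a - 1) ^+ 2 * d_ (N - 2) b delta))%:C.
Proof.
move=> N delta a b P O; rewrite /N subn2 /=; split.
  exact: complex_mean_offdiag_overlap.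
exact: complex_mean_diag_overlap.
Qed.
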